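(* Let $u\in H^1_0(\Omega)$ be the exact (weak) solution of the boundary value problem $-\nabla\cdot(\mu(x,|\nabla u|)\nabla u)+f(x,u)=0$ in $\Omega$, $u=0$ on $\Gamma$, i.e. $A(u,v)=0$ for all $v\in H^1_0(\Omega)$. Let $\mathcal{T}_{h,0}$ be an initial mesh with initial guess $u_{h,0}^0\in V_{{\sf FEM},0}$. Denote by $\mathcal{T}_{h,i}$ the mesh after $i$ mesh refinements, and let $u_{h,i}^n\in V_{{\sf FEM},i}$ be the FEM solution obtained after $n$ steps of the fixed point iteration $$(u_{h,i}^{n},v_h)_\Omega=(u_{h,i}^{n-1},v_h)_\Omega-L^{-2}A(u_{h,i}^{n-1},v_h)\qquad\forall v_h\in V_{{\sf FEM},i}$$ on $\mathcal{T}_{h,i}$, where for $i>0$ the initial guess $u_{h,i}^0\in V_{{\sf FEM},i}$ is obtained as an (appropriate) projection to $V_{{\sf FEM},i}$ of the last ($n^\star$-th) iterate $u_{h,i-1}^{n^\star}\in V_{{\sf FEM},i-1}$ on the mesh $\mathcal{T}_{h,i-1}$. Then, for $n\ge1$, $$|||u-u_{h,i}^{n}|||_\Omega\le C_I\Bigg(\sum_{K\in\mathcal{T}_{h,i}}\eta_K^2\Bigg)^{1/2}+L(1+L)\,|||u_{h,i}^{n}-u_{h,i}^{n-1}|||_\Omega,$$ where $C_I$ is the interpolation constant described in the context and, for $K\in\mathcal{T}_{h,i}$ and $n\ge 1$, $$\begin{aligned}\eta_K^2={}&\gamma_K\left\|f(u_{h,i}^{n-1})-\nabla\cdot\left(\mu(|\nabla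 u_{h,i}^{n-1}|)\nabla u_{h,i}^{n-1}\right)+L^2\mathsf{F}(u_{h,i}^{n}-u_{h,i}^{n-1})\right\|_{L_2(K)}^2\\&+\tfrac12\alpha_2^{-1/2}\gamma_K^{1/2}\left\|\left[\!\left[\mu(|\nabla u_{h,i}^{n-1}|)\nabla u_{h,i}^{n-1}+L^2\alpha_2\nabla(u_{h,i}^{n}-u_{h,i}^{n-1})\right]\!\right]\right\|_{L_2(\partial K\setminus\Gamma)}^2,\end{aligned}$$ with $\mathsf{F}(v)=-\alpha_2\Delta v+\beta_2v$ (applied elementwise).
   Context: $\Omega\subset\mathbb{R}^2$ is a bounded, open, polygonal Lipschitz domain with boundary $\Gamma$. The functions $\mu\in C^0(\overline\Omega\times[0,\infty))$ and $f\in C^0(\overline\Omega\times\mathbb{R})$ satisfy, with constants $\alpha_1\ge\alpha_2>0$ and $\beta_1\ge\beta_2\ge0$, $$\alpha_2(t-s)\le\mu(x,t)t-\mu(x,s)s\le\alpha_1(t-s)\quad (t\ge s\ge0,\ x\in\overline\Omega),$$ $$\beta_2(t-s)\le f(x,t)-f(x,s)\le\beta_1(t-s)\quad (t\ge s,\ x\in\overline\Omega).$$ The dependence on $x$ is suppressed: $\mu(t)=\mu(x,t)$, $f(u)=f(x,u)$. For $u,v\in H^1_0(\Omega)$, $$A(u,v)=\int_\Omega\{\mu(|\nabla u|)\nabla u\cdot\nabla v+f(u)v\}\,dx,\qquad (u,v)_\Omega=\int_\Omega\{\alpha_2\nabla u\cdot\nabla v+\beta_2uv\}\,dx,$$ and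 $|||v|||_\Omega^2=(v,v)_\Omega=\alpha_2\|\nabla v\|_{L_2(\Omega)}^2+\beta_2\|v\|_{L_2(\Omega)}^2$. With $C_P>0$ (depending only on $\Omega$) a constant such that $\|v\|_{L_2(\Omega)}\le C_P\|\nabla v\|_{L_2(\Omega)}$ for all $v\in H^1_0(\Omega)$, set $$L=\frac{\alpha_1+\max(\beta_1,\alpha_1\beta_2/\alpha_2)\,C_P^2}{\alpha_2+\beta_2C_P^2}\ (\ge1).$$ Meshes: $\{\mathcal{T}_{h,i}\}_{i\ge0}$ is a sequence of regular (no hanging nodes), shape-regular partitions of $\Omega$ into open disjoint triangles and/or parallelograms $K$ with diameters $h_K$. For a fixed polynomial degree $p\ge1$, $V_{{\sf FEM},i}=\{v\in H^1_0(\Omega): v|_K\in\mathcal{S}_p(K)\ \forall K\in\mathcal{T}_{h,i}\}$, where $\mathcal{S}_p(K)$ is the space of polynomials of total degree at most $p$ if $K$ is a triangle, and of polynomials of degree at most $p$ in each variable if $K$ is a parallelogram. For each $K$, $$\gamma_K=\begin{cases}\min(\alpha_2^{-1}h_K^2,\beta_2^{-1})&\text{if }\beta_2\ne0,\\ \alpha_2^{-1}h_K^2&\text{otherwise.}\end{cases}$$ Jumps: for an edge $e\subset\partial K^+\cap\partial K^-$ between two neighbouring elements $K^\pm$, and a vector-valued function $\boldsymbol v$ with traces $\boldsymbol v^\pm$ on $e$ taken from the interior of $K^\pm$, $[\![\boldsymbol v]\!]|_e=\boldsymbol v^+|_e\cdot\boldsymbol n_{K^+}+\boldsymbol v^-|_e\cdot\boldsymbol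 n_{K^-}$, where $\boldsymbol n_{K^\pm}$ are the unit outward normals on $\partial K^\pm$. Interpolation constant: let $\pi:H^1_0(\Omega)\to V_{{\sf FEM},i}$ be the Clément quasi-interpolation operator, that is, $\pi v=\sum_j (P_jv)(x_j)\,\varphi_j$, where $\varphi_j$ are the Lagrange nodal basis functions of $V_{{\sf FEM},i}$ with nodes $x_j$ in the interior of $\Omega$ and $P_j$ is the $L_2(S_j)$-projection onto polynomials of total degree at most $p$ on the support $S_j$ of $\varphi_j$. $C_I>0$ is a constant, independent of the local element sizes, such that for all $v\in H^1_0(\Omega)$ $$\sum_{K\in\mathcal{T}_{h,i}}\left(\gamma_K^{-1}\|v-\pi v\|_{L_2(K)}^2+\alpha_2\|\nabla(v-\pi v)\|_{L_2(K)}^2+\tfrac12\alpha_2^{1/2}\gamma_K^{-1/2}\|v-\pi v\|_{L_2(\partial K)}^2\right)\le C_I^2|||v|||_\Omega^2 .$$ Convention: the divergence in $\eta_K$ is taken in the sense of distributions on $K$; if the residual is not in $L_2(K)$ then $\eta_K=+\infty$. *)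

(* Defs.v *)
From HB Require Import structures.
From mathcomp Require Import all_boot all_order all_algebra.
From mathcomp Require Import all_classical all_reals all_analysis.

Set Implicit Arguments.
Unset Strict Implicit.
Unset Printing Implicit Defensive.

Import Order.TTheory GRing.Theory Num.Theory.
Import numFieldNormedType.Exports.

Local Open Scope classical_set_scope.
Local Open Scope ring_scope.

Notation plane R := (R * R)%type.
(* The Borel sigma-algebra and the topology on the plane are those of the
   library product; the library norm on it is the sup norm, so the Euclidean
   norm is [enorm]. *)
Definition leb2 (R : realType) : set (plane R) -> \bar R :=
  (@lebesgue_measure R \x @lebesgue_measure R)%E.

Definition dot (R : realType) (x y : plane R) : R := x.1 * y.1 + x.2 * y.2.
Definition cross (R : realType) (x y : plane R) : R := x.1 * y.2 - x.2 * y.1.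
Definition enorm (R : realType) (x : plane R) : R := Num.sqrt (dot x x).

Definition bdry (T : topologicalType) (A : set T) : set T :=
  closure A `\` interior A.

Definition diam (R : realType) (A : set (plane R)) : R :=
  sup [set enorm (x - y) | x in A & y in A].

Definition edge (R : realType) : Type := (plane R * plane R)%type.
Definition param (R : realType) (e : edge R) (s : R) : plane R :=
  e.1 + s *: (e.2 - e.1).
Definition segment (R : realType) (e : edge R) : set (plane R) :=
  param e @` `[0, 1].
Definition same_edge (R : realType) (e e' : edge R) : bool :=
  (e == e') || (e == (e'.2, e'.1)).

(* In suitable orthonormal coordinates (s, t) centred at any boundary point,
   the domain is locally the region above the graph of a Lipschitz function. *)
Definition lipschitz_boundary (R : realType) (Om : set (plane R)) : Prop :=
  forall x, bdry Om x ->
  exists (nu : plane R) (r h k : R) (g : R -> R),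
    [/\ enorm nu = 1, 0 < r, 0 < h, k.-lipschitz g &
        forall s t, `|s| < r -> `|t| < h ->
          (Om (x + s *: ((nu.2, - nu.1) : plane R) + t *: nu) <-> g s < t)].

Definition polygonal (R : realType) (Om : set (plane R)) : Prop :=
  exists es : seq (edge R),
    bdry Om = [set x | exists2 e, e \in es & segment e x].

Definition polygonal_lipschitz_domain (R : realType) (Om : set (plane R)) :=
  [/\ Om !=set0, connected Om & open Om] /\
  [/\ bounded_set Om, polygonal Om & lipschitz_boundary Om].

(* C^oo: every iterated directional derivative is differentiable everywhere. *)
Definition smooth (R : realType) (phi : plane R -> R) : Prop :=
  forall (vs : seq (plane R)) (x : plane R),
    differentiable (foldr (fun v g => 'D_v g) phi vs) x.

Definition test_fun (R : realType) (D : set (plane R)) (phi : plane R -> R) :=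
  smooth phi /\
  exists C, [/\ compact C, C `<=` D & forall x, ~ C x -> phi x = 0].

Definition cgrad (R : realType) (v : plane R -> R) (x : plane R) : plane R :=
  ('D_((1, 0) : plane R) v x, 'D_((0, 1) : plane R) v x).
Definition claplace (R : realType) (v : plane R -> R) (x : plane R) : R :=
  'D_((1, 0) : plane R) ('D_((1, 0) : plane R) v) x
  + 'D_((0, 1) : plane R) ('D_((0, 1) : plane R) v) x.

Definition L2 (R : realType) (D : set (plane R)) (v : plane R -> R) : Prop :=
  measurable_fun D v /\
  (@leb2 R).-integrable D (fun x => ((v x) ^+ 2)%:E).

Definition L2norm (R : realType) (D : set (plane R)) (v : plane R -> R) : R :=
  Num.sqrt (\int[@leb2 R]_(x in D) (v x) ^+ 2).
Definition L2vnorm (R : realType) (D : set (plane R))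
    (g : plane R -> plane R) : R :=
  Num.sqrt (\int[@leb2 R]_(x in D) dot (g x) (g x)).

Definition is_wgrad (R : realType) (D : set (plane R)) (v : plane R -> R)
    (g : plane R -> plane R) : Prop :=
  [/\ L2 D (fun x => (g x).1), L2 D (fun x => (g x).2) &
      forall phi, test_fun D phi ->
        (\int[@leb2 R]_(x in D) (v x * (cgrad phi x).1)
           = - \int[@leb2 R]_(x in D) ((g x).1 * phi x)) /\
        (\int[@leb2 R]_(x in D) (v x * (cgrad phi x).2)
           = - \int[@leb2 R]_(x in D) ((g x).2 * phi x))].

(* A representative of the square-integrable weak gradient on D (unique almost
   everywhere); only meaningful when [H1 D v]. *)
Definition wgrad (R : realType) (D : set (plane R)) (v : plane R -> R) :
    plane R -> plane R :=
  xget (cst 0) [set g | is_wgrad D v g].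

Definition H1 (R : realType) (D : set (plane R)) (v : plane R -> R) : Prop :=
  L2 D v /\ exists g, is_wgrad D v g.

Definition H1norm (R : realType) (D : set (plane R)) (v : plane R -> R) : R :=
  Num.sqrt (L2norm D v ^+ 2 + L2vnorm D (wgrad D v) ^+ 2).

(* Elements of the function spaces are representatives R^2 -> R; their values
   outside D are irrelevant. *)
Definition H10 (R : realType) (D : set (plane R)) (v : plane R -> R) : Prop :=
  H1 D v /\
  exists phi : nat -> plane R -> R,
    (forall n, test_fun D (phi n)) /\
    H1norm D (phi n - v) @[n --> \oo] --> (0 : R).

Definition formA (R : realType) (Om : set (plane R))
    (mu f : plane R -> R -> R) (u v : plane R -> R) : R :=
  \int[@leb2 R]_(x in Om)
    (mu x (enorm (wgrad Om u x)) * dot (wgrad Om u x) (wgrad Om v x)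
     + f x (u x) * v x).

Definition ip (R : realType) (Om : set (plane R)) (a2 b2 : R)
    (u v : plane R -> R) : R :=
  \int[@leb2 R]_(x in Om)
    (a2 * dot (wgrad Om u x) (wgrad Om v x) + b2 * (u x * v x)).

Definition energy (R : realType) (Om : set (plane R)) (a2 b2 : R)
    (v : plane R -> R) : R :=
  Num.sqrt (ip Om a2 b2 v v).

Definition Lconst (R : realType) (a1 a2 b1 b2 CP : R) : R :=
  (a1 + Num.max b1 (a1 * b2 / a2) * CP ^+ 2) / (a2 + b2 * CP ^+ 2).

Inductive shape := Triangle | Parallelogram.

(* The triangle with vertices a, a + d1, a + d2, or the parallelogram with
   vertices a, a + d1, a + d1 + d2, a + d2. *)
Record element (R : realType) := Element {
  eshape : shape;
  eorg : plane R;
  edir1 : plane R;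
  edir2 : plane R;
  _ : cross edir1 edir2 != 0 }.

Definition loc (R : realType) (K : element R) (z : plane R) : plane R :=
  eorg K + z.1 *: edir1 K + z.2 *: edir2 K.

Definition refcell {R : realType} (sh : shape) : set (plane R) :=
  match sh with
  | Triangle => [set z | [/\ 0 < z.1, 0 < z.2 & z.1 + z.2 < 1]]
  | Parallelogram => [set z | 0 < z.1 < 1 /\ 0 < z.2 < 1]
  end.

Definition eset (R : realType) (K : element R) : set (plane R) :=
  loc K @` refcell (eshape K).

Definition vertices (R : realType) (K : element R) : seq (plane R) :=
  match eshape K with
  | Triangle => [:: loc K (0, 0); loc K (1, 0); loc K (0, 1)]
  | Parallelogram =>
      [:: loc K (0, 0); loc K (1, 0); loc K (1, 1); loc K (0, 1)]
  end.

Definition edges (R : realType) (K : element R) : seq (edge R) :=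
  zip (vertices K) (rot 1 (vertices K)).

(* Unit outward normal of K on its edge e: the vertices are listed
   counterclockwise iff [cross (edir1 K) (edir2 K) > 0]. *)
Definition onormal (R : realType) (K : element R) (e : edge R) : plane R :=
  let d := e.2 - e.1 in
  (Num.sg (cross (edir1 K) (edir2 K)) / enorm d) *: ((d.2, - d.1) : plane R).

Record mesh (R : realType) := Mesh {
  ncells : nat;
  cell : 'I_ncells -> element R }.
Arguments cell {R} m k.

Definition partition_of (R : realType) (Om : set (plane R)) (T : mesh R) :=
  [/\ forall k, eset (cell T k) `<=` Om,
      forall k l, k != l -> eset (cell T k) `&` eset (cell T l) = set0 &
      closure Om = \bigcup_(k in [set: 'I_(ncells T)]) closure (eset (cell T k))].

Definition no_hanging_nodes (R : realType) (T : mesh R) : Prop :=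
  forall k l, k != l ->
  let S := closure (eset (cell T k)) `&` closure (eset (cell T l)) in
  [\/ S = set0,
      exists z, [/\ z \in vertices (cell T k), z \in vertices (cell T l)
                  & S = [set z]] |
      exists e e', [/\ e \in edges (cell T k), e' \in edges (cell T l),
                       same_edge e e' & S = segment e]].

Definition hK (R : realType) (K : element R) : R := diam (eset K).

Definition shape_regular (R : realType) (T : nat -> mesh R) : Prop :=
  exists2 kappa : R, 0 < kappa &
  forall i k, exists (c : plane R) (r : R),
    [/\ 0 < r, [set x | enorm (x - c) < r] `<=` eset (cell (T i) k) &
        hK (cell (T i) k) <= kappa * r].

Definition gammaK (R : realType) (a2 b2 : R) (K : element R) : R :=
  if b2 != 0 then Num.min (a2^-1 * hK K ^+ 2) b2^-1 else a2^-1 * hK K ^+ 2.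

Definition Ppoly (R : realType) (p : nat) (q : plane R -> R) : Prop :=
  exists c : nat -> nat -> R, forall x,
    q x = \sum_(i < p.+1) \sum_(j < p.+1 | (i + j <= p)%N)
            c i j * x.1 ^+ i * x.2 ^+ j.

Definition Qpoly (R : realType) (p : nat) (q : plane R -> R) : Prop :=
  exists c : nat -> nat -> R, forall x,
    q x = \sum_(i < p.+1) \sum_(j < p.+1) c i j * x.1 ^+ i * x.2 ^+ j.

(* On a parallelogram the "variables" are the affine coordinates along its
   sides (the Cartesian ones if it is an axis-parallel rectangle), as required
   for the Lagrange basis of the conforming space to exist. *)
Definition Sp (R : realType) (p : nat) (K : element R) (v : plane R -> R) :=
  match eshape K with
  | Triangle => exists2 q, Ppoly p q & forall x, eset K x -> v x = q x
  | Parallelogram =>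
      exists2 q, Qpoly p q &
        forall z, refcell (eshape K) z -> v (loc K z) = q z
  end.

Definition VFEM (R : realType) (Om : set (plane R)) (p : nat) (T : mesh R) :
    set (plane R -> R) :=
  [set v | H10 Om v /\ forall k, Sp p (cell T k) v].

Definition lagrange_nodes (R : realType) (p : nat) (K : element R) :
    seq (plane R) :=
  [seq loc K (i%:R / p%:R, j%:R / p%:R)
     | i <- iota 0 p.+1,
       j <- iota 0 (if eshape K is Triangle then p.+1 - i else p.+1)].

Definition interior_nodes (R : realType) (Om : set (plane R)) (p : nat)
    (T : mesh R) : seq (plane R) :=
  undup [seq x <- flatten [seq lagrange_nodes p (cell T k)
                             | k <- enum 'I_(ncells T)] | x \in Om].

(* Continuity on Om fixes the values at the nodes lying on element edges. *)
Definition lagrange_basis (R : realType) (Om : set (plane R)) (p : nat)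
    (T : mesh R) (x : plane R) : plane R -> R :=
  xget (cst 0) [set phi | [/\ VFEM Om p T phi, {within Om, continuous phi} &
    forall y, y \in interior_nodes Om p T -> phi y = (y == x)%:R]].

Definition supp_in (R : realType) (Om : set (plane R)) (phi : plane R -> R) :
    set (plane R) :=
  Om `&` closure [set x | Om x /\ phi x != 0].

Definition L2proj (R : realType) (p : nat) (S : set (plane R))
    (v : plane R -> R) : plane R -> R :=
  xget (cst 0) [set q | Ppoly p q /\
    forall r, Ppoly p r -> \int[@leb2 R]_(x in S) ((v x - q x) * r x) = 0].

Definition clement (R : realType) (Om : set (plane R)) (p : nat) (T : mesh R)
    (v : plane R -> R) : plane R -> R :=
  fun y => \sum_(x <- interior_nodes Om p T)
    L2proj p (supp_in Om (lagrange_basis Om p T x)) v x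
    * lagrange_basis Om p T x y.

Definition L2bd (R : realType) (K : element R) (tau : plane R -> R) : Prop :=
  forall e, e \in edges K ->
    measurable_fun (`[0, 1] : set R) (fun s => tau (param e s)) /\
    (@lebesgue_measure R).-integrable `[0, 1]
      (fun s => ((tau (param e s)) ^+ 2)%:E).

Definition L2bdnorm (R : realType) (K : element R) (tau : plane R -> R) : R :=
  Num.sqrt (\sum_(e <- edges K) enorm (e.2 - e.1) *
    \int[@lebesgue_measure R]_(s in `[0, 1]) (tau (param e s)) ^+ 2).

(* tau is the trace on the boundary of K of w in H^1(K): the L_2 limit of the
   boundary values of smooth functions converging to w in H^1(K). *)
Definition is_trace (R : realType) (K : element R) (w tau : plane R -> R) :=
  [/\ H1 (eset K) w, L2bd K tau &
      exists psi : nat -> plane R -> R,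
        [/\ forall n, smooth (psi n),
            H1norm (eset K) (psi n - w) @[n --> \oo] --> (0 : R) &
            L2bdnorm K (psi n - tau) @[n --> \oo] --> (0 : R)]].

Definition interpolation_bound (R : realType) (Om : set (plane R))
    (a2 b2 CI : R) (p : nat) (T : mesh R) : Prop :=
  forall v, H10 Om v ->
  let w := v - clement Om p T v in
  forall tau : 'I_(ncells T) -> plane R -> R,
    (forall k, is_trace (cell T k) w (tau k)) ->
    \sum_(k < ncells T)
      ((gammaK a2 b2 (cell T k))^-1 * L2norm (eset (cell T k)) w ^+ 2
       + a2 * L2vnorm (eset (cell T k)) (wgrad Om w) ^+ 2
       + 2^-1 * Num.sqrt a2 * (Num.sqrt (gammaK a2 b2 (cell T k)))^-1
         * L2bdnorm (cell T k) (tau k) ^+ 2)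
    <= CI ^+ 2 * energy Om a2 b2 v ^+ 2.

Definition vtrace (R : realType) (K : element R) (sigma : plane R -> plane R)
    (x : plane R) : plane R :=
  (lim ((sigma y).1 @[y --> within (eset K) (nbhs x)]),
   lim ((sigma y).2 @[y --> within (eset K) (nbhs x)])).

(* The sum ranges over the (exactly two, for an interior edge e of a regular
   mesh) elements having e as an edge. *)
Definition jump (R : realType) (T : mesh R) (sigma : plane R -> plane R)
    (e : edge R) (x : plane R) : R :=
  \sum_(k < ncells T) \sum_(e' <- edges (cell T k) | same_edge e' e)
    dot (vtrace (cell T k) sigma x) (onormal (cell T k) e').

(* Square of the L_2 norm of the jump on the boundary of K minus that of Om. *)
Definition jump_norm2 (R : realType) (Om : set (plane R)) (T : mesh R)
    (K : element R) (sigma : plane R -> plane R) : \bar R :=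
  (\sum_(e <- edges K) (enorm (e.2 - e.1))%:E *
    \int[@lebesgue_measure R]_(s in [set s | (0 <= s <= 1)%R /\
                                             ~ bdry Om (param e s)])
      ((jump T sigma e (param e s)) ^+ 2)%:E)%E.

(* d is locally integrable, so that it defines a distribution on D. *)
Definition is_div (R : realType) (D : set (plane R))
    (sigma : plane R -> plane R) (d : plane R -> R) : Prop :=
  [/\ measurable_fun D d,
      forall C, compact C -> C `<=` D ->
        (@leb2 R).-integrable C (EFin \o d) &
      forall phi, test_fun D phi ->
        \int[@leb2 R]_(x in D) dot (sigma x) (cgrad phi x)
        = - \int[@leb2 R]_(x in D) (d x * phi x)].

Definition flux (R : realType) (mu : plane R -> R -> R) (v : plane R -> R)
    (x : plane R) : plane R :=
  mu x (enorm (cgrad v x)) *: cgrad v x.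

Definition opF (R : realType) (a2 b2 : R) (v : plane R -> R) (x : plane R) : R :=
  - a2 * claplace v x + b2 * v x.

(* Square of the L_2(K) norm of f(v) - div (flux v) + L^2 F(w).  All functions
   d below agree almost everywhere; if there is none, or if the residual is not
   square integrable, the value is +oo (the infimum of the empty set). *)
Definition residual_norm2 (R : realType) (a2 b2 L : R)
    (mu f : plane R -> R -> R) (K : element R) (v w : plane R -> R) : \bar R :=
  ereal_inf [set (\int[@leb2 R]_(x in eset K)
      ((f x (v x) - d x + L ^+ 2 * opF a2 b2 w x) ^+ 2)%:E)%E
    | d in [set d | is_div (eset K) (flux mu v) d]].

Definition eta2 (R : realType) (Om : set (plane R)) (a2 b2 L : R)
    (mu f : plane R -> R -> R) (T : mesh R) (K : element R)
    (vnew vold : plane R -> R) : \bar R :=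
  ((gammaK a2 b2 K)%:E
     * residual_norm2 a2 b2 L mu f K vold (vnew - vold)%R
   + (2^-1 * (Num.sqrt a2)^-1 * Num.sqrt (gammaK a2 b2 K))%:E
     * jump_norm2 Om T K
         (fun x => flux mu vold x + (L ^+ 2 * a2) *: cgrad (vnew - vold) x)%R)%E.

Definition eq_ae (R : realType) (Om : set (plane R)) (v w : plane R -> R) :=
  {ae @leb2 R, forall x, Om x -> v x = w x}.

(* P is a linear projection onto V, defined on V0 + V; functions are identified
   when they agree almost everywhere. *)
Definition is_projection (R : realType) (Om : set (plane R))
    (V0 V : set (plane R -> R)) (P : (plane R -> R) -> plane R -> R) : Prop :=
  let W := [set v | exists v0 v1, [/\ V0 v0, V v1 & v = v0 + v1]] in
  [/\ forall v, W v -> V (P v),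
      forall v, V v -> eq_ae Om (P v) v,
      forall v w, W v -> W w -> eq_ae Om v w -> eq_ae Om (P v) (P w) &
      forall (c : R) v w, W v -> W w ->
        eq_ae Om (P (c *: v + w)) (c *: P v + P w)].

(* Main.v *)
Require Import Defs.
From HB Require Import structures.
From mathcomp Require Import all_boot all_order all_algebra.
From mathcomp Require Import all_classical all_reals all_analysis.
From mathcomp Require Import measurable_realfun.
From mathcomp Require Import ring lra.
Set Implicit Arguments.
Unset Strict Implicit.
Unset Printing Implicit Defensive.
Import Order.TTheory GRing.Theory Num.Theory.
Import numFieldNormedType.Exports.
Local Open Scope classical_set_scope.
Local Open Scope ring_scope.

(** Write [e = u - u_n], [del = u_n - u_(n-1)] and, for a test function [v],
    [R(v) = A(u_(n-1), v) + L^2 (del, v)].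

    Strong monotonicity of [A] ([formA_mono]) and [A(u, e) = 0] give
    [|||e|||^2 <= - A(u_n, e)], and the right-hand side is split as
    [- (A(u_n, e) - A(u_(n-1), e)) - R(e) + L^2 (del, e)]. As [A] is Lipschitz
    continuous with constant [L] in the energy norm ([formA_lip]), the first and
    the last term are at most [(L + L^2) |||del||| |||e|||]. Both properties of
    [A] come from inequalities for the integrand; the constant [L] enters with
    the Poincare inequality ([L_bound]).

    The fixed point equation says that [R] vanishes on the finite element
    space. The quasi-interpolant of [e] lies in this space, so [R(e) = R(w)]
    where [w] is the interpolation error. On each cell [u_(n-1)] and [del] are
    polynomials, and Green's formula ([green_cell], [cell_identity]) turns
    [R(w)] into a sum over the cells of the integral of the strong residual
    against [w] and of the normal flux against the trace of [w]. Two cells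
    that share an edge see the same trace, and on the boundary of the domain
    the trace is zero, so that the edge terms add up to half the sum of the
    jumps ([edge_two], [jump_sum]). Weighted Cauchy-Schwarz inequalities
    ([residual_bound]) and the interpolation bound give
    [|R(w)| <= C_I eta |||e|||]. If the residual of some cell is not square
    integrable, the right-hand side of the theorem is infinite.

    Two facts of analysis carry the integration by parts. The field is only
    continuous up to the boundary of the cell and has a divergence in the
    sense of distributions; [divergence_theorem] obtains the boundary integral
    by testing with smooth cutoffs whose gradients concentrate on the edges
    ([edge_limit]). The trace of [w] is the upper limit of a sequence of test
    functions which converges so fast in [H^1] that, by the trace inequality
    ([trace_ineq]), it converges almost everywhere on every edge; this yields
    one function which is the trace for all cells at once and is zero on the
    boundary ([trace_exists]). *)

(** * Integration and square-integrable functions *)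

Section Bridge.
Context d1 d2 (T1 : measurableType d1) (T2 : measurableType d2) (R : realType).
Variables (mu1 : set T1 -> \bar R) (mu2 : set T2 -> \bar R).
Variables (i : T1 -> T2) (j : T2 -> T1).
Hypotheses (ij : cancel i j) (ji : cancel j i).
Hypotheses (mi : measurable_fun setT i) (mj : measurable_fun setT j).
Hypothesis mu12 : forall A, mu2 A = mu1 (i @^-1` A).
Import HBNNSimple.

(** Used with the identity map between two records for the Borel structure of
    the plane which have the same measurable sets: the simple functions under a
    given function are then the same, and so are their integrals. *)
Lemma integral_iso D (f : T2 -> \bar R) :
  integral mu2 D f = integral mu1 (i @^-1` D) (f \o i).
Proof.
have aux (g : T2 -> \bar R) :
  [set sintegral mu2 h | h in [set h : {nnsfun T2 >-> R} | forall x, ((h x)%:E <= g x)%E]]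
  = [set sintegral mu1 h | h in [set h : {nnsfun T1 >-> R} | forall x, ((h x)%:E <= g (i x))%E]].
  apply/seteqP; split => _ [h hg <-].
    have mh : measurable_fun setT (h \o i) by exact: measurableT_comp.
    have fh : finite_set (range (h \o i)).
      by apply: sub_finite_set (@fimfunP _ _ h) => _ [x _ <-]; exists (i x).
    have h0 : forall x, 0 <= (h \o i) x by move=> x; exact: fun_ge0.
    pose m1 := isMeasurableFun.Build _ _ _ _ (h \o i) mh.
    pose m2 := FiniteImage.Build _ _ (h \o i) fh.
    pose m3 := isNonNegFun.Build _ _ (h \o i) h0.
    pose h' : {nnsfun T1 >-> R} := HB.pack (h \o i) m1 m2 m3.
    exists h'; first by move=> x; exact: hg.
    by rewrite /sintegral; apply: eq_fsbigr => x _; rewrite mu12.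
  have mh : measurable_fun setT (h \o j) by exact: measurableT_comp.
  have fh : finite_set (range (h \o j)).
    by apply: sub_finite_set (@fimfunP _ _ h) => _ [x _ <-]; exists (j x).
  have h0 : forall x, 0 <= (h \o j) x by move=> x; exact: fun_ge0.
  pose m1 := isMeasurableFun.Build _ _ _ _ (h \o j) mh.
  pose m2 := FiniteImage.Build _ _ (h \o j) fh.
  pose m3 := isNonNegFun.Build _ _ (h \o j) h0.
  pose h' : {nnsfun T2 >-> R} := HB.pack (h \o j) m1 m2 m3.
  exists h'; first by move=> x; rewrite /= -{2}(ji x); exact: hg.
  rewrite /sintegral; apply: eq_fsbigr => x _; rewrite mu12; congr (_ * mu1 _)%E.
  by apply/seteqP; split => y /=; rewrite ij.
have e : (f \o i) \_ (i @^-1` D) = (f \_ D) \o i.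
  apply/funext => x; rewrite /patch /=.
  by have -> : (x \in i @^-1` D) = (i x \in D) by apply/idP/idP; rewrite !inE.
have fp (g : T2 -> \bar R) x : ((g \o i)^\+ x = g^\+ (i x))%E by rewrite !funeposE.
have fn (g : T2 -> \bar R) x : ((g \o i)^\- x = g^\- (i x))%E by rewrite !funenegE.
rewrite /integral !aux e.
by congr (ereal_sup _ - ereal_sup _)%E; apply/seteqP; split => _ [h hg <-];
  exists h => // x; move: (hg x); rewrite ?fp ?fn.
Qed.
End Bridge.

Section Lebesgue.
Variable R : realType.

Notation mR := (measurableTypeR R).

(** The measures of the statement as measures over the structure for which they
    are packaged, so that the theorems on product measures apply. *)
Definition lb1 := [the {sigma_finite_measure set (measurableTypeR R) -> \bar R} of @lebesgue_measure R].
Definition lb2 : {measure set (mR * mR) -> \bar R} := [the measure _ _ of product_measure1 lb1 lb1].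

Lemma lb2E (D : set (plane R)) (f : plane R -> R) :
  \int[@leb2 R]_(x in D) f x = \int[lb2]_(x in D) f x.
Proof. by []. Qed.

Lemma integral_leb2 (D : set (plane R)) (f : plane R -> \bar R) :
  integral (@leb2 R) D f = integral lb2 D f.
Proof. by rewrite (@integral_iso _ _ (mR * mR)%type _ _ lb2 (@leb2 R) id id). Qed.
End Lebesgue.

(** Fixes the measure in the almost everywhere quantifier, which is not
    determined by the type of the points. *)
Definition all_ae d (T : measurableType d) (R : realType)
  (mu : {measure set T -> \bar R}) (P : T -> Prop) : Prop := {ae mu, forall x, P x}.

Section AE.
Context d (T : measurableType d) (R : realType) (mu : {measure set T -> \bar R}).
Implicit Types P Q : T -> Prop.

Lemma all_aeW P : (forall x, P x) -> all_ae mu P.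
Proof. by move=> h; exact: aeW. Qed.

Lemma all_aeS P Q : (forall x, P x -> Q x) -> all_ae mu P -> all_ae mu Q.
Proof. by move=> PQ; rewrite /all_ae; exact: filterS. Qed.

Lemma all_aeS2 P Q Z : (forall x, P x -> Q x -> Z x) -> all_ae mu P ->
  all_ae mu Q -> all_ae mu Z.
Proof. by move=> PQ; rewrite /all_ae; exact: filterS2. Qed.

Lemma all_ae_foralln (P : nat -> T -> Prop) : (forall n, all_ae mu (P n)) ->
  all_ae mu (fun x => forall n, P n x).
Proof. by move=> h; apply/ae_foralln. Qed.

Lemma all_ae_null (N : set T) : measurable N -> mu N = 0%E -> all_ae mu (fun x => ~ N x).
Proof. by move=> mN N0; exists N; split => // x /= /contrapT. Qed.
End AE.

Definition eintg d (T : measurableType d) (R : realType)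
  (mu : {measure set T -> \bar R}) (D : set T) (f : T -> \bar R) : Prop :=
  mu.-integrable D f.

Definition intg d (T : measurableType d) (R : realType)
  (mu : {measure set T -> \bar R}) (D : set T) (f : T -> R) : Prop :=
  mu.-integrable D (EFin \o f).

Lemma integrable_leb2 (R : realType) (D : set (plane R)) (f : plane R -> R) :
  (@leb2 R).-integrable D (EFin \o f) <-> intg (@lb2 R) D f.
Proof.
by split => /integrableP[m h]; apply/integrableP; split => //; move: h; rewrite integral_leb2.
Qed.

Section Tools.
Context d (T : measurableType d) (R : realType) (mu : {measure set T -> \bar R}).
Variable D : set T.
Hypothesis mD : measurable D.
Implicit Types f g : T -> R.

Local Notation int f := (intg mu D f).

Lemma int_meas f : int f -> measurable_fun D f.
Proof. by move/measurable_int/measurable_EFinP. Qed.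

Lemma int_dom f g : measurable_fun D f -> (forall x, D x -> `|f x| <= g x) ->
  int g -> int f.
Proof.
move=> mf fg ig; apply: (le_integrable mD _ _ ig); first exact/measurable_EFinP.
by move=> x Dx; rewrite /= lee_fin (le_trans (fg x Dx))// ler_norm.
Qed.

Lemma int_ext f g : (forall x, D x -> f x = g x) -> int f -> int g.
Proof.
move=> fg; apply: eq_integrable => // x; rewrite inE => Dx /=; by rewrite fg.
Qed.

Lemma intD f g : int f -> int g -> int (fun x => f x + g x).
Proof. by move=> hf hg; have := integrableD mD hf hg. Qed.

Lemma intB f g : int f -> int g -> int (fun x => f x - g x).
Proof. by move=> hf hg; have := integrableB mD hf hg. Qed.

Lemma intZ k f : int f -> int (fun x => k * f x).
Proof. by move=> hf; have := integrableZl mD k hf. Qed.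

Lemma int_abs f : int f -> int (fun x => `|f x|).
Proof. exact: integrable_norm. Qed.

Lemma int_sum I (s : seq I) (h : I -> T -> R) :
  (forall i, int (h i)) -> int (fun x => \sum_(i <- s) h i x).
Proof.
move=> hi; elim: s => [|a s IH].
  by apply: (int_ext (f := fun=> 0)) => [x _|]; [rewrite big_nil|exact: integrable0].
apply: (int_ext (f := fun x => h a x + \sum_(i <- s) h i x)); last exact: intD.
by move=> x _; rewrite big_cons.
Qed.

Lemma Rint_sum I (s : seq I) (h : I -> T -> R) :
  (forall i, int (h i)) ->
  \int[mu]_(x in D) (\sum_(i <- s) h i x) = \sum_(i <- s) \int[mu]_(x in D) h i x.
Proof.
move=> hi; elim: s => [|a s IH].
  rewrite big_nil (@eq_Rintegral _ _ _ mu D (fun=> 0)); last by move=> x _; rewrite big_nil.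
  by rewrite Rintegral_cst// mul0r.
rewrite big_cons -IH -RintegralD//; [|exact: hi|exact: int_sum].
by apply: eq_Rintegral => x _; rewrite big_cons.
Qed.

Lemma Rint_ext f g : (forall x, D x -> f x = g x) ->
  \int[mu]_(x in D) f x = \int[mu]_(x in D) g x.
Proof. by move=> fg; apply: eq_Rintegral => x; rewrite inE; exact: fg. Qed.

Lemma Rint_fin f : int f -> (\int[mu]_(x in D) f x)%:E = (\int[mu]_(x in D) (f x)%:E)%E.
Proof. by move=> hf; rewrite fineK// integrable_fin_num. Qed.

Lemma Rint_ae f g : all_ae mu (fun x => D x -> f x = g x) ->
  measurable_fun D f -> measurable_fun D g ->
  \int[mu]_(x in D) f x = \int[mu]_(x in D) g x.
Proof.
move=> fg mf mg; congr fine; apply: ae_eq_integral => //;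
  [exact/measurable_EFinP|exact/measurable_EFinP|].
by apply: all_aeS fg => x h Dx; rewrite h.
Qed.

Lemma Rint_dct (f_ : nat -> T -> R) f g :
  (forall n, measurable_fun D (f_ n)) ->
  (forall x, D x -> f_ n x @[n --> \oo] --> f x) ->
  int g -> (forall n x, D x -> `|f_ n x| <= g x) ->
  \int[mu]_(x in D) f_ n x @[n --> \oo] --> \int[mu]_(x in D) f x.
Proof.
move=> mf cf ig fg.
have mff : measurable_fun D f.
  by apply: (measurable_fun_cvg mf) => x Dx; exact: cf.
have cf' x : D x -> (EFin \o f_ n) x @[n --> \oo] --> (EFin \o f) x.
  by move=> Dx; apply: cvg_EFin; [exact: nearW|exact: cf].
have [i1 _ i3] := @dominated_convergence _ _ _ mu _ mD (fun n => EFin \o f_ n)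
  (EFin \o f) (EFin \o g) (fun n => (measurable_EFinP _ _).2 (mf n))
  ((measurable_EFinP _ _).2 mff)
  (aeW mu cf') ig
  (aeW mu (fun x n Dx => fg n x Dx)).
by apply: fine_cvg; rewrite Rint_fin.
Qed.

Definition sqint f := measurable_fun D f /\ int (fun x => f x ^+ 2).
Definition nrm f := Num.sqrt (\int[mu]_(x in D) f x ^+ 2).

Lemma sqint_dom f g : measurable_fun D f -> (forall x, D x -> `|f x| <= `|g x|) ->
  sqint g -> sqint f.
Proof.
move=> mf fg [mg ig]; split=> //; apply: int_dom ig; first exact: measurable_funX.
move=> x Dx; rewrite ger0_norm ?sqr_ge0// -(real_normK (num_real (f x))).
by rewrite -(real_normK (num_real (g x))) ler_sqr ?nnegrE// fg.
Qed.

Lemma sqint_mul f g : sqint f -> sqint g -> int (fun x => f x * g x).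
Proof.
move=> [mf i_f] [mg ig]; apply: (int_dom _ _ (intD i_f ig)).
  exact: measurable_funM.
move=> x Dx; rewrite normrM.
have := sqr_ge0 (`|f x| - `|g x|).
rewrite sqrrB !real_normK ?num_real// => h.
have := mulr_ge0 (normr_ge0 (f x)) (normr_ge0 (g x)); nra.
Qed.

Lemma sqintZ k f : sqint f -> sqint (fun x => k * f x).
Proof.
move=> [mf i_f]; split; first exact: measurable_funM.
by apply: (int_ext (f := fun x => k ^+ 2 * (f x ^+ 2))); [move=> x _; rewrite exprMn|exact: intZ].
Qed.

Lemma sqintD f g : sqint f -> sqint g -> sqint (fun x => f x + g x).
Proof.
move=> hf hg; have [mf i_f] := hf; have [mg ig] := hg.
split; first exact: measurable_funD.
apply: (int_ext (f := fun x => (f x ^+ 2 + g x ^+ 2) + 2 * (f x * g x))).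
  by move=> x _; ring.
by apply: intD; [exact: intD|apply: intZ; exact: sqint_mul].
Qed.

Lemma sqint_ext f g : (forall x, D x -> f x = g x) -> sqint f -> sqint g.
Proof.
move=> fg [mf i_f]; split.
  by apply: eq_measurable_fun mf => x; rewrite inE => Dx; rewrite fg.
by apply: int_ext i_f => x Dx; rewrite fg.
Qed.

Lemma sqintN f : sqint f -> sqint (fun x => - f x).
Proof. by move/(sqintZ (-1)); apply: sqint_ext => x _; rewrite mulN1r. Qed.

Lemma sqintB f g : sqint f -> sqint g -> sqint (fun x => f x - g x).
Proof. by move=> hf hg; apply: (sqintD hf); exact: sqintN. Qed.

Lemma sqint_abs f : sqint f -> sqint (fun x => `|f x|).
Proof.
move=> h; have [mf _] := h; apply: sqint_dom h; first exact: measurableT_comp.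
by move=> x _; rewrite normr_id.
Qed.

Lemma sqint0 : sqint (fun=> 0).
Proof.
split; first exact: measurable_cst.
apply: (int_ext (f := fun=> 0)); first by move=> x _; rewrite expr0n.
exact: integrable0.
Qed.

(** A quadratic polynomial without negative values has a nonpositive
    discriminant: evaluate it at its minimum [- b / c]. *)
Lemma discriminant_bound (a b c : R) : 0 <= c -> (forall t, 0 <= a + 2 * t * b + t ^+ 2 * c) ->
  `|b| <= Num.sqrt a * Num.sqrt c.
Proof.
move=> c0 h; have a0 : 0 <= a by have := h 0; nra.
rewrite -sqrtrM// -sqrtr_sqr ler_wsqrtr//.
have [c1|c1] := eqVneq c 0.
  (* for nonzero [b] the affine function takes the value [-1] at this point *)
  have := h (- (a + 1) / (2 * b)); rewrite c1 mulr0 addr0 mulr0.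
  have [->|b0] := eqVneq b 0; first by rewrite expr0n.
  rewrite (_ : 2 * _ * b = - (a + 1)); [lra|by field].
have cp : 0 < c by rewrite lt_def c1.
have := h (- b / c).
have -> : a + 2 * (- b / c) * b + (- b / c) ^+ 2 * c = (a * c - b ^+ 2) / c by field.
by rewrite pmulr_lge0 ?invr_gt0// subr_ge0.
Qed.

(** The integral of [(f + t g)^2] is a nonnegative quadratic polynomial in [t]. *)
Lemma cauchy_schwarz f g : sqint f -> sqint g ->
  `|\int[mu]_(x in D) (f x * g x)| <= nrm f * nrm g.
Proof.
move=> hf hg; have [mf i_f] := hf; have [mg ig] := hg.
have ifg := sqint_mul hf hg.
apply: discriminant_bound => [|t]; first by apply: Rintegral_ge0 => x _; exact: sqr_ge0.
have -> : \int[mu]_(x in D) f x ^+ 2 + 2 * t * \int[mu]_(x in D) (f x * g x) +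
  t ^+ 2 * \int[mu]_(x in D) g x ^+ 2 = \int[mu]_(x in D) (f x + t * g x) ^+ 2.
  rewrite -!RintegralZl// -!RintegralD//; last exact: intZ.
  - by apply: Rint_ext => x _; ring.
  - by apply: intD => //; exact: intZ.
  - exact: intZ.
by apply: Rintegral_ge0 => x _; exact: sqr_ge0.
Qed.

Lemma nrm_ge0 f : 0 <= nrm f.
Proof. exact: sqrtr_ge0. Qed.

Lemma nrm_sqr f : nrm f ^+ 2 = \int[mu]_(x in D) f x ^+ 2.
Proof. by rewrite sqr_sqrtr//; apply: Rintegral_ge0 => x _; exact: sqr_ge0. Qed.

Lemma nrm_ext f g : (forall x, D x -> f x = g x) -> nrm f = nrm g.
Proof. by move=> fg; congr Num.sqrt; apply: Rint_ext => x Dx; rewrite fg. Qed.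

Lemma nrmZ k f : sqint f -> nrm (fun x => k * f x) = `|k| * nrm f.
Proof.
move=> [mf hf]; rewrite /nrm -sqrtr_sqr -sqrtrM ?sqr_ge0// -RintegralZl//.
by congr Num.sqrt; apply: Rint_ext => x _; rewrite exprMn.
Qed.

Lemma nrmD f g : sqint f -> sqint g -> nrm (fun x => f x + g x) <= nrm f + nrm g.
Proof.
move=> hf hg; have [mf i_f] := hf; have [mg ig] := hg.
rewrite -(@ler_pXn2r _ 2)// ?nnegrE ?nrm_ge0 ?addr_ge0 ?nrm_ge0//.
have ifg := sqint_mul hf hg.
have -> : nrm (fun x => f x + g x) ^+ 2 =
  nrm f ^+ 2 + 2 * \int[mu]_(x in D) (f x * g x) + nrm g ^+ 2.
  rewrite !nrm_sqr -!RintegralZl// -!RintegralD//; do ?[exact: intZ|apply: intD => //; exact: intZ].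
  by apply: Rint_ext => x _; ring.
have := le_trans (ler_norm _) (cauchy_schwarz hf hg); nra.
Qed.

Lemma nrmB f g : sqint f -> sqint g -> nrm (fun x => f x - g x) <= nrm f + nrm g.
Proof.
move=> hf hg; have := nrmD hf (sqintN hg).
suff -> : nrm (fun x => - g x) = nrm g by [].
by congr Num.sqrt; apply: Rint_ext => x _; rewrite sqrrN.
Qed.

Lemma nrm_ae f g : all_ae mu (fun x => D x -> f x = g x) ->
  measurable_fun D f -> measurable_fun D g -> nrm f = nrm g.
Proof.
move=> fg mf mg; congr Num.sqrt; apply: Rint_ae; last 2 first.
- exact: measurable_funX.
- exact: measurable_funX.
by apply: all_aeS fg => x h Dx; rewrite h.
Qed.

Section finite.
Hypothesis fD : (mu D < +oo)%E.

Lemma int_bd f M : measurable_fun D f -> (forall x, D x -> `|f x| <= M) -> int f.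
Proof.
move=> mf fM; apply: measurable_bounded_integrable => //.
exists M; split; first exact: num_real.
by move=> y My x Dx; rewrite /= (le_trans (fM x Dx))// ltW.
Qed.

Lemma sqint_bd f M : measurable_fun D f -> (forall x, D x -> `|f x| <= M) -> sqint f.
Proof.
move=> mf fM; split => //; apply: (@int_bd _ (M ^+ 2)); first exact: measurable_funX.
by move=> x Dx; rewrite normrX lerXn2r ?nnegrE// ?fM// (le_trans _ (fM x Dx)).
Qed.

Lemma sqint_int f : sqint f -> int f.
Proof.
move=> hf; have h1 : sqint (fun=> 1).
  by apply: (@sqint_bd _ 1) => //x _; rewrite normr1.
by have := sqint_mul hf h1; apply: int_ext => x _; rewrite mulr1.
Qed.

End finite.
End Tools.

Section Sub.
Context d (T : measurableType d) (R : realType) (mu : {measure set T -> \bar R}).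
Variables D E : set T.
Hypotheses (mD : measurable D) (mE : measurable E) (DE : D `<=` E).
Implicit Types f g : T -> R.

Lemma sqint_sub f : sqint mu E f -> sqint mu D f.
Proof.
move=> [mf hf]; split; first exact: measurable_funS mf.
exact: integrableS hf.
Qed.

Lemma Rint_sub f : intg mu E f -> (forall x, E x -> 0 <= f x) ->
  \int[mu]_(x in D) f x <= \int[mu]_(x in E) f x.
Proof.
move=> hf f0; have hD : intg mu D f by exact: integrableS hf.
rewrite -lee_fin !Rint_fin//; apply: ge0_subset_integral => //.
exact: measurable_int hf.
Qed.

Lemma nrm_sub f : sqint mu E f -> nrm mu D f <= nrm mu E f.
Proof. by move=> [mf hf]; apply: ler_wsqrtr; apply: Rint_sub => // x _; exact: sqr_ge0. Qed.

Lemma Rint_supp f : (forall x, E x -> ~ D x -> f x = 0) ->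
  \int[mu]_(x in E) f x = \int[mu]_(x in D) f x.
Proof.
move=> h; rewrite Rintegral_mkcond [RHS]Rintegral_mkcond; congr Rintegral.
apply/funext => x; rewrite /patch; case: ifPn; rewrite ?inE ?notin_setE => Ex.
  by case: ifPn; rewrite ?inE ?notin_setE// => Dx; exact: h.
by rewrite ifF//; apply/negbTE; rewrite notin_setE => /DE.
Qed.

Lemma int_supp f : (forall x, E x -> ~ D x -> f x = 0) ->
  intg mu E f <-> intg mu D f.
Proof.
move=> h; rewrite /intg integrable_mkcond// (integrable_mkcond _ mD).
suff -> : (EFin \o f) \_ E = (EFin \o f) \_ D by [].
apply/funext => x; rewrite /patch; case: ifPn; rewrite ?inE ?notin_setE => Ex.
  by case: ifPn; rewrite ?inE ?notin_setE// => Dx; rewrite /= h.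
by rewrite ifF//; apply/negbTE; rewrite notin_setE => /DE.
Qed.
End Sub.

(** * Borel sets of the plane and affine changes of variables *)

Section Dot.
Variable R : realType.
Implicit Types (x y z : plane R).

Lemma dotZl c x y : dot (c *: x) y = c * dot x y.
Proof. by rewrite /dot /= /GRing.scale /=; ring. Qed.

Lemma dotBl x y z : dot (x - y) z = dot x z - dot y z.
Proof. by rewrite /dot /=; ring. Qed.

Lemma dotBr x y z : dot z (x - y) = dot z x - dot z y.
Proof. by rewrite /dot /=; ring. Qed.

Lemma dotDZl c x y z : dot (x + c *: y) z = dot x z + c * dot y z.
Proof. by rewrite /dot /= /GRing.scale /=; ring. Qed.

Lemma dotDZr b c x y z : dot z (b *: x + c *: y) = b * dot z x + c * dot z y.
Proof. by rewrite /dot /= /GRing.scale /=; ring. Qed.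
End Dot.

Section Basis.
(** Used with measurable sets [M]: open subsets of a product are then countable
    unions of measurable rectangles. *)
Definition mbasis (T : topologicalType) (M : set (set T)) :=
  exists B : nat -> set T, (forall n, M (B n)) /\
    forall U x, open U -> U x -> exists n, B n x /\ B n `<=` U.

Lemma mbasis_open (T : topologicalType) (M : set (set T)) (U : set T) :
  mbasis M -> open U -> exists (B : nat -> set T) (P : set nat),
    (forall n, M (B n)) /\ U = \bigcup_(n in P) B n.
Proof.
move=> [B [MB hB]] oU; exists B, [set n | B n `<=` U]; split => //.
apply/seteqP; split => [x Ux|x [n /= nU Bx]]; last exact: nU.
by have [n [Bnx nU]] := hB U x oU Ux; exists n.
Qed.

Lemma mbasis_prod (T1 T2 : topologicalType) (M1 : set (set T1)) (M2 : set (set T2)) :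
  mbasis M1 -> mbasis M2 ->
  mbasis (T := (T1 * T2)%type) [set A `*` B | A in M1 & B in M2].
Proof.
move=> [B1 [MB1 h1]] [B2 [MB2 h2]].
pose B n := if @unpickle (nat * nat)%type n is Some (i, j) then B1 i `*` B2 j
  else B1 0%N `*` B2 0%N.
exists B; split.
  rewrite /B => n; case: (unpickle n) => [[i j]|].
    by exists (B1 i) => //; exists (B2 j).
  by exists (B1 0%N) => //; exists (B2 0%N).
move=> U [x1 x2] oU Ux.
have /= [[V1 V2] /= [n1 n2] VU] : nbhs (x1, x2) U by exact: open_nbhs_nbhs.
move: n1 n2; rewrite !nbhsE => -[W1 [oW1 Wx1] WV1] [W2 [oW2 Wx2] WV2].
have [i [Bi iW]] := h1 W1 x1 oW1 Wx1; have [j [Bj jW]] := h2 W2 x2 oW2 Wx2.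
exists (pickle (i, j)); rewrite /B pickleK; split => // -[y1 y2] /= [hy1 hy2].
by apply: VU; split; [apply/WV1/iW|apply/WV2/jW].
Qed.

Lemma mbasis_sub (T : topologicalType) (M M' : set (set T)) :
  M `<=` M' -> mbasis M -> mbasis M'.
Proof. by move=> MM [B [MB h]]; exists B; split => // n; exact/MM. Qed.
End Basis.

Section PlaneTop.
Variable R : realType.
Notation mR := (measurableTypeR R).

Definition oitv : set (set R) := [set A | exists a b : R, A = `]a, b[%classic].

Lemma mbasis_R : mbasis (T := R) oitv.
Proof.
exists (fun n => if @unpickle (rat * rat)%type n is Some (a, b)
  then `]ratr a, ratr b[%classic else `]0, 0[%classic); split.
  by move=> n; case: (unpickle n) => [[a b]|]; do 2 eexists.
move=> U x oU Ux; have : nbhs x U by exact: open_nbhs_nbhs.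
move=> /nbhs_ballP[e /= e0 xU].
have /rat_in_itvoo[a ha] : x - e < x by lra.
have /rat_in_itvoo[b hb] : x < x + e by lra.
exists (pickle (a, b)); rewrite pickleK; move: ha hb; rewrite !in_itv /= => /andP[a1 a2] /andP[b1 b2].
split; first by rewrite /= in_itv/= a2 b1.
move=> y /=; rewrite in_itv /= => /andP[y1 y2]; apply: xU.
by rewrite /ball /= ltr_norml; apply/andP; split; lra.
Qed.

Lemma oitv_measurable : oitv `<=` @measurable _ R.
Proof. by move=> _ [a [b ->]]; exact: measurable_itv. Qed.

Definition boxes : set (set (plane R)) := [set A `*` B | A in oitv & B in oitv].

Lemma mbasis_boxes : mbasis (T := plane R) boxes.
Proof. exact: mbasis_prod mbasis_R mbasis_R. Qed.

Lemma boxes_measurable : boxes `<=` @measurable _ (plane R).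
Proof.
by move=> _ [A mA [B mB <-]]; apply: measurableX; exact: oitv_measurable.
Qed.

Lemma open_measurable2 (U : set (plane R)) : open U -> measurable U.
Proof.
move=> oU; have [B [P [mB ->]]] := mbasis_open (mbasis_sub boxes_measurable mbasis_boxes) oU.
by apply: bigcup_measurable.
Qed.

Lemma closed_measurable2 (U : set (plane R)) : closed U -> measurable U.
Proof. by move/closed_openC/open_measurable2/measurableC; rewrite setCK. Qed.

Lemma open_measurable3 (U : set (plane R * R)) : open U -> measurable U.
Proof.
have h : mbasis (T := (plane R * R)%type) (@measurable _ (plane R * R)%type).
  apply: mbasis_sub (mbasis_prod (mbasis_sub boxes_measurable mbasis_boxes)
    (mbasis_sub oitv_measurable mbasis_R)).
  by move=> _ [A mA [B mB <-]]; exact: measurableX.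
move=> oU; have [B [P [mB ->]]] := mbasis_open h oU.
by apply: bigcup_measurable.
Qed.

Lemma closed_measurable3 (U : set (plane R * R)) : closed U -> measurable U.
Proof. by move/closed_openC/open_measurable3/measurableC; rewrite setCK. Qed.

Lemma cont_measurable2 (D : set (plane R)) (f : plane R -> R) :
  measurable D -> {within D, continuous f} -> measurable_fun D f.
Proof.
move=> mD /continuousP cf; apply: (measurability _ (RGenOpens.measurableE R)).
move=> _ [_ [a [b ->] <-]]; have /cf/open_subspaceP[V oV VD] := @interval_open R (BRight a) (BLeft b) isT isT.
by rewrite setIC -VD; apply: measurableI => //; exact: open_measurable2.
Qed.

Lemma cont_measurable3 (D : set (plane R * R)) (f : plane R * R -> R) :
  measurable D -> {within D, continuous f} -> measurable_fun D f.
Proof.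
move=> mD /continuousP cf; apply: (measurability _ (RGenOpens.measurableE R)).
move=> _ [_ [a [b ->] <-]]; have /cf/open_subspaceP[V oV VD] := @interval_open R (BRight a) (BLeft b) isT isT.
by rewrite setIC -VD; apply: measurableI => //; exact: open_measurable3.
Qed.

Lemma cont_measurableT (f : plane R -> R) : continuous f -> forall D, measurable_fun D f.
Proof.
move=> cf D; apply: (@measurable_funS _ _ _ _ setT) => //.
by apply: cont_measurable2 => //; exact: continuous_subspaceT.
Qed.

End PlaneTop.

Section Affine.
Variable R : realType.
Notation mR := (measurableTypeR R).

Local Open Scope ereal_scope.
(** Lebesgue measure is determined by its values on half-open intervals, which
    an affine map scales by [|a|]. *)
Lemma integral_affine1 (a b : R) (f : R -> \bar R) : (a != 0)%R ->
  measurable_fun setT f -> (forall x, 0 <= f x) ->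
  \int[@lb1 R]_x f x = `|a|%:E * \int[@lb1 R]_t f (a * t + b)%R.
Proof.
move=> a0 mf f0.
pose phi (t : mR) : mR := (a * t + b)%R.
have mphi : measurable_fun setT phi.
  by apply: (@continuous_measurable_fun R) => t; apply: cvgD; [apply: cvgM;
      [exact: cvg_cst|exact: cvg_id]|exact: cvg_cst].
pose m1 := pushforward (@lb1 R) phi.
pose m1m : {measure set mR -> \bar R} := m1.
pose na := NngNum (normr_ge0 a).
pose m2 : {measure set mR -> \bar R} := mscale na (m1m mphi).
have e A : measurable A -> @lebesgue_measure R A = m2 A.
  apply: lebesgue_measure_unique => X [[x y] _ <-] /=.
  rewrite /m2 /mscale /= /pushforward.
  have [xy|yx] := ltP x y; last first.
    rewrite set_itv_ge ?bnd_simp -?leNgt// measure0.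
    by rewrite ?preimage_set0 ?measure0 mule0.
  have [ap|an] : (0 < a)%R \/ (a < 0)%R by apply/orP; rewrite -neq_lt eq_sym.
    have -> : phi @^-1` `]x, y] = `]((x - b) / a)%R, ((y - b) / a)%R]%classic.
      apply/seteqP; split => t /=; rewrite /phi !in_itv /= ltr_pdivrMr// ler_pdivlMr// => /andP[h1 h2];
          apply/andP; split; lra.
    rewrite !lebesgue_measure_itv /= !lte_fin xy ltr_pM2r ?invr_gt0// ltrD2r xy.
    by rewrite -!EFinB -EFinM gtr0_norm//; congr EFin; field.
  have -> : phi @^-1` `]x, y] = `[((y - b) / a)%R, ((x - b) / a)%R[%classic.
    by apply/seteqP; split => t /=; rewrite /phi !in_itv /= ltr_ndivlMr// ler_ndivrMr// => /andP[h1 h2];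
        apply/andP; split; lra.
  rewrite !lebesgue_measure_itv /= !lte_fin xy ltr_nM2r ?invr_lt0// ltrD2r xy.
  by rewrite -!EFinB -EFinM ltr0_norm//; congr EFin; field.
rewrite (@eq_measure_integral _ _ _ _ m2); last by move=> A mA _; exact: e.
rewrite ge0_integral_mscale//.
by rewrite /m1m /m1 ge0_integral_pushforward.
Qed.

Lemma affine_cont (p d m : plane R) : continuous (fun z : plane R => p + z.1 *: d + z.2 *: m)%R.
Proof.
move=> z; apply: cvgD; [apply: cvgD|].
- exact: cvg_cst.
- by apply: cvgZr_tmp; exact: cvg_fst.
- by apply: cvgZr_tmp; exact: cvg_snd.
Qed.

Lemma affine_meas (p d m : plane R) :
  measurable_fun setT (fun z : plane R => p + z.1 *: d + z.2 *: m)%R.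
Proof.
apply/measurable_fun_pairP; split; apply: cont_measurableT => z; (apply: (@continuous_comp _ _ _
    (fun z : plane R => p + z.1 *: d + z.2 *: m)%R); [exact: affine_cont|]).
- exact: cvg_fst.
- exact: cvg_snd.
Qed.

(** If [d] is not vertical, the substitution is a horizontal one at fixed [t]
    followed by a vertical one at fixed abscissa, with an exchange of the order
    of integration in between. *)
Lemma integral_affine2_aux (p d m : plane R) (f : plane R -> \bar R) : (d.1 != 0)%R ->
  (cross d m != 0)%R ->
  measurable_fun setT f -> (forall x, 0 <= f x) ->
  \int[@lb2 R]_x f x = `|cross d m|%:E * \int[@lb1 R]_t \int[@lb1 R]_s f (p + s *: d + t *: m)%R.
Proof.
move=> d0 c0 mf f0.
pose c := (cross d m / d.1)%R.
pose al := (p.2 - d.2 * p.1 / d.1)%R; pose be := (d.2 / d.1)%R.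
pose psi (z : plane R) : plane R := ((0, al) + z.1 *: (1, be) + z.2 *: (0, c))%R.
pose G (z : plane R) := f (psi z).
have mpsi : measurable_fun setT psi by exact: affine_meas.
have mG : measurable_fun setT G by exact: measurableT_comp.
have E s t : f (p + s *: d + t *: m)%R = G (d.1 * s + (p.1 + t * m.1), t)%R.
  rewrite /G /psi; congr f; rewrite /c /al /be /cross.
  by apply/eqP; rewrite -pair_eqE /=; apply/andP; split; apply/eqP; rewrite /GRing.scale /=; field.
have -> : \int[@lb1 R]_t \int[@lb1 R]_s f (p + s *: d + t *: m)%R =
  \int[@lb1 R]_t (`|d.1|^-1%:E * \int[@lb1 R]_x G (x, t)).
  apply: eq_integral => t _; under eq_integral do rewrite E.
  rewrite (integral_affine1 (p.1 + t * m.1) d0 (f := fun x => G (x, t))).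
  - by rewrite muleA -EFinM mulVf ?normr_eq0// mul1e.
  - by apply: measurableT_comp mG _; exact: measurable_pair2.
  - by move=> x; exact: f0.
rewrite ge0_integralZl//; last 2 first.
- exact: (measurable_fun_fubini_tonelli_G (m1 := @lb1 R) G mG (fun x => f0 _)).
- by move=> t _; apply: integral_ge0 => x _; exact: f0.
have := fubini_tonelli (m1 := @lb1 R) (m2 := @lb1 R) G mG (fun x => f0 _).
rewrite /fubini_F /fubini_G => <-.
have -> : \int[@lb1 R]_x \int[@lb1 R]_y G (x, y) =
   \int[@lb1 R]_x (`|c|^-1%:E * \int[@lb1 R]_y f (x, y)).
  apply: eq_integral => x _.
  have cn0 : (c != 0)%R by rewrite mulf_neq0// invr_eq0.
  rewrite (integral_affine1 (al + be * x) cn0 (f := fun y => f (x, y))).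
  - rewrite muleA -EFinM mulVf ?normr_eq0// mul1e.
    apply: eq_integral => y _; rewrite /G /psi; congr f.
    by apply/eqP; rewrite -pair_eqE /=; apply/andP; split; apply/eqP; rewrite /GRing.scale /=; ring.
  - by apply: measurableT_comp mf _; exact: measurable_pair1.
  - by move=> y; exact: f0.
rewrite ge0_integralZl//; last 2 first.
- exact: (measurable_fun_fubini_tonelli_F (m2 := @lb1 R) f mf f0).
- by move=> t _; apply: integral_ge0 => x _; exact: f0.
rewrite (fubini_tonelli1 (m1 := @lb1 R) (m2 := @lb1 R) _ mf f0).
rewrite !muleA -!EFinM.
suff -> : (`|cross d m| / `|d.1| / `|c| = 1)%R by rewrite mul1e.
by rewrite /c normrM normfV; field; rewrite !normr_eq0 c0 d0.
Qed.

Lemma crossC (d m : plane R) : cross d m = (- cross m d)%R.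
Proof. by rewrite /cross; ring. Qed.

(** One of [d] and [m] is not vertical, and their exchange only changes the
    sign of the determinant. *)
Lemma integral_affine2 (p d m : plane R) (f : plane R -> \bar R) :
  (cross d m != 0)%R -> measurable_fun setT f -> (forall x, 0 <= f x) ->
  \int[@lb2 R]_x f x = `|cross d m|%:E * \int[@lb2 R]_z f (p + z.1 *: d + z.2 *: m)%R.
Proof.
move=> c0 mf f0.
pose F (z : plane R) := f (p + z.1 *: d + z.2 *: m)%R.
have mF : measurable_fun setT F by apply: measurableT_comp mf _; exact: affine_meas.
have F0 z : 0 <= F z by exact: f0.
have [d0|d0] := eqVneq d.1 0%R; last first.
  rewrite (integral_affine2_aux p d0 c0)//; congr (_ * _).
  by rewrite (fubini_tonelli2 (m1 := @lb1 R) (m2 := @lb1 R) _ mF F0).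
have m0 : (m.1 != 0)%R.
  by apply: contra_neq c0 => m0; rewrite /cross d0 m0 mul0r mulr0 subr0.
rewrite (integral_affine2_aux p m0 (m := d))//; last by rewrite crossC oppr_eq0.
rewrite crossC normrN; congr (_ * _).
rewrite (fubini_tonelli1 (m1 := @lb1 R) (m2 := @lb1 R) _ mF F0).
by apply: eq_integral => s _; apply: eq_integral => t _; rewrite /F /= addrAC.
Qed.

Lemma Rint_affine (p d m : plane R) (D : set (plane R)) (f : plane R -> R)
    (phi := fun z : plane R => (p + z.1 *: d + z.2 *: m)%R) :
  (cross d m != 0)%R -> measurable D -> intg (@lb2 R) D f ->
  intg (@lb2 R) (phi @^-1` D) (f \o phi) /\
  (\int[@lb2 R]_(x in D) f x = `|cross d m| * \int[@lb2 R]_(z in phi @^-1` D) f (phi z))%R.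
Proof.
move=> c0 mD iD.
have mphi : measurable_fun setT phi by exact: affine_meas.
have mpD : measurable (phi @^-1` D) by rewrite -[X in measurable X]setTI; exact: mphi.
pose F := (EFin \o f) \_ D.
have iF : eintg (@lb2 R) setT F by exact: ((integrable_mkcond (mu := @lb2 R) _ mD).1 iD).
have mF := measurable_int _ iF.
have FE : (EFin \o (f \o phi)) \_ (phi @^-1` D) = F \o phi.
  apply/funext => x; rewrite /F /patch /=.
  by have -> : (x \in phi @^-1` D) = (phi x \in D) by apply/idP/idP; rewrite !inE.
have iFp : eintg (@lb2 R) setT (F \o phi).
  apply/integrableP; split; first exact: measurableT_comp.
  have /integrableP[_] := iF.
  rewrite (integral_affine2 p c0 (f := fun x => `|F x|))//; last exact: measurableT_comp.
  rewrite -/phi; apply: contraTT; rewrite -!leNgt !leye_eq => /eqP ->.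
  by rewrite gt0_muley ?lte_fin ?normr_gt0.
split; first by apply/(integrable_mkcond (mu := @lb2 R) _ mpD); rewrite FE.
rewrite /Rintegral.
have -> : \int[lb2 R]_(x in D) (f x)%:E = \int[lb2 R]_x F x by rewrite integral_mkcond.
have -> : \int[lb2 R]_(x in phi @^-1` D) (f (phi x))%:E = \int[lb2 R]_x (F \o phi) x.
  by rewrite -FE -integral_mkcond.
rewrite -[(`|_| * _)%R]/(fine (`|cross d m|%:E) * _)%R -fineM//; last exact: integrable_fin_num.
congr fine; rewrite integralE [in RHS]integralE muleBr//; last first.
  by apply: fin_num_adde_defl; rewrite fin_numN; exact: integrable_neg_fin_num.
congr (_ - _).
  rewrite (integral_affine2 p c0)//; last exact: measurable_funepos.
  by congr (_ * _); apply: eq_integral => x _; rewrite !funeposE.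
rewrite (integral_affine2 p c0)//; last exact: measurable_funeneg.
by congr (_ * _); apply: eq_integral => x _; rewrite !funenegE.
Qed.

(** In coordinates along and across the line, each slice is a single point. *)
Lemma null_line (a b c : R) : (a != 0)%R || (b != 0)%R ->
  @lb2 R [set x : plane R | (a * x.1 + b * x.2 = c)%R] = 0.
Proof.
move=> ab; set A := [set x | _].
have n0 : (0 < a ^+ 2 + b ^+ 2)%R.
  by rewrite lt_def addr_ge0 ?sqr_ge0// paddr_eq0 ?sqr_ge0// !sqrf_eq0 negb_and ab.
have mA : measurable A.
  apply: closed_measurable2; rewrite (_ : A = (fun x : plane R => a * x.1 + b * x.2)%R @^-1` [set c])//.
  apply: closed_comp; last exact: closed_eq.
  by move=> x _; apply: cvgD; apply: cvgM; [exact: cvg_cst|exact: cvg_fst|exact: cvg_cst|exact: cvg_snd].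
have cr : (cross (b, - a) (a, b) != 0)%R by rewrite /cross /= lt0r_neq0//; nra.
have mf : measurable_fun setT (EFin \o \1_A : plane R -> \bar R).
  by apply/measurable_EFinP; exact: measurable_indic.
have f0 x : 0 <= (EFin \o \1_A : plane R -> \bar R) x by rewrite lee_fin.
have -> : lb2 R A = \int[lb2 R]_x (EFin \o \1_A) x by rewrite integral_indic ?setIT.
rewrite (integral_affine2 (0%R : plane R) cr mf f0).
set g := fun z => _; have mg : measurable_fun setT g.
  by apply: measurableT_comp mf _; exact: affine_meas.
rewrite (fubini_tonelli1 (m1 := @lb1 R) (m2 := @lb1 R) g mg)//.
rewrite integral0_eq ?mule0// => s _; rewrite /fubini_F.
have -> : (fun y => g (s, y)) = EFin \o \1_[set (c / (a ^+ 2 + b ^+ 2))%R].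
  apply/funext => t; rewrite /g /= !indicE; congr (_%:R%:E).
  congr nat_of_bool; apply/idP/idP; rewrite !inE /A /= /GRing.scale /= => h.
    by apply/eqP; rewrite eq_sym -subr_eq0 -h; apply/eqP; field; rewrite gt_eqF.
  by rewrite h; field; rewrite gt_eqF.
rewrite integral_indic ?setIT//; exact: lebesgue_measure_set1.
by move=> x; exact: f0.
Qed.

Lemma bounded_finite (D : set (plane R)) : measurable D -> bounded_set D ->
  @lb2 R D < +oo.
Proof.
move=> mD [M [_ hM]].
pose I : set R := `[(- (M + 1))%R, (M + 1)%R]%classic.
have DI : D `<=` I `*` I.
  move=> x Dx; have := hM (M + 1)%R; rewrite ltrDl ltr01 => /(_ isT x Dx).
  rewrite /= prod_normE ge_max => /andP[h1 h2].
  by split; rewrite /I /= in_itv /= -ler_norml.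
apply: (@le_lt_trans _ _ (lb2 R (I `*` I))).
  by apply: le_measure; rewrite ?inE//; apply: measurableX; exact: measurable_itv.
rewrite /lb2 /= product_measure1E; [|exact: measurable_itv|exact: measurable_itv].
change (@lebesgue_measure R I * @lebesgue_measure R I < +oo).
by rewrite /I !lebesgue_measure_itv /=; case: ifP => _; rewrite ?mule0// -EFinM ltry.
Qed.
End Affine.

(** The record of measurable structure that carries [lb2]; its measurable sets
    are those of the canonical structure of [plane R]. *)
Definition mplane (R : realType) :=
  [the measurableType _ of (measurableTypeR R * measurableTypeR R)%type].
Definition mble (R : realType) (D : set (plane R)) : Prop := @measurable _ (mplane R) D.

Lemma open_mble (R : realType) (U : set (plane R)) : open U -> mble U.
Proof. exact: open_measurable2. Qed.

(** * Smooth functions *)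

Section Flat.
Variable R : realType.
Implicit Types (P : {poly R}) (t : R).

(** The functions [P(1/t) exp(-1/t)], extended by [0], form a family which is
    stable under derivation; this is why [exp(-1/t)] is smooth at [0]. *)
Definition flat P t : R := if 0 < t then P.[t^-1] * expR (- t^-1) else 0.

Lemma flat_pos P t : 0 < t -> flat P t = P.[t^-1] * expR (- t^-1).
Proof. by rewrite /flat => ->. Qed.

Lemma flat_npos P t : t <= 0 -> flat P t = 0.
Proof. by rewrite /flat ltNge => ->. Qed.

(** The exponential series bounds [t^-(i+1)] by [(i+1)! exp(1/t)]. Linear decay
    makes the difference quotients at [0] vanish in the limit. *)
Lemma flat_bound P : exists2 C : R, 0 <= C & forall t, 0 < t -> `|flat P t| <= C * t.
Proof.
pose C := \sum_(i < size P) `|P`_i| * i.+1`!%:R.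
exists C; first by apply: sumr_ge0 => i _; rewrite mulr_ge0.
move=> t t0; rewrite flat_pos// horner_coef mulr_suml.
apply: le_trans (ler_norm_sum _ _ _) _; rewrite /C mulr_suml; apply: ler_sum => i _.
rewrite -mulrA normrM -mulrA ler_wpM2l//.
have ti : 0 < t^-1 by rewrite invr_gt0.
have e := expR_ge1Dxn i (ltW ti).
have e0 := expR_gt0 (t^-1).
rewrite expRN ger0_norm; last by rewrite mulr_ge0 ?invr_ge0 ?exprn_ge0 ?ltW.
rewrite ler_pdivrMr//.
have f0 : 0 < (i.+1)`!%:R :> R by rewrite ltr0n fact_gt0.
have e1 : t^-1 ^+ i.+1 <= (i.+1)`!%:R * expR (t^-1).
  by rewrite mulrC -ler_pdivrMr//; apply: le_trans e; rewrite lerDr.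
have -> : t^-1 ^+ i = t * t^-1 ^+ i.+1 by rewrite exprS mulrA divff ?mul1r// gt_eqF.
by rewrite -[leRHS]mulrA [leRHS]mulrCA ler_wpM2l// ltW.
Qed.

Lemma flat_is_derive P t : is_derive t 1 (flat P) (flat ('X^2 * (P - P^`())) t).
Proof.
have [t0|t0|->] := ltgtP t 0.
- rewrite (flat_npos _ (ltW t0)); apply: near_eq_is_derive (is_derive_cst 0 t 1).
  near=> s; rewrite /cst flat_npos// ltW//; near: s; exact: lt_nbhsl.
- have tn : t != 0 by rewrite gt_eqF.
  have -> : flat ('X^2 * (P - P^`())) t = ((P^`()).[t^-1] * expR (- t^-1) - P.[t^-1] * expR (- t^-1)) * (- t ^- 2).
    by rewrite flat_pos// !hornerE; field.
  apply: (near_eq_is_derive (f := (fun s => P.[s] * expR (- s)) \o (fun s => s^-1))).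
    near=> s; rewrite /= flat_pos//; near: s; exact: lt_nbhsr.
  have h1 := is_derive_poly P t^-1.
  have a1 : is_derive (- t^-1) 1 expR (expR (- t^-1)) by exact: is_derive_expR.
  have a2 : is_derive t^-1 1 -%R (-1 : R) by exact: is_deriveN.
  have h2 : is_derive (t^-1) 1 (fun s => expR (- s)) (- expR (- t^-1)).
    by have := @is_derive1_comp R expR -%R (t^-1) _ _ a1 a2; rewrite mulrN1.
  have hg : is_derive (t^-1) 1 (fun s => P.[s] * expR (- s))
     ((P^`()).[t^-1] * expR (- t^-1) - P.[t^-1] * expR (- t^-1)).
    by apply: is_derive_eq (is_deriveM h1 h2) _; rewrite /GRing.scale /=; ring.
  have hinv : is_derive t 1 (fun s : R => s^-1) (- t ^- 2).
    by apply: is_derive_eq (is_deriveV tn (is_derive_id t 1)) _; rewrite /GRing.scale /= mulr1.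
  exact: (@is_derive1_comp _ _ _ _ _ _ hg hinv).
- rewrite flat_npos//; have [C C0 hC] := flat_bound ('X * P).
  suff h : h^-1 *: ((flat P \o shift 0) (h *: (1 : R)) - flat P 0) @[h --> 0^'] --> (0 : R).
    by apply: DeriveDef; [apply/cvg_ex; exists 0|apply/cvg_lim].
  apply/cvgr0Pnorm_lt => e e0; near=> s.
  have s0 : s != 0 by near: s; exact: nbhs_dnbhs_neq.
  rewrite /= addr0 (flat_npos P (lexx 0)) subr0 /GRing.scale /= mulr1.
  have [sp|sp] := ltP 0 s; last by rewrite (flat_npos P sp) mulr0 normr0.
  have -> : s^-1 * flat P s = flat ('X * P) s by rewrite !flat_pos// hornerM hornerX mulrA.
  apply: le_lt_trans (hC _ sp) _.
  have : `|s| < e / (C + 1).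
    near: s; apply: dnbhs0_lt; rewrite divr_gt0//; lra.
  rewrite gtr0_norm// ltr_pdivlMr; last lra.
  nra.
Unshelve. all: by end_near. Qed.

Definition flat1 : R -> R := flat 1.
Definition dflat1 : R -> R := flat ('X^2).

Lemma flat1_derive t : is_derive t 1 flat1 (dflat1 t).
Proof. by have := flat_is_derive 1 t; rewrite derivC subr0 mulr1. Qed.

Lemma flat1_ge0 t : 0 <= flat1 t.
Proof. by rewrite /flat1 /flat; case: ifP => // _; rewrite hornerC mul1r expR_ge0. Qed.

Lemma flat1_le1 t : flat1 t <= 1.
Proof.
rewrite /flat1 /flat; case: ifP => // t0; rewrite hornerC mul1r expR_le1.
by rewrite oppr_le0 invr_ge0 ltW.
Qed.

Lemma flat1_npos t : t <= 0 -> flat1 t = 0. Proof. exact: flat_npos. Qed.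

Lemma dflat1_ge0 t : 0 <= dflat1 t.
Proof.
rewrite /dflat1 /flat; case: ifP => // _; rewrite hornerXn mulr_ge0 ?expR_ge0//.
by rewrite exprn_even_ge0.
Qed.

Lemma dflat1_npos t : t <= 0 -> dflat1 t = 0. Proof. exact: flat_npos. Qed.

Lemma flat_cont P : continuous (flat P).
Proof.
move=> t; apply: differentiable_continuous; apply/derivable1_diffP.
by have [] := flat_is_derive P t.
Qed.

Lemma flat1_cvg (c d : R) : 0 < c -> flat1 (n%:R * c - d) @[n --> \oo] --> (1 : R).
Proof.
move=> c0.
apply/cvgrPdist_lt => e e0; near=> n.
have t0 : 0 < n%:R * c - d.
  rewrite subr_gt0 -ltr_pdivrMr//; near: n; exact: nbhs_infty_gtr.
have : e^-1 < n%:R * c - d.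
  rewrite ltrBrDr -ltr_pdivrMr//; near: n; exact: nbhs_infty_gtr.
set s := _ - d in t0 * => es; rewrite /flat1 flat_pos// hornerC mul1r.
have h1 : s^-1 < e by rewrite -[e]invrK ltf_pV2 ?posrE ?invr_gt0.
have := expR_ge1Dx (- s^-1) => h2.
have h3 : expR (- s^-1) <= 1 by rewrite expR_le1 oppr_le0 invr_ge0 ltW.
by rewrite ger0_norm ?subr_ge0//; lra.
Unshelve. all: by end_near. Qed.

Lemma flat1_cvgy : flat1 t @[t --> +oo] --> (1 : R).
Proof.
apply/cvgrPdist_lt => e e0; near=> s.
have t0 : 0 < s by near: s; exact: nbhs_pinfty_gt.
have es : e^-1 < s by near: s; apply: nbhs_pinfty_gt; rewrite num_real.
rewrite /flat1 flat_pos// hornerC mul1r.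
have h1 : s^-1 < e by rewrite -[e]invrK ltf_pV2 ?posrE ?invr_gt0.
have := expR_ge1Dx (- s^-1) => h2.
have h3 : expR (- s^-1) <= 1 by rewrite expR_le1 oppr_le0 invr_ge0 ltW.
by rewrite ger0_norm ?subr_ge0//; lra.
Unshelve. all: by end_near. Qed.

(** The profile [flat1] increases from [0] to [1], so that its derivative,
    scaled, approximates a unit mass. *)
Lemma dflat1_integral : (\int[@lebesgue_measure R]_(x in `[0%R, +oo[) (dflat1 x)%:E = 1)%E.
Proof.
rewrite (@ge0_continuous_FTC2y R dflat1 flat1 0 1).
- by rewrite flat1_npos// sube0.
- by move=> x _; exact: dflat1_ge0.
- by apply: continuous_subspaceT => x; exact: flat_cont.
- exact: flat1_cvgy.
- by move=> x _; have [] := flat1_derive x.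
- by apply: cvg_at_right_filter; exact: flat_cont.
- by move=> x _; rewrite derive1E; have [_ ->] := flat1_derive x.
Qed.
End Flat.

Section Smooth.
Variable R : realType.
Implicit Types (phi psi : plane R -> R) (x v : plane R).

(** Smoothness concerns all iterated derivatives, hence it is the largest class
    of differentiable functions that is stable under directional derivatives. *)
Lemma smooth_coind (S : set (plane R -> R)) :
  (forall phi, S phi -> (forall x, differentiable phi x) /\ forall v, S ('D_v phi)) ->
  forall phi, S phi -> smooth phi.
Proof.
move=> h phi Sphi vs; have : S (foldr (fun v g => 'D_v g) phi vs).
  by elim: vs => //= v vs IH; have [_] := h _ IH; exact.
by move=> /h[].
Qed.

Lemma smooth_diff phi x : smooth phi -> differentiable phi x.
Proof. by move=> /(_ [::] x). Qed.

Lemma smoothD_v phi v : smooth phi -> smooth ('D_v phi).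
Proof. by move=> h vs x; have := h (rcons vs v) x; rewrite foldr_rcons. Qed.

Lemma smooth_cont phi : smooth phi -> continuous phi.
Proof. by move=> h x; apply: differentiable_continuous; exact: smooth_diff. Qed.

(** By the sum and product rules this class is stable under derivation, which
    reduces the smoothness of products to [smooth_coind]. *)
Inductive smooth_alg : (plane R -> R) -> Prop :=
| smooth_alg_base phi : smooth phi -> smooth_alg phi
| smooth_alg_add phi psi : smooth_alg phi -> smooth_alg psi -> smooth_alg (phi + psi)
| smooth_alg_mul phi psi : smooth_alg phi -> smooth_alg psi -> smooth_alg (phi * psi).

Lemma diff_deriv phi x (v : plane R) : differentiable phi x -> derivable phi x v.
Proof. exact: diff_derivable. Qed.

Lemma smooth_alg_smooth phi : smooth_alg phi -> smooth phi.
Proof.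
apply: smooth_coind => {phi}; have D phi : smooth_alg phi -> forall x, differentiable phi x.
  elim => {phi} [phi h x|phi psi _ h1 _ h2 x|phi psi _ h1 _ h2 x]; first exact: smooth_diff.
    exact: differentiableD.
  exact: differentiableM.
move=> phi h; split; first exact: D.
move=> v; elim: h => {phi} [phi h|phi psi s1 h1 s2 h2|phi psi s1 h1 s2 h2].
- exact/smooth_alg_base/smoothD_v.
- have -> : 'D_v (phi + psi) = 'D_v phi + 'D_v psi.
    by apply/funext => x; rewrite deriveD//; exact/diff_deriv/D.
  exact: smooth_alg_add.
- have -> : 'D_v (phi * psi) = phi * 'D_v psi + psi * 'D_v phi.
    by apply/funext => x; rewrite deriveM//; exact/diff_deriv/D.
  by apply: smooth_alg_add; exact: smooth_alg_mul.
Qed.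

Lemma smoothD phi psi : smooth phi -> smooth psi -> smooth (phi + psi).
Proof. by move=> h1 h2; apply/smooth_alg_smooth/smooth_alg_add; exact: smooth_alg_base. Qed.

Lemma smoothM phi psi : smooth phi -> smooth psi -> smooth (phi * psi).
Proof. by move=> h1 h2; apply/smooth_alg_smooth/smooth_alg_mul; exact: smooth_alg_base. Qed.

Definition aff (a b c : R) x : R := a * x.1 + b * x.2 + c.

Lemma aff_diff a b c x : differentiable (aff a b c) x.
Proof.
have @f1 : {linear plane R -> R}.
  by exists (fun z : plane R => z.1); do 2![eexists]; do ?[constructor].
have @f2 : {linear plane R -> R}.
  by exists (fun z : plane R => z.2); do 2![eexists]; do ?[constructor].
have h1 : differentiable f1 x by apply: linear_differentiable => y; exact: cvg_fst.
have h2 : differentiable f2 x by apply: linear_differentiable => y; exact: cvg_snd.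
have := differentiableD (differentiableD (differentiableZ a h1) (differentiableZ b h2)) (differentiable_cst c x).
exact.
Qed.

Lemma aff_deriv a b c v x : 'D_v (aff a b c) x = a * v.1 + b * v.2.
Proof.
apply: cvg_lim => //; apply: (@cvg_trans _ (cst (a * v.1 + b * v.2) h @[h --> 0^'])); last exact: cvg_cst.
apply: near_eq_cvg; near=> h.
have h0 : h != 0 by near: h; exact: nbhs_dnbhs_neq.
by rewrite /aff /= /GRing.scale /=; field.
Unshelve. all: by end_near. Qed.

Lemma smooth_cst (c : R) : smooth (fun=> c).
Proof.
apply: (@smooth_coind [set phi | exists c, phi = fun=> c]); last by exists c.
move=> _ [k ->]; split; first by move=> x; exact: differentiable_cst.
by move=> v; exists 0; apply/funext => x; exact: derive_cst.
Qed.

Lemma smooth_aff a b c : smooth (aff a b c).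
Proof.
apply: (@smooth_coind [set phi | exists a b c, phi = aff a b c]); last by do 3 eexists.
move=> _ [a' [b' [c' ->]]]; split; first by move=> x; exact: aff_diff.
move=> v; exists 0, 0, (a' * v.1 + b' * v.2); apply/funext => x.
by rewrite aff_deriv /aff !mul0r !add0r.
Qed.

Lemma smoothZ k phi : smooth phi -> smooth (fun x => k * phi x).
Proof. by move=> h; have := smoothM (smooth_cst k) h. Qed.

Lemma smoothN phi : smooth phi -> smooth (- phi).
Proof.
move=> h; have := smoothZ (-1) h; congr smooth.
by apply/funext => x; rewrite mulN1r.
Qed.

Lemma smoothB phi psi : smooth phi -> smooth psi -> smooth (phi - psi).
Proof. by move=> h1 h2; apply: smoothD => //; exact: smoothN. Qed.

Lemma smooth_sum I (s : seq I) (P : pred I) (F : I -> plane R -> R) :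
  (forall i, P i -> smooth (F i)) -> smooth (fun x => \sum_(i <- s | P i) F i x).
Proof.
move=> h; elim: s => [|i s IH].
  by rewrite (_ : (fun _ => _) = fun=> 0); [exact: smooth_cst|apply/funext => x; rewrite big_nil].
have [Pi|nPi] := boolP (P i).
  rewrite (_ : (fun _ => _) = F i + (fun x => \sum_(i <- s | P i) F i x)); last first.
    by apply/funext => x; rewrite big_cons Pi.
  by apply: smoothD => //; exact: h.
rewrite (_ : (fun _ => _) = (fun x => \sum_(i <- s | P i) F i x))//.
by apply/funext => x; rewrite big_cons (negbTE nPi).
Qed.

Lemma smooth_exp n phi : smooth phi -> smooth (fun x => phi x ^+ n).
Proof.
move=> h; elim: n => [|n IH]; first exact: smooth_cst.
rewrite (_ : (fun _ => _) = phi * (fun x => phi x ^+ n)); first exact: smoothM.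
by apply/funext => x; rewrite exprS.
Qed.

Lemma flat_aff_is_derive P a b c v x :
  'D_v (flat P \o aff a b c) x = (a * v.1 + b * v.2) * flat ('X^2 * (P - P^`())) (aff a b c x).
Proof.
have h1 := @aff_diff a b c x.
have [h2 e2] := flat_is_derive P (aff a b c x).
have h3 : differentiable (flat P) (aff a b c x) by exact/derivable1_diffP.
rewrite deriveE; last exact: differentiable_comp.
rewrite diff_comp//= -(deriveE v h1) aff_deriv -[in 'd _ _ _](mulr1 (_ + _)).
rewrite -[(_ + _) * 1]/((_ + _) *: (1 : R)) linearZ /= -(deriveE (1 : R) h3) e2.
by [].
Qed.

Lemma flat_aff_diff P a b c x : differentiable (flat P \o aff a b c) x.
Proof.
apply: differentiable_comp; first exact: aff_diff.
by apply/derivable1_diffP; have [] := flat_is_derive P (aff a b c x).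
Qed.

Lemma smooth_flat P a b c : smooth (flat P \o aff a b c).
Proof.
apply: (@smooth_coind [set phi | exists k P, phi = (fun x => k * flat P (aff a b c x))]); last first.
  by exists 1, P; apply/funext => x; rewrite mul1r.
move=> _ [k [Q ->]]; split.
  by move=> x; have := differentiableZ k (@flat_aff_diff Q a b c x).
move=> v; exists (k * (a * v.1 + b * v.2)), ('X^2 * (Q - Q^`())); apply/funext => x.
have := @deriveZ _ _ _ _ k _ v (diff_deriv (@flat_aff_diff Q a b c x)).
by rewrite flat_aff_is_derive => -> /=; rewrite /GRing.scale /= mulrA.
Qed.

Lemma smooth_cgrad1 phi : smooth phi -> smooth (fun x => (cgrad phi x).1).
Proof. exact: smoothD_v. Qed.
Lemma smooth_cgrad2 phi : smooth phi -> smooth (fun x => (cgrad phi x).2).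
Proof. exact: smoothD_v. Qed.

Lemma cgradM phi psi x : smooth phi -> smooth psi ->
  cgrad (phi * psi) x = phi x *: cgrad psi x + psi x *: cgrad phi x.
Proof.
move=> h1 h2; rewrite /cgrad !deriveM//; apply: diff_deriv; exact: smooth_diff.
Qed.

Lemma cgradD phi psi x : smooth phi -> smooth psi ->
  cgrad (phi + psi) x = cgrad phi x + cgrad psi x.
Proof.
move=> h1 h2; rewrite /cgrad !deriveD//; apply: diff_deriv; exact: smooth_diff.
Qed.

Lemma cgradZ k phi x : smooth phi -> cgrad (fun x => k * phi x) x = k *: cgrad phi x.
Proof.
move=> h1; have e v : 'D_v (fun x => k * phi x) x = k *: 'D_v phi x.
  by have := @deriveZ _ _ _ _ k _ v (diff_deriv (smooth_diff x h1)).
by rewrite /cgrad !e.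
Qed.

Lemma cgradB phi psi x : smooth phi -> smooth psi ->
  cgrad (phi - psi) x = cgrad phi x - cgrad psi x.
Proof.
move=> h1 h2; rewrite /cgrad !deriveB//; apply: diff_deriv; exact: smooth_diff.
Qed.

Lemma near_cgrad phi psi x : (\near x, phi x = psi x) -> cgrad phi x = cgrad psi x.
Proof. by move=> h; rewrite /cgrad !(near_eq_derive _ h). Qed.

Lemma near_claplace phi psi x : (\near x, phi x = psi x) -> claplace phi x = claplace psi x.
Proof.
move=> h; have h' v : \near x, 'D_v phi x = 'D_v psi x.
  have : \forall y \near x, \forall z \near y, phi z = psi z by exact: near_join.
  by apply: filterS => y hy; exact: near_eq_derive.
by rewrite /claplace !(near_eq_derive _ (h' _)).
Qed.

End Smooth.

(** * Test functions and the fundamental lemma *)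

Section TestFun.
Variable R : realType.
Implicit Types (phi psi g : plane R -> R) (x v : plane R) (D : set (plane R)).

Lemma int_derive0 (F F' : R -> R) (M : R) : 0 < M ->
  (forall x : R, is_derive x 1 F (F' x)) -> continuous F' ->
  (forall x : R, M < `|x| -> F x = 0) ->
  (\int[@lb1 R]_x (F' x)%:E = 0)%E.
Proof.
move=> M0 dF cF' F0; pose a := - (M + 1); pose b := M + 1.
have ab : a < b by rewrite /a /b; lra.
have F'0 (x : R) : M < `|x| -> F' x = 0.
  move=> Mx; have [_ <-] := dF x; rewrite -(derive_cst (0 : R) x 1).
  apply: near_eq_derive; near=> y; rewrite F0//; near: y.
  by apply: (@cvgr_gt _ _ _ _ _ `|x|) => //; apply: cvg_norm; exact: cvg_id.
have cF : continuous F.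
  by move=> x; apply: differentiable_continuous; apply/derivable1_diffP; have [] := dF x.
have -> : (\int[@lb1 R]_x (F' x)%:E = \int[@lb1 R]_(x in `[a, b]) (F' x)%:E)%E.
  rewrite [RHS]integral_mkcond; apply: eq_integral => x _; rewrite /patch.
  case: ifPn => //; rewrite notin_setE /= in_itv /= => /negP h.
  rewrite F'0//; move: h; rewrite /a /b negb_and -!ltNge => /orP[h|h].
    by rewrite ltr0_norm; lra.
  by rewrite gtr0_norm; lra.
rewrite (@continuous_FTC2 R F' F a b ab).
- rewrite !F0 ?subee//; rewrite /a /b; first by rewrite normrN gtr0_norm; lra.
  by rewrite gtr0_norm; lra.
- by apply: continuous_subspaceT => x; exact: cF'.
- split; first by move=> x _; have [] := dF x.
    by apply: cvg_at_right_filter; exact: cF.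
  by apply: cvg_at_left_filter; exact: cF.
- by move=> x _; rewrite derive1E; have [_ ->] := dF x.
Unshelve. all: by end_near. Qed.

Lemma test_sub D E psi : D `<=` E -> test_fun D psi -> test_fun E psi.
Proof. by move=> DE [h [C [C1 C2 C3]]]; split => //; exists C; split => //; exact: subset_trans DE. Qed.

Lemma compact_plane (C : set (plane R)) : compact C ->
  [/\ closed C, measurable C & (@lb2 R C < +oo)%E].
Proof.
move=> cC; have clC : closed C by apply: compact_closed => //; exact: norm_hausdorff.
have mC := closed_measurable2 clC; split => //.
by apply: bounded_finite => //; exact: compact_bounded.
Qed.

Lemma test_mulr D phi psi : smooth phi -> test_fun D psi -> test_fun D (phi * psi).
Proof.
move=> sp [h [C [C1 C2 C3]]]; split; first exact: smoothM.
by exists C; split => // x nC; rewrite -[LHS]/(phi x * psi x) C3// mulr0.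
Qed.

Lemma supp_D (C : set (plane R)) psi v x : closed C -> (forall x, ~ C x -> psi x = 0) -> ~ C x -> 'D_v psi x = 0.
Proof.
move=> clC h nC; rewrite -(derive_cst (0 : R) x v); apply: near_eq_derive.
have : nbhs x (~` C) by apply: open_nbhs_nbhs; split => //; exact: closed_openC.
by apply: filterS => y nCy; rewrite h.
Qed.

Lemma test_D D psi v : test_fun D psi -> test_fun D ('D_v psi).
Proof.
move=> [h [C [C1 C2 C3]]]; split; first exact: smoothD_v.
have [clC _ _] := compact_plane C1.
by exists C; split => // x nC; exact: supp_D C3 _.
Qed.

Lemma compact_abs_bound (C : set (plane R)) psi : compact C -> {within C, continuous psi} ->
  exists2 M, 0 <= M & forall x, C x -> `|psi x| <= M.
Proof.
move=> cC ct; have [M [_ hM]] := compact_bounded (continuous_compact ct cC).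
exists (`|M| + 1); first by rewrite addr_ge0.
move=> x Cx; apply: (hM (`|M| + 1)) => /=; last by exists x.
by apply: le_lt_trans (ler_norm _) _; rewrite ltrDl.
Qed.

Lemma test_bd D psi : test_fun D psi -> exists2 M, 0 <= M & forall x, `|psi x| <= M.
Proof.
move=> [h [C [C1 C2 C3]]].
have [|M M0 hM] := compact_abs_bound C1 (psi := psi).
  by apply: continuous_subspaceT => x; exact: smooth_cont.
exists M => // x; have [Cx|nCx] := pselect (C x); first exact: hM.
by rewrite C3// normr0.
Qed.

Lemma smooth_meas psi D : smooth psi -> measurable_fun D psi.
Proof. by move=> h; apply: cont_measurableT; exact: smooth_cont. Qed.

Lemma test_int D psi : test_fun D psi -> intg (@lb2 R) setT psi.
Proof.
move=> tp; have [M M0 hM] := test_bd tp; have [h [C [C1 C2 C3]]] := tp.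
have [_ mC fC] := compact_plane C1.
apply/(int_supp (@lb2 R) mC measurableT (@subsetT _ _)); first by move=> x _; exact: C3.
by apply: (int_bd (mu := @lb2 R) mC fC _ (fun x _ => hM x)) => //; exact: smooth_meas.
Qed.

Lemma deriv_slice1 psi (x y : R) : smooth psi ->
  is_derive x 1 (fun x : R => psi (x, y)) ('D_((1, 0) : plane R) psi (x, y)).
Proof.
move=> h; have dd := diff_deriv (v := (1, 0)) (smooth_diff (x, y) h).
have e : (fun k : R => k^-1 *: (((fun x : R => psi (x, y)) \o shift x) (k *: (1 : R)) - psi (x, y))) =
  (fun k : R => k^-1 *: ((psi \o shift (x, y)) (k *: ((1, 0) : plane R)) - psi (x, y))).
  apply/funext => k; congr (_ *: (_ - _)) => /=; congr psi.
  by apply/eqP; rewrite -pair_eqE /=; apply/andP; split; apply/eqP; rewrite /GRing.scale /=; ring.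
apply: DeriveDef; first by rewrite /derivable e.
by rewrite /derive e.
Qed.

Lemma deriv_slice2 psi (x y : R) : smooth psi ->
  is_derive y 1 (fun y : R => psi (x, y)) ('D_((0, 1) : plane R) psi (x, y)).
Proof.
move=> h; have dd := diff_deriv (v := (0, 1)) (smooth_diff (x, y) h).
have e : (fun k : R => k^-1 *: (((fun y : R => psi (x, y)) \o shift y) (k *: (1 : R)) - psi (x, y))) =
  (fun k : R => k^-1 *: ((psi \o shift (x, y)) (k *: ((0, 1) : plane R)) - psi (x, y))).
  apply/funext => k; congr (_ *: (_ - _)) => /=; congr psi.
  by apply/eqP; rewrite -pair_eqE /=; apply/andP; split; apply/eqP; rewrite /GRing.scale /=; ring.
apply: DeriveDef; first by rewrite /derivable e.
by rewrite /derive e.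
Qed.

Lemma slice_cont1 psi (y : R) : continuous psi -> continuous (fun x : R => psi (x, y)).
Proof.
move=> h x; apply: (@continuous_comp _ _ _ (fun x : R => (x, y)) psi); last exact: h.
by move=> P [[A B] [/= hA hB] AB]; apply: filterS hA => z Az; apply: AB; split => //; exact: nbhs_singleton hB.
Qed.

Lemma slice_cont2 psi (x : R) : continuous psi -> continuous (fun y : R => psi (x, y)).
Proof.
move=> h y; apply: (@continuous_comp _ _ _ (fun y : R => (x, y)) psi); last exact: h.
by move=> P [[A B] [/= hA hB] AB]; apply: filterS hB => z Bz; apply: AB; split => //; exact: nbhs_singleton hA.
Qed.

Lemma bounded_coords (C : set (plane R)) : bounded_set C -> exists2 M, 0 < M &
  forall x, C x -> `|x.1| <= M /\ `|x.2| <= M.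
Proof.
move=> [M [_ hM]]; exists (`|M| + 1); first by rewrite ltr_pwDr.
move=> x Cx; have := hM (`|M| + 1).
have -> : M < `|M| + 1 by apply: le_lt_trans (ler_norm _) _; rewrite ltrDl.
by move=> /(_ isT x Cx) /=; rewrite prod_normE ge_max => /andP[].
Qed.

Lemma Rint_D1 D psi : test_fun D psi ->
  \int[@lb2 R]_x 'D_((1, 0) : plane R) psi x = 0.
Proof.
move=> tp; have [h [C [C1 C2 C3]]] := tp.
have i1 := test_int (test_D (1, 0) tp).
rewrite /Rintegral -(integral21_prod_meas1 (m1 := @lb1 R) (m2 := @lb1 R) i1).
rewrite integral0_eq// => y _; rewrite /fubini_G.
have [M M0 hM] := bounded_coords (compact_bounded C1).
apply: (@int_derive0 (fun x : R => psi (x, y)) (fun x : R => 'D_((1, 0) : plane R) psi (x, y)) M) => //.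
- by move=> x; exact: deriv_slice1.
- exact: (slice_cont1 (smooth_cont (smoothD_v _ h))).
- by move=> x Mx; apply: C3 => /hM/= [] /le_lt_trans/(_ Mx); rewrite ltxx.
Qed.

Lemma Rint_D2 D psi : test_fun D psi ->
  \int[@lb2 R]_x 'D_((0, 1) : plane R) psi x = 0.
Proof.
move=> tp; have [h [C [C1 C2 C3]]] := tp.
have i1 := test_int (test_D (0, 1) tp).
rewrite /Rintegral -(integral12_prod_meas1 (m1 := @lb1 R) (m2 := @lb1 R) i1).
rewrite integral0_eq// => y _; rewrite /fubini_F.
have [M M0 hM] := bounded_coords (compact_bounded C1).
apply: (@int_derive0 (fun x : R => psi (y, x)) (fun x : R => 'D_((0, 1) : plane R) psi (y, x)) M) => //.
- by move=> x; exact: deriv_slice2.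
- exact: (slice_cont2 (smooth_cont (smoothD_v _ h))).
- by move=> x Mx; apply: C3 => /hM/= [_] /le_lt_trans/(_ Mx); rewrite ltxx.
Qed.

Lemma test_Rint D f psi : measurable D -> test_fun D psi ->
  \int[@lb2 R]_x (f x * psi x) = \int[@lb2 R]_(x in D) (f x * psi x).
Proof.
move=> mD [h [C [C1 C2 C3]]]; apply: (Rint_supp (@lb2 R)) => // x _ nD.
by rewrite C3 ?mulr0// => /C2.
Qed.

(** The derivative of [phi * psi], which has compact support, integrates to [0]. *)
Lemma ibp_test D phi psi v : measurable D -> smooth phi -> test_fun D psi ->
  (forall psi, test_fun D psi -> \int[@lb2 R]_x 'D_v psi x = 0) ->
  \int[@lb2 R]_(x in D) (phi x * 'D_v psi x) = - \int[@lb2 R]_(x in D) ('D_v phi x * psi x).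
Proof.
move=> mD sp tp h0.
rewrite -(test_Rint phi mD (test_D v tp)) -(test_Rint ('D_v phi) mD tp).
apply/eqP; rewrite -addr_eq0 -RintegralD//; last 2 first.
- exact: (test_int (test_mulr sp (test_D v tp))).
- exact: (test_int (test_mulr (smoothD_v v sp) tp)).
rewrite -(h0 _ (test_mulr sp tp)); apply/eqP; apply: Rint_ext => // x _.
rewrite deriveM; [|exact/diff_deriv/smooth_diff|apply/diff_deriv/smooth_diff; by case: tp].
by rewrite /GRing.scale /= [psi x * _]mulrC.
Qed.

Lemma bounded_smooth D psi : bounded_set D -> continuous psi -> exists2 M, 0 <= M & forall x, D x -> `|psi x| <= M.
Proof.
move=> bD cp; have [N N0 hN] := bounded_coords bD.
have cB : compact (`[- N, N] `*` `[- N, N] : set (plane R)).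
  by apply: compact_setX; exact: segment_compact.
have [|M M0 hM] := compact_abs_bound cB (psi := psi).
  by apply: continuous_subspaceT.
exists M => // x Dx; apply: hM; have [h1 h2] := hN x Dx.
by split => /=; rewrite in_itv /= -ler_norml.
Qed.

Lemma L2_smooth D psi : measurable D -> bounded_set D -> smooth psi -> L2 D psi.
Proof.
move=> mD bD sp; have [M M0 hM] := bounded_smooth bD (smooth_cont sp).
have [m1 m2] : sqint (@lb2 R) D psi.
  by apply: (sqint_bd (mu := @lb2 R) mD (bounded_finite mD bD) _ hM); exact: smooth_meas.
by split => //; apply/integrable_leb2.
Qed.

Lemma L2E D psi : L2 D psi <-> sqint (@lb2 R) D psi.
Proof. by split => -[m1 m2]; split => //; apply/integrable_leb2. Qed.

Lemma wgrad_smooth D psi : measurable D -> bounded_set D -> smooth psi ->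
  is_wgrad D psi (cgrad psi).
Proof.
move=> mD bD sp; split; first exact: L2_smooth (smooth_cgrad1 sp).
  exact: L2_smooth (smooth_cgrad2 sp).
move=> phi tp; split.
  exact: (ibp_test (v := (1, 0)) mD sp tp (fun psi h => Rint_D1 h)).
exact: (ibp_test (v := (0, 1)) mD sp tp (fun psi h => Rint_D2 h)).
Qed.
End TestFun.

Section FundLemma.
Variable R : realType.
Implicit Types (g : plane R -> R) (D : set (plane R)).

Definition cbox (a b c d : R) : set (plane R) := `[a, b] `*` `[c, d].
Definition obox (a b c d : R) : set (plane R) := `]a, b[ `*` `]c, d[.

Definition bump (a b c d : R) (n : nat) (x : plane R) : R :=
  flat1 (aff n%:R 0 (- (n%:R * a)) x) * flat1 (aff (- n%:R) 0 (n%:R * b) x) *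
  (flat1 (aff 0 n%:R (- (n%:R * c)) x) * flat1 (aff 0 (- n%:R) (n%:R * d) x)).

Lemma smooth_bump a b c d n : smooth (bump a b c d n).
Proof.
have h := @smooth_flat R 1.
exact: smoothM (smoothM (h _ _ _) (h _ _ _)) (smoothM (h _ _ _) (h _ _ _)).
Qed.

Lemma bump_out a b c d n x : ~ obox a b c d x -> bump a b c d n x = 0.
Proof.
move=> h; rewrite /bump /aff.
have n0 : (0 : R) <= n%:R by [].
have [h1|h1] := lerP x.1 a.
  rewrite flat1_npos ?mul0r//; nra.
have [h2|h2] := lerP b x.1.
  rewrite [flat1 (- _ * _ + _ + _)]flat1_npos ?(mul0r, mulr0)//; nra.
have [h3|h3] := lerP x.2 c.
  rewrite [flat1 (0 * _ + n%:R * _ + _)]flat1_npos ?(mul0r, mulr0)//; nra.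
have [h4|h4] := lerP d x.2.
  rewrite [flat1 (0 * _ + - n%:R * _ + _)]flat1_npos ?(mul0r, mulr0)//; nra.
by exfalso; apply: h; split; rewrite /= in_itv /=; apply/andP.
Qed.

Lemma bump_cvg a b c d x : obox a b c d x -> bump a b c d n x @[n --> \oo] --> (1 : R).
Proof.
case; rewrite /= !in_itv /= => /andP[h1 h2] /andP[h3 h4].
have H (k : R) (f : nat -> R) : 0 < k -> (forall n, f n = n%:R * k - 0) -> flat1 (f n) @[n --> \oo] --> (1 : R).
  by move=> k0 e; under eq_fun do rewrite e; exact: flat1_cvg.
suff : bump a b c d n x @[n --> \oo] --> (1 * 1 * (1 * 1) : R) by rewrite !mulr1.
apply: cvgM; apply: cvgM.
- by apply: (H (x.1 - a)); rewrite ?subr_gt0// => n; rewrite /aff; ring.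
- by apply: (H (b - x.1)); rewrite ?subr_gt0// => n; rewrite /aff; ring.
- by apply: (H (x.2 - c)); rewrite ?subr_gt0// => n; rewrite /aff; ring.
- by apply: (H (d - x.2)); rewrite ?subr_gt0// => n; rewrite /aff; ring.
Qed.

Lemma bump_01 a b c d n x : 0 <= bump a b c d n x <= 1.
Proof.
have h t : 0 <= flat1 (t : R) <= 1 by rewrite flat1_ge0 flat1_le1.
have M (s t : R) : 0 <= s <= 1 -> 0 <= t <= 1 -> 0 <= s * t <= 1.
  by move=> /andP[s0 s1] /andP[t0 t1]; rewrite mulr_ge0// mulr_ile1.
by apply: (M); apply: (M).
Qed.

Lemma compact_cbox a b c d : compact (cbox a b c d).
Proof. by apply: compact_setX; exact: segment_compact. Qed.

Arguments compact_cbox : clear implicits.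

Lemma obox_cbox a b c d : obox a b c d `<=` cbox a b c d.
Proof. by move=> x [h1 h2]; split; [move: h1|move: h2]; exact: subset_itv_oo_cc. Qed.

Lemma measurable_obox a b c d : measurable (obox a b c d).
Proof. by apply: measurableX; exact: measurable_itv. Qed.

(** The bumps converge to the indicator function of the box and are dominated
    by it. *)
Lemma Rint_obox D g a b c d : measurable D -> cbox a b c d `<=` D ->
  intg (@lb2 R) (cbox a b c d) g ->
  (forall phi, test_fun D phi -> \int[@lb2 R]_(x in D) (g x * phi x) = 0) ->
  \int[@lb2 R]_(x in obox a b c d) g x = 0.
Proof.
move=> mD BD ig h.
have mO := measurable_obox a b c d.
have igO : intg (@lb2 R) (obox a b c d) g.
  apply: integrableS ig => //; last exact: obox_cbox.
  by have [_ ] := compact_plane (compact_cbox a b c d).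
have mg : measurable_fun (obox a b c d) g := int_meas igO.
have c1 : \int[@lb2 R]_(x in obox a b c d) (g x * bump a b c d n x) @[n --> \oo] -->
  \int[@lb2 R]_(x in obox a b c d) g x.
  apply: (Rint_dct (mu := @lb2 R) mO _ _ (int_abs igO)).
  - by move=> n; apply: measurable_funM => //; exact: smooth_meas (smooth_bump _ _ _ _ _).
  - by move=> x Ox; rewrite -[X in _ --> X]mulr1; apply: cvgM; [exact: cvg_cst|exact: bump_cvg].
  - move=> n x Ox; rewrite normrM ler_piMr//.
    by have /andP[b0 b1] := bump_01 a b c d n x; rewrite ger0_norm.
have c2 n : \int[@lb2 R]_(x in obox a b c d) (g x * bump a b c d n x) = 0.
  rewrite -(Rint_supp (@lb2 R) (E := D)).
  - apply: h; split; first exact: smooth_bump.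
    exists (cbox a b c d); split => //; first exact: compact_cbox.
    by move=> x nC; apply: bump_out => /obox_cbox.
  - exact: subset_trans (@obox_cbox a b c d) BD.
  - by move=> x _ nO; rewrite bump_out ?mulr0.
have c3 : \int[@lb2 R]_(x in obox a b c d) (g x * bump a b c d n x) @[n --> \oo] --> (0 : R).
  by under eq_fun do rewrite c2; exact: cvg_cst.
by rewrite -(cvg_lim _ c1)// (cvg_lim _ c3).
Qed.

Lemma boxesE : @boxes R = [set A | exists a b c d, A = obox a b c d].
Proof.
apply/seteqP; split => [A [_ [a [b ->]] [_ [c [d ->]] <-]]|A [a [b [c [d ->]]]]].
  by exists a, b, c, d.
by exists `]a, b[%classic; [do 2 eexists|exists `]c, d[%classic => //; do 2 eexists].
Qed.

(** A strip is a countable union of boxes, and the sets whose strip is generated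
    by boxes form a sigma-algebra. *)
Lemma measurable_boxes : @measurable _ (plane R) `<=` <<s @boxes R >>.
Proof.
have sb := @smallest_sigma_algebra _ setT (@boxes R).
have UI (A : set R) : \bigcup_n (A `*` `]- n%:R, n%:R[) = A `*` [set: R].
  apply/seteqP; split => [[x y] [n _ [/= Ax _]]//|[x y] [/= Ax _]].
  exists (Num.truncn `|y|).+1 => //; split => //=; rewrite in_itv /= -ltr_norml.
  by rewrite truncnS_gt.
have UI' (A : set R) : \bigcup_n (`]- n%:R, n%:R[ `*` A) = [set: R] `*` A.
  apply/seteqP; split => [[x y] [n _ [_ /= Ax]]//|[x y] [_ /= Ax]].
  exists (Num.truncn `|x|).+1 => //; split => //=; rewrite in_itv /= -ltr_norml.
  by rewrite truncnS_gt.
have f1 (A : set R) : measurable A -> <<s @boxes R >> (A `*` setT).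
  move=> mA; have {}mA : (@RGenOpens.G R).-sigma.-measurable A by rewrite -RGenOpens.measurableE.
  apply: (mA [set A : set R | <<s @boxes R >> (A `*` setT)]); split.
    split => //=.
    - by rewrite set0X; have [] := sb.
    - move=> B hB /=; have -> : (setT `\` B) `*` [set: R] = setT `\` (B `*` [set: R]).
        by apply/seteqP; split => -[x y] /=; tauto.
      by have [_ + _] := sb; apply.
    - move=> F hF /=; have -> : (\bigcup_i F i) `*` [set: R] = \bigcup_i (F i `*` [set: R]).
        by apply/seteqP; split => -[x y] /= [] => [[i _ ?] _|i _ [? _]]; [exists i|split => //; exists i].
      by have [_ _] := sb; apply.
  move=> _ [a [b ->]] /=; rewrite -UI.
  have [_ _] := sb; apply => n; apply: sub_sigma_algebra.
  by rewrite boxesE; do 4 eexists.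
have f2 (A : set R) : measurable A -> <<s @boxes R >> (setT `*` A).
  move=> mA; have {}mA : (@RGenOpens.G R).-sigma.-measurable A by rewrite -RGenOpens.measurableE.
  apply: (mA [set A : set R | <<s @boxes R >> (setT `*` A)]); split.
    split => //=.
    - by rewrite setX0; have [] := sb.
    - move=> B hB /=; have -> : [set: R] `*` (setT `\` B) = setT `\` ([set: R] `*` B).
        by apply/seteqP; split => -[x y] /=; tauto.
      by have [_ + _] := sb; apply.
    - move=> F hF /=; have -> : [set: R] `*` (\bigcup_i F i) = \bigcup_i ([set: R] `*` F i).
        by apply/seteqP; split => -[x y] /= [] => [_ [i _ ?]|i _ [_ ?]]; [exists i|split => //; exists i].
      by have [_ _] := sb; apply.
  move=> _ [a [b ->]] /=; rewrite -UI'.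
  have [_ _] := sb; apply => n; apply: sub_sigma_algebra.
  by rewrite boxesE; do 4 eexists.
apply: smallest_sub; first exact: sb.
move=> A [[B mB <-]|[B mB <-]]; rewrite setTI.
  by have := f1 B mB; congr (<<s _ >> _); apply/seteqP; split => x /=; tauto.
by have := f2 B mB; congr (<<s _ >> _); apply/seteqP; split => x /=; tauto.
Qed.

Lemma itvI (a b a' b' : R) : `]a, b[ `&` `]a', b'[ = `]Num.max a a', Num.min b b'[%classic.
Proof.
apply/seteqP; split => x /=; rewrite !in_itv /= gt_max lt_min; first by move=> [/andP[-> ->] /andP[-> ->]].
by move=> /andP[/andP[-> ->] /andP[-> ->]].
Qed.

Lemma oboxI a b c d a' b' c' d' : obox a b c d `&` obox a' b' c' d' =
  obox (Num.max a a') (Num.min b b') (Num.max c c') (Num.min d d').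
Proof. by rewrite /obox -!itvI setXI. Qed.

(** The sets over which [g] has integral zero within the box form a lambda-system
    which contains the boxes, and boxes are stable under intersection. *)
Lemma fund_box D g a b c d : measurable D -> cbox a b c d `<=` D ->
  intg (@lb2 R) (cbox a b c d) g ->
  (forall phi, test_fun D phi -> \int[@lb2 R]_(x in D) (g x * phi x) = 0) ->
  all_ae (@lb2 R) (fun x => obox a b c d x -> g x = 0).
Proof.
move=> mD BD ig h; set B := obox a b c d.
have mB : measurable B := measurable_obox a b c d.
have [_ mC fC] := compact_plane (compact_cbox a b c d).
have igB : intg (@lb2 R) B g by apply: integrableS ig => //; exact: obox_cbox.
have mg : measurable_fun B g := int_meas igB.
pose H := [set A : set (plane R) | measurable A /\ \int[@lb2 R]_(x in B) (g x * \1_A x) = 0].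
have iA A : measurable A -> intg (@lb2 R) B (fun x => g x * \1_A x).
  move=> mA; apply: (int_dom (mu := @lb2 R) mB _ _ (int_abs igB)).
    by apply: measurable_funM => //; exact: measurable_indic.
  by move=> x _; rewrite normrM ler_piMr// ger0_norm// indicE; case: (_ \in _).
have HB A : @boxes R A -> H A.
  move=> bA; split; first exact: boxes_measurable.
  move: bA; rewrite boxesE => -[a' [b' [c' [d' ->]]]].
  set B' := obox a' b' c' d'.
  have e : \int[@lb2 R]_(x in B) (g x * \1_B' x) = \int[@lb2 R]_(x in B `&` B') g x.
    rewrite [RHS]Rintegral_mkcondr; apply: Rint_ext => x _.
    by rewrite /patch indicE; case: ifP => _; rewrite ?mulr1 ?mulr0.
  rewrite e /B /B' oboxI.
  have sub : cbox (Num.max a a') (Num.min b b') (Num.max c c') (Num.min d d') `<=` cbox a b c d.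
    move=> x [/=]; rewrite !in_itv /= !ge_max !le_min.
    move=> /andP[/andP[h1 _] /andP[h2 _]] /andP[/andP[h3 _] /andP[h4 _]].
    by split; rewrite /= in_itv /=; apply/andP.
  apply: (Rint_obox (D := D)) => //; first exact: subset_trans BD.
  apply: integrableS ig => //.
  by have [] := compact_plane (compact_cbox (Num.max a a') (Num.min b b') (Num.max c c') (Num.min d d')).
have sI : setI_closed (@boxes R).
  move=> X Y; rewrite boxesE => -[a1 [b1 [c1 [d1 ->]]]] [a2 [b2 [c2 [d2 ->]]]].
  by rewrite oboxI; do 4 eexists.
have lH : lambda_system setT H.
  split => //.
  - split => //; have [_ <-] : H B by apply: HB; rewrite boxesE; do 4 eexists.
    by apply: Rint_ext => // x Bx; rewrite !indicE !mem_set.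
  - move=> X Y YX [mX iX] [mY iY]; split; first exact: measurableD.
    have <- : \int[@lb2 R]_(x in B) (g x * \1_X x) - \int[@lb2 R]_(x in B) (g x * \1_Y x) = 0.
      by rewrite iX iY subrr.
    rewrite -RintegralB//; [|exact: iA|exact: iA].
    apply: Rint_ext => // x _; rewrite -mulrBr; congr (_ * _); rewrite !indicE.
    have [Yx|nYx] := boolP (x \in Y).
      have Xx : x \in X by rewrite inE; apply: YX; rewrite inE in Yx.
      rewrite Xx subrr (_ : (x \in _) = false)//; apply/negbTE; rewrite notin_setE => -[_]; apply.
      by rewrite inE in Yx.
    rewrite subr0; congr (_%:R); congr nat_of_bool; apply/idP/idP; rewrite !inE.
      by case.
    by move=> Xx; split => // Yx; move: nYx; rewrite notin_setE.
  - move=> F ndF HF; split; first by apply: bigcup_measurable => n _; have [] := HF n.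
    have c1 : \int[@lb2 R]_(x in B) (g x * \1_(F n) x) @[n --> \oo] -->
      \int[@lb2 R]_(x in B) (g x * \1_(\bigcup_n F n) x).
      apply: (Rint_dct (mu := @lb2 R) mB _ _ (int_abs igB)).
      + by move=> n; apply: measurable_funM => //; apply: measurable_indic; have [] := HF n.
      + move=> x Bx; apply: cvgM; first exact: cvg_cst.
        have [[n _ Fnx]|nF] := pselect ((\bigcup_n F n) x).
          rewrite indicE mem_set; last by exists n.
          apply: cvg_near_cst; near=> m; rewrite indicE mem_set//.
          have : (F n `<=` F m) by apply/subsetPset/ndF; near: m; exact: nbhs_infty_ge.
          exact.
        rewrite indicE memNset//; apply: cvg_near_cst; apply: nearW => m.
        by rewrite indicE memNset// => Fm; apply: nF; exists m.
      + move=> n x Ox; rewrite normrM ler_piMr// ger0_norm// indicE; by case: (_ \in _).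
    have c3 : \int[@lb2 R]_(x in B) (g x * \1_(F n) x) @[n --> \oo] --> (0 : R).
      by under eq_fun do rewrite (HF _).2; exact: cvg_cst.
    by rewrite -(cvg_lim _ c1)// (cvg_lim _ c3).
have allH A : measurable A -> H A.
  move=> mA; exact: (lambda_system_subset sI lH HB (fun X _ => @subsetT _ X) (measurable_boxes mA)).
have := @integral_ae_eq _ _ _ (@lb2 R) B mB (cst 0%E) (EFin \o g) igB (measurable_cst _).
have hE E : E `<=` B -> measurable E ->
  (\int[@lb2 R]_(x in E) (EFin \o g) x = \int[@lb2 R]_(x in E) cst 0 x)%E.
  move=> EB mE; have [_ hE] := allH E mE.
  have igE : intg (@lb2 R) E g by apply: integrableS igB.
  rewrite integral0; apply: etrans (esym (Rint_fin (mu := @lb2 R) mE igE)) _.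
  congr EFin; apply: etrans _ hE; rewrite (Rint_supp (@lb2 R) EB).
    by apply: Rint_ext => // x Ex; rewrite indicE mem_set// mulr1.
  by move=> x _ nE; rewrite indicE memNset// mulr0.
by move=> /(_ hE); apply: all_aeS => x hx Bx; have [] := hx Bx.
Unshelve. all: by end_near. Qed.

(** Countably many boxes with rational corners and closures in [D] cover [D]. *)
Lemma fund_lemma D g : open D ->
  (forall C, compact C -> C `<=` D -> intg (@lb2 R) C g) ->
  (forall phi, test_fun D phi -> \int[@lb2 R]_(x in D) (g x * phi x) = 0) ->
  all_ae (@lb2 R) (fun x => D x -> g x = 0).
Proof.
move=> oD ig h; have mD := open_measurable2 oD.
pose B (n : nat) : rat * rat * (rat * rat) := if unpickle n is Some q then q else (0, 0, (0, 0)).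
(* the numbering of the boxes sends a code of no quadruple to an empty box *)
pose bx n := obox (ratr (B n).1.1) (ratr (B n).1.2) (ratr (B n).2.1) (ratr (B n).2.2).
pose cx n := cbox (ratr (B n).1.1) (ratr (B n).1.2) (ratr (B n).2.1) (ratr (B n).2.2).
have H n : all_ae (@lb2 R) (fun x => bx n x -> cx n `<=` D -> g x = 0).
  have [cD|ncD] := pselect (cx n `<=` D); last by apply: all_aeW => x _ /ncD.
  have := fund_box mD cD (ig _ (compact_cbox _ _ _ _) cD) h.
  by apply: all_aeS => x hx bxx _; exact: hx.
have H' : all_ae (@lb2 R) (fun x => forall n, bx n x -> cx n `<=` D -> g x = 0).
  exact: all_ae_foralln.
apply: all_aeS H' => x hx Dx.
have : nbhs x D by exact: open_nbhs_nbhs.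
move=> /nbhs_ballP[e /= e0 xD].
have e2 : 0 < e / 2 by rewrite divr_gt0.
have H1 (t : R) : exists q r : rat, [/\ t - e / 2 < ratr q, ratr q < t, t < ratr r & ratr r < t + e / 2].
  have /rat_in_itvoo[a] : t - e / 2 < t by lra.
  have /rat_in_itvoo[b] : t < t + e / 2 by lra.
  by rewrite !in_itv /= => /andP[h1 h2] /andP[h3 h4]; exists a, b.
have [q1 [r1 [a1 a2 a3 a4]]] := H1 x.1; have [q2 [r2 [b1 b2 b3 b4]]] := H1 x.2.
apply: (hx (pickle ((q1, r1), (q2, r2)))); rewrite /bx /cx /B pickleK /=.
  by split; rewrite /= in_itv /=; apply/andP.
move=> y [/=]; rewrite !in_itv /= => /andP[c1 c2] /andP[c3 c4].
apply: xD; split; rewrite /ball /= ltr_norml; apply/andP; split; lra.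
Qed.
End FundLemma.

(** * Weak gradients *)

Section Sobolev.
Variable R : realType.
Implicit Types (u v w phi : plane R -> R) (g h : plane R -> plane R) (D : set (plane R)).

Notation sq := (sqint (@lb2 R)).
Notation nrm2 := (nrm (@lb2 R)).
Notation aeD D P := (all_ae (@lb2 R) (fun x => D x -> P x)).

Lemma sqint_test D E psi : mble D -> test_fun E psi -> sq D psi.
Proof.
move=> mD tp; apply: (sqint_sub mD (measurableT : mble setT)) => //.
have [h _] := tp; split; first exact: smooth_meas.
have := test_int (test_mulr h tp); apply: (int_ext (measurableT : mble setT)) => x _; by rewrite expr2.
Qed.

Lemma sqint_locint D f : mble D -> sq D f ->
  forall C, compact C -> C `<=` D -> intg (@lb2 R) C f.
Proof.
move=> mD sf C cC CD; have [_ mC fC] := compact_plane cC; have {}mC : mble C := mC.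
by apply: (sqint_int (mu := @lb2 R) mC fC); exact: (sqint_sub mC mD CD).
Qed.

Lemma intg_test D E f psi : mble D -> sq D f -> test_fun E psi ->
  intg (@lb2 R) D (fun x => f x * psi x).
Proof. by move=> mD sf tp; apply: sqint_mul => //; exact: sqint_test tp. Qed.

Lemma sq_test_uniq D f f' : open D -> sq D f -> sq D f' ->
  (forall phi, test_fun D phi -> \int[@lb2 R]_(x in D) (f x * phi x) =
     \int[@lb2 R]_(x in D) (f' x * phi x)) ->
  aeD D (fun x => f x = f' x).
Proof.
move=> oD sf sf' e; have mD := open_mble oD.
have := @fund_lemma R D (fun x => f x - f' x) oD.
have s : sq D (fun x => f x - f' x) by exact: (sqintB mD).
move=> /(_ (sqint_locint mD s)) H.
have {}H : aeD D (fun x => f x - f' x = 0).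
  apply: H => phi tp; have := e phi tp => /eqP; rewrite -subr_eq0 => /eqP <-.
  rewrite -RintegralB//; [|exact: intg_test tp|exact: intg_test tp].
  by apply: Rint_ext => x _; rewrite mulrBl.
by apply: all_aeS H => x hx Dx; apply/eqP; rewrite -subr_eq0 hx.
Qed.

Lemma wgrad_sq D v g : is_wgrad D v g -> sq D (fun x => (g x).1) /\ sq D (fun x => (g x).2).
Proof. by case=> /L2E ? /L2E ?. Qed.

Lemma wgrad_uniq D v g h : open D -> is_wgrad D v g -> is_wgrad D v h ->
  aeD D (fun x => g x = h x).
Proof.
move=> oD wg wh; have [g1 g2] := wgrad_sq wg; have [h1 h2] := wgrad_sq wh.
have [_ _ Hg] := wg; have [_ _ Hh] := wh.
have e1 : aeD D (fun x => (g x).1 = (h x).1).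
  apply: sq_test_uniq => // phi tp; apply: oppr_inj.
  by have [<- _] := Hg phi tp; have [<- _] := Hh phi tp.
have e2 : aeD D (fun x => (g x).2 = (h x).2).
  apply: sq_test_uniq => // phi tp; apply: oppr_inj.
  by have [_ <-] := Hg phi tp; have [_ <-] := Hh phi tp.
apply: all_aeS2 e1 e2 => x q1 q2 Dx.
by rewrite (surjective_pairing (g x)) q1// q2// -surjective_pairing.
Qed.

Lemma wgradP D v : H1 D v -> is_wgrad D v (wgrad D v).
Proof. by move=> [_ ex]; rewrite /wgrad; exact: xgetPex. Qed.

Lemma wgradE D v g : open D -> is_wgrad D v g -> aeD D (fun x => wgrad D v x = g x).
Proof.
move=> oD wg; apply: (wgrad_uniq oD _ wg); rewrite /wgrad.
by apply: xgetPex; exists g.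
Qed.

Lemma Rint_lin D (f f' psi : plane R -> R) (a b : R) : mble D -> sq D f -> sq D f' ->
  test_fun D psi ->
  \int[@lb2 R]_(x in D) ((a * f x + b * f' x) * psi x) =
  a * \int[@lb2 R]_(x in D) (f x * psi x) + b * \int[@lb2 R]_(x in D) (f' x * psi x).
Proof.
move=> mD s1 s2 tt; have i1 := intg_test mD s1 tt; have i2 := intg_test mD s2 tt.
rewrite -!RintegralZl// -RintegralD//; [|exact: (intZ mD)|exact: (intZ mD)].
by apply: Rint_ext => x _; ring.
Qed.

Lemma ibp_lin D (f f' F F' psi phi : plane R -> R) (a b : R) : mble D ->
  sq D f -> sq D f' -> sq D F -> sq D F' -> test_fun D psi -> test_fun D phi ->
  \int[@lb2 R]_(x in D) (f x * psi x) = - (\int[@lb2 R]_(x in D) (F x * phi x)) ->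
  \int[@lb2 R]_(x in D) (f' x * psi x) = - (\int[@lb2 R]_(x in D) (F' x * phi x)) ->
  \int[@lb2 R]_(x in D) ((a * f x + b * f' x) * psi x) =
  - (\int[@lb2 R]_(x in D) ((a * F x + b * F' x) * phi x)).
Proof. by move=> mD sf sf' sF sF' tpsi tphi e1 e2; rewrite !Rint_lin// e1 e2; ring. Qed.

Lemma wgrad_lin D v w g h (a b : R) : mble D -> L2 D v -> L2 D w ->
  is_wgrad D v g -> is_wgrad D w h ->
  is_wgrad D (fun x => a * v x + b * w x) (fun x => a *: g x + b *: h x).
Proof.
move=> mD /L2E sv /L2E sw wg wh; have [g1 g2] := wgrad_sq wg; have [h1 h2] := wgrad_sq wh.
have [_ _ Hg] := wg; have [_ _ Hh] := wh; split.
- by apply/L2E/(sqintD mD); apply: (sqintZ mD).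
- by apply/L2E/(sqintD mD); apply: (sqintZ mD).
move=> phi tp; have [eg1 eg2] := Hg phi tp; have [eh1 eh2] := Hh phi tp.
by split; [exact: (@ibp_lin D v w (fun x => (g x).1) (fun x => (h x).1) _ phi a b mD sv sw g1 h1 (test_D (1,
    0) tp) tp eg1 eh1)|
  exact: (@ibp_lin D v w (fun x => (g x).2) (fun x => (h x).2) _ phi a b mD sv sw g2 h2 (test_D (0, 1) tp) tp eg2 eh2)].
Qed.

Lemma L2_lin D v w (a b : R) : mble D -> L2 D v -> L2 D w ->
  L2 D (fun x => a * v x + b * w x).
Proof.
by move=> mD /L2E sv /L2E sw; apply/L2E; apply: (sqintD mD); exact: (sqintZ mD).
Qed.

Lemma wgrad_ext D v w g : (forall x, D x -> v x = w x) -> is_wgrad D v g -> is_wgrad D w g.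
Proof.
move=> vw [h1 h2 h]; split => // phi tp; have [e1 e2] := h phi tp; split.
  by rewrite -e1; apply: Rint_ext => x Dx; rewrite vw.
by rewrite -e2; apply: Rint_ext => x Dx; rewrite vw.
Qed.

Lemma wgrad_sub D E v g : mble D -> mble E -> D `<=` E ->
  is_wgrad E v g -> is_wgrad D v g.
Proof.
move=> mD mE DE wg; have [g1 g2] := wgrad_sq wg; have [_ _ H] := wg.
split; [exact/L2E/(sqint_sub mD mE)|exact/L2E/(sqint_sub mD mE)|move=> phi tp].
have key (f psi : plane R -> R) : test_fun D psi ->
  \int[@lb2 R]_(x in E) (f x * psi x) = \int[@lb2 R]_(x in D) (f x * psi x).
  by move=> t; rewrite -(test_Rint f mD t) -(test_Rint f mE (test_sub DE t)).
have [e1 e2] := H phi (test_sub DE tp); split.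
  by rewrite -(key _ _ (test_D _ tp)) e1 (key (fun x => (g x).1) _ tp).
by rewrite -(key _ _ (test_D _ tp)) e2 (key (fun x => (g x).2) _ tp).
Qed.

Lemma L2_sub D E v : mble D -> mble E -> D `<=` E -> L2 E v -> L2 D v.
Proof. by move=> mD mE DE /L2E h; apply/L2E/(sqint_sub mD mE). Qed.

Lemma L2vnormE D g : mble D -> sq D (fun x => (g x).1) -> sq D (fun x => (g x).2) ->
  L2vnorm D g ^+ 2 = nrm2 D (fun x => (g x).1) ^+ 2 + nrm2 D (fun x => (g x).2) ^+ 2.
Proof.
move=> mD [_ s1] [_ s2]; rewrite sqr_sqrtr; last first.
  by apply: Rintegral_ge0 => x _; rewrite /dot -!expr2 addr_ge0 ?sqr_ge0.
by rewrite !nrm_sqr -RintegralD//; apply: Rint_ext => x _; rewrite /dot -!expr2.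
Qed.

Lemma wgrad_meas D v : H1 D v -> sq D (fun x => (wgrad D v x).1) /\ sq D (fun x => (wgrad D v x).2).
Proof. by move=> /wgradP/wgrad_sq. Qed.

Lemma H1normE D v g : open D -> L2 D v -> is_wgrad D v g ->
  H1norm D v ^+ 2 = nrm2 D v ^+ 2 + (nrm2 D (fun x => (g x).1) ^+ 2 + nrm2 D (fun x => (g x).2) ^+ 2).
Proof.
move=> oD lv wg; have mD := open_mble oD; have e := wgradE oD wg.
have [g1 g2] := wgrad_sq wg.
have [h1 h2] : sq D (fun x => (wgrad D v x).1) /\ sq D (fun x => (wgrad D v x).2).
  by apply: wgrad_meas; split => //; exists g.
rewrite sqr_sqrtr; last by rewrite addr_ge0 ?sqr_ge0.
rewrite (L2vnormE mD h1 h2); congr (_ + (_ ^+ 2 + _ ^+ 2)).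
  apply: nrm_ae => //; [|by have [] := h1|by have [] := g1].
  by apply: all_aeS e => x ex Dx; rewrite ex.
apply: nrm_ae => //; [|by have [] := h2|by have [] := g2].
by apply: all_aeS e => x ex Dx; rewrite ex.
Qed.

Lemma cvg_sqr0 (a : nat -> R) : (a n ^+ 2 @[n --> \oo] --> (0 : R)) <-> (a n @[n --> \oo] --> (0 : R)).
Proof.
split => h; last first.
  have -> : (fun n => a n ^+ 2) = (fun n => a n * a n) by apply/funext => n; rewrite expr2.
  by have := cvgM h h; rewrite mulr0; exact.
apply/cvgr0Pnorm_lt => e e0.
have e2 : 0 < e ^+ 2 by rewrite exprn_gt0.
move/cvgr0Pnorm_lt : h => /(_ _ e2); apply: filterS => n.
by rewrite normrX ltr_sqr ?nnegrE// ltW.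
Qed.

Lemma cvg0_le (a b : nat -> R) : (forall n, 0 <= a n <= b n) ->
  b n @[n --> \oo] --> (0 : R) -> a n @[n --> \oo] --> (0 : R).
Proof.
move=> h; apply: (@squeeze_cvgr _ _ _ _ (fun=> 0)); last exact: cvg_cst.
by apply: nearW => n.
Qed.

Lemma H1norm_cvg D (v : nat -> plane R -> R) (g : nat -> plane R -> plane R) :
  open D -> (forall n, L2 D (v n)) -> (forall n, is_wgrad D (v n) (g n)) ->
  H1norm D (v n) @[n --> \oo] --> (0 : R) <->
  [/\ nrm2 D (v n) @[n --> \oo] --> (0 : R),
      nrm2 D (fun x => (g n x).1) @[n --> \oo] --> (0 : R) &
      nrm2 D (fun x => (g n x).2) @[n --> \oo] --> (0 : R)].
Proof.
move=> oD lv wg; rewrite -cvg_sqr0; under eq_fun do rewrite (H1normE oD (lv _) (wg _)).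
split => [h|[h1 h2 h3]].
  by split; apply/cvg_sqr0; apply: cvg0_le h => n; have := sqr_ge0 (nrm2 D (v n));
   have := sqr_ge0 (nrm2 D (fun x => (g n x).1)); have := sqr_ge0 (nrm2 D (fun x => (g n x).2));
   lra.
rewrite -[X in _ --> X](addr0 (0 : R)) -[X in _ --> _ + X](addr0 (0 : R)).
by apply: cvgD; [|apply: cvgD]; exact/cvg_sqr0.
Qed.

(** Convergence in [H^1(D)] expressed with a given weak gradient [g] of the limit,
    instead of the one that [H1norm] selects. *)
Definition H1cvg D (phi : nat -> plane R -> R) v g :=
  [/\ nrm2 D (fun x => phi n x - v x) @[n --> \oo] --> (0 : R),
      nrm2 D (fun x => (cgrad (phi n) x).1 - (g x).1) @[n --> \oo] --> (0 : R) &
      nrm2 D (fun x => (cgrad (phi n) x).2 - (g x).2) @[n --> \oo] --> (0 : R)].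

Lemma wgradB D v w g h : mble D -> L2 D v -> L2 D w ->
  is_wgrad D v g -> is_wgrad D w h ->
  is_wgrad D (v - w) (fun x => g x - h x).
Proof.
move=> mD lv lw wg wh; have := wgrad_lin 1 (-1) mD lv lw wg wh.
have -> : (fun x => 1 * v x + -1 * w x) = v - w.
  by apply/funext => x; rewrite mul1r mulN1r.
by congr is_wgrad; apply/funext => x; rewrite scale1r scaleN1r.
Qed.

Lemma L2B D v w : mble D -> L2 D v -> L2 D w -> L2 D (v - w).
Proof.
move=> mD lv lw; have := L2_lin 1 (-1) mD lv lw.
by congr L2; apply/funext => x; rewrite mul1r mulN1r.
Qed.

Lemma H1norm_smooth_cvg D (phi : nat -> plane R -> R) v g : open D -> bounded_set D ->
  (forall n, smooth (phi n)) -> L2 D v -> is_wgrad D v g ->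
  H1norm D (phi n - v) @[n --> \oo] --> (0 : R) <-> H1cvg D phi v g.
Proof.
move=> oD bD sp lv wg; have mD := open_mble oD.
have lp n : L2 D (phi n) by exact: L2_smooth.
have wp n : is_wgrad D (phi n) (cgrad (phi n)) by exact: wgrad_smooth.
exact: (@H1norm_cvg D (fun n => phi n - v) (fun n x => cgrad (phi n) x - g x) oD (fun n => L2B mD (lp n) lv)
    (fun n => wgradB mD (lp n) lv (wp n) wg)).
Qed.

Lemma H10P D v : open D -> bounded_set D -> H10 D v <->
  exists g (phi : nat -> plane R -> R), [/\ L2 D v, is_wgrad D v g, forall n, test_fun D (phi n) & H1cvg D phi v g].
Proof.
move=> oD bD; split => [[h1 [phi [tp cv]]]|[g [phi [lv wg tp cv]]]].
  exists (wgrad D v), phi; have wg := wgradP h1; have [lv _] := h1; split => //.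
  by apply/H1norm_smooth_cvg => // n; have [] := tp n.
split; first by split => //; exists g.
by exists phi; split => //; apply/(H1norm_smooth_cvg oD bD _ lv wg) => // n; have [] := tp n.
Qed.

Lemma test_lin D phi psi (a b : R) : test_fun D phi -> test_fun D psi ->
  test_fun D (fun x => a * phi x + b * psi x).
Proof.
move=> [h1 [C1 [c1 d1 e1]]] [h2 [C2 [c2 d2 e2]]]; split.
  exact: smoothD (smoothZ a h1) (smoothZ b h2).
exists (C1 `|` C2); split; first exact: compactU.
  by move=> x [/d1|/d2].
by move=> x /not_orP[n1 n2]; rewrite e1// e2// !mulr0 addr0.
Qed.

Lemma nrm_lin_cvg D (f f' : nat -> plane R -> R) (F F' : plane R -> R) (a b : R) : mble D ->
  (forall n, sq D (f n)) -> (forall n, sq D (f' n)) -> sq D F -> sq D F' ->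
  nrm2 D (fun x => f n x - F x) @[n --> \oo] --> (0 : R) ->
  nrm2 D (fun x => f' n x - F' x) @[n --> \oo] --> (0 : R) ->
  nrm2 D (fun x => (a * f n x + b * f' n x) - (a * F x + b * F' x)) @[n --> \oo] --> (0 : R).
Proof.
move=> mD sf sf' sF sF' h h'.
have s1 n : sq D (fun x => f n x - F x) by exact: (sqintB mD).
have s2 n : sq D (fun x => f' n x - F' x) by exact: (sqintB mD).
apply: (@cvg0_le _ (fun n => `|a| * nrm2 D (fun x => f n x - F x) + `|b| * nrm2 D (fun x => f' n x - F' x))).
  move=> n; rewrite nrm_ge0 /=.
  rewrite (@nrm_ext _ _ _ (@lb2 R) D _ (fun x => a * (f n x - F x) + b * (f' n x - F' x))); last by move=> x _; ring.
  rewrite -!(nrmZ mD _ (s1 _)) -!(nrmZ mD _ (s2 _)); exact: (nrmD mD (sqintZ mD a (s1 n)) (sqintZ mD b (s2 n))).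
rewrite -[X in _ --> X](addr0 (0 : R)) -[X in _ --> X + _](mulr0 `|a|) -[X in _ --> _ + X](mulr0 `|b|).
by apply: cvgD; apply: cvgM => //; exact: cvg_cst.
Qed.

Lemma H10_lin D v w (a b : R) : open D -> bounded_set D -> H10 D v -> H10 D w ->
  H10 D (fun x => a * v x + b * w x).
Proof.
move=> oD bD /(H10P _ oD bD)[g [phi [lv wg tp [c1 c2 c3]]]] /(H10P _ oD bD)[h [psi [lw wh tq [d1 d2 d3]]]].
have mD := open_mble oD.
have sp n : smooth (phi n) by have [] := tp n.
have sq' n : smooth (psi n) by have [] := tq n.
have L2s q : smooth q -> sq D q by move=> ?; apply/L2E; exact: L2_smooth.
have [g1 g2] := wgrad_sq wg; have [h1 h2] := wgrad_sq wh.
apply/(H10P _ oD bD); exists (fun x => a *: g x + b *: h x), (fun n x => a * phi n x + b * psi n x).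
have cg n x : cgrad (fun x => a * phi n x + b * psi n x) x = a *: cgrad (phi n) x + b *: cgrad (psi n) x.
  by rewrite -!cgradZ//; exact: cgradD (smoothZ _ _) (smoothZ _ _).
split; [exact: L2_lin|exact: wgrad_lin|by move=> n; exact: test_lin|split].
- by apply: nrm_lin_cvg => // [n|n||]; [exact: L2s|exact: L2s|exact/L2E|exact/L2E].
- under eq_fun => n do rewrite (@nrm_ext _ _ _ (@lb2 R) D _ (fun x => (a * (cgrad (phi n) x).1 + b * (cgrad
    (psi n) x).1) - (a * (g x).1 + b * (h x).1)) (fun x _ => congr1 (fun z => z.1 - _) (cg n x))).
  by apply: (nrm_lin_cvg (f := fun n x => (cgrad (phi n) x).1)) => // n; apply: L2s; exact: smooth_cgrad1.
- under eq_fun => n do rewrite (@nrm_ext _ _ _ (@lb2 R) D _ (fun x => (a * (cgrad (phi n) x).2 + b * (cgrad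
    (psi n) x).2) - (a * (g x).2 + b * (h x).2)) (fun x _ => congr1 (fun z => z.2 - _) (cg n x))).
  by apply: (nrm_lin_cvg (f := fun n x => (cgrad (phi n) x).2)) => // n; apply: L2s; exact: smooth_cgrad2.
Qed.

Lemma H10_0 D : open D -> bounded_set D -> H10 D (fun=> 0).
Proof.
move=> oD bD; have mD := open_mble oD; have s0 := @smooth_cst R 0.
have t0 : test_fun D (fun=> 0).
  by split => //; exists set0; split => //; exact: compact0.
apply/(H10P _ oD bD); exists (cgrad (fun=> 0)), (fun _ => fun=> 0); split => //.
- exact: L2_smooth.
- exact: wgrad_smooth.
have e (f : plane R -> R) : nrm2 D (fun x => f x - f x) = 0.
  rewrite (@nrm_ext _ _ _ (@lb2 R) D _ (fun x => 0 * 0)); last by move=> x _; rewrite subrr mulr0.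
  by rewrite (nrmZ mD 0 (sqint0 (@lb2 R) mD)) normr0 mul0r.
by split; (under eq_fun do rewrite e); exact: cvg_cst.
Qed.

Lemma H10B D v w : open D -> bounded_set D -> H10 D v -> H10 D w -> H10 D (v - w).
Proof.
move=> oD bD hv hw; have := H10_lin 1 (-1) oD bD hv hw.
by congr H10; apply/funext => x; rewrite mul1r mulN1r.
Qed.

Lemma wgradB_ae D v w : open D -> H1 D v -> H1 D w ->
  aeD D (fun x => wgrad D (v - w) x = wgrad D v x - wgrad D w x).
Proof.
move=> oD hv hw; apply: (wgradE oD); apply: wgradB; first exact: open_mble.
- by case: hv.
- by case: hw.
- exact: wgradP.
- exact: wgradP.
Qed.

End Sobolev.

(** * Geometry of a cell and cutoff functions *)

Section Element.
Variable R : realType.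
Implicit Types (K : element R) (x z : plane R).

Lemma plane_eq (x y : plane R) : x.1 = y.1 -> x.2 = y.2 -> x = y.
Proof. by case: x y => [? ?] [? ?] /= -> ->. Qed.

Lemma cross_neq0 K : cross (edir1 K) (edir2 K) != 0.
Proof. by case: K. Qed.

Definition cell_det K : R := cross (edir1 K) (edir2 K).

Lemma cell_det_neq0 K : cell_det K != 0. Proof. exact: cross_neq0. Qed.

Lemma turn_tri_subproof K : cross (edir2 K - edir1 K) (- edir1 K) != 0.
Proof.
have -> : cross (edir2 K - edir1 K) (- edir1 K) = cell_det K by rewrite /cell_det /cross /=; ring.
exact: cell_det_neq0.
Qed.

Lemma turn_par_subproof K : cross (edir2 K) (- edir1 K) != 0.
Proof.
have -> : cross (edir2 K) (- edir1 K) = cell_det K by rewrite /cell_det /cross /=; ring.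
exact: cell_det_neq0.
Qed.

(** The same cell described from its next vertex, which reduces statements about
    an arbitrary edge to the first edge. *)
Definition turn K : element R :=
  match eshape K with
  | Triangle => @Element R Triangle (eorg K + edir1 K) _ _ (turn_tri_subproof K)
  | Parallelogram => @Element R Parallelogram (eorg K + edir1 K) _ _ (turn_par_subproof K)
  end.

Definition nb_edges K := if eshape K is Triangle then 3%N else 4%N.

Lemma turn_shape K : eshape (turn K) = eshape K.
Proof. by rewrite /turn; case e : (eshape K). Qed.

Lemma turn_det K : cell_det (turn K) = cell_det K.
Proof. by rewrite /turn /cell_det; case: (eshape K); rewrite /cross /=; ring. Qed.

Lemma iter_turn_det i K : cell_det (iter i turn K) = cell_det K.
Proof. by elim: i => //= i IH; rewrite turn_det. Qed.

Definition first_edge K : edge R := (eorg K, eorg K + edir1 K).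

Lemma param_first_edge K s : param (first_edge K) s = loc K (s, 0).
Proof. by apply: plane_eq; rewrite /param /loc /= /GRing.scale /=; ring. Qed.

Lemma edgesE K : edges K = [seq first_edge (iter i turn K) | i <- iota 0 (nb_edges K)].
Proof.
rewrite /edges /vertices /nb_edges; case e : (eshape K) => /=;
rewrite /turn /first_edge /= !(e, fun_if) /=.
  by congr [:: (_, _); (_, _); (_, _)]; apply: plane_eq; rewrite /loc /= /GRing.scale /=; ring.
by congr [:: (_, _); (_, _); (_, _); (_, _)]; apply: plane_eq; rewrite /loc /= /GRing.scale /=; ring.
Qed.

Definition lamA K : R := - (edir1 K).2 / cell_det K.
Definition lamB K : R := (edir1 K).1 / cell_det K.
(** The affine coordinate transversal to the first edge. Those of the turned
    cells describe the cell as an intersection of half planes. *)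
Definition lam K : plane R -> R := aff (lamA K) (lamB K) (- cross (edir1 K) (eorg K) / cell_det K).

Lemma lam_loc K z : lam K (loc K z) = z.2.
Proof.
rewrite /lam /lamA /lamB /aff /loc /= /GRing.scale /=.
have := cell_det_neq0 K; rewrite /cell_det /cross => h; field.
exact: h.
Qed.

Definition unloc K x : plane R :=
  (cross (x - eorg K) (edir2 K) / cell_det K, cross (edir1 K) (x - eorg K) / cell_det K).

Lemma locK K : cancel (loc K) (unloc K).
Proof.
move=> z; have := cell_det_neq0 K; rewrite /cell_det /cross => h; apply: plane_eq;
rewrite /unloc /loc /cell_det /cross /= /GRing.scale /=; field; exact: h.
Qed.

Lemma unlocK K : cancel (unloc K) (loc K).
Proof.
move=> z; have := cell_det_neq0 K; rewrite /cell_det /cross => h; apply: plane_eq;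
rewrite /unloc /loc /cell_det /cross /= /GRing.scale /=; field; exact: h.
Qed.

Lemma esetE K x : eset K x <-> refcell (eshape K) (unloc K x).
Proof.
split=> [[z hz <-]|h]; first by rewrite locK.
by exists (unloc K x) => //; rewrite unlocK.
Qed.

Lemma eset_loc K z : eset K (loc K z) <-> refcell (eshape K) z.
Proof. by rewrite esetE locK. Qed.

Lemma lam_turn1_tri K z : eshape K = Triangle -> lam (turn K) (loc K z) = 1 - z.1 - z.2.
Proof.
move=> e; rewrite /lam /lamA /lamB turn_det /turn e /= /aff /loc /= /GRing.scale /=.
have := cell_det_neq0 K; rewrite /cell_det /cross /= => h; field; exact: h.
Qed.

Lemma lam_turn2_tri K z : eshape K = Triangle -> lam (turn (turn K)) (loc K z) = z.1.
Proof.
move=> e; rewrite /lam /lamA /lamB !turn_det /turn e /= /aff /loc /= /GRing.scale /=.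
have := cell_det_neq0 K; rewrite /cell_det /cross /= => h; field; exact: h.
Qed.

Lemma lam_turn3_tri K x : eshape K = Triangle -> lam (turn (turn (turn K))) x = lam K x.
Proof.
move=> e; rewrite -(unlocK K x) lam_loc /lam /lamA /lamB !turn_det /turn e /= /aff /loc /= /GRing.scale /=.
have := cell_det_neq0 K; rewrite /cell_det /cross /= => h; field; exact: h.
Qed.

Lemma lam_turn1_par K z : eshape K = Parallelogram -> lam (turn K) (loc K z) = 1 - z.1.
Proof.
move=> e; rewrite /lam /lamA /lamB !turn_det /turn e /= /aff /loc /= /GRing.scale /=.
have := cell_det_neq0 K; rewrite /cell_det /cross /= => h; field; exact: h.
Qed.

Lemma lam_turn2_par K z : eshape K = Parallelogram -> lam (turn (turn K)) (loc K z) = 1 - z.2.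
Proof.
move=> e; rewrite /lam /lamA /lamB !turn_det /turn e /= /aff /loc /= /GRing.scale /=.
have := cell_det_neq0 K; rewrite /cell_det /cross /= => h; field; exact: h.
Qed.

Lemma lam_turn3_par K z : eshape K = Parallelogram -> lam (turn (turn (turn K))) (loc K z) = z.1.
Proof.
move=> e; rewrite /lam /lamA /lamB !turn_det /turn e /= /aff /loc /= /GRing.scale /=.
have := cell_det_neq0 K; rewrite /cell_det /cross /= => h; field; exact: h.
Qed.

Lemma lam_turn4_par K x : eshape K = Parallelogram -> lam (turn (turn (turn (turn K)))) x = lam K x.
Proof.
move=> e; rewrite -(unlocK K x) lam_loc /lam /lamA /lamB !turn_det /turn e /= /aff /loc /= /GRing.scale /=.
have := cell_det_neq0 K; rewrite /cell_det /cross /= => h; field; exact: h.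
Qed.

Lemma eset_lam K x : eset K x <-> forall i, (i < nb_edges K)%N -> 0 < lam (iter i turn K) x.
Proof.
rewrite esetE -{2}(unlocK K x); move: (unloc K x) => z; rewrite /nb_edges; case e : (eshape K) => /=.
  split=> [[h1 h2 h3] [|[|[|]]]//= _|h].
  - by rewrite lam_loc.
  - by rewrite lam_turn1_tri//; lra.
  - by rewrite lam_turn2_tri.
  - have := h 0%N isT; have := h 1%N isT; have := h 2%N isT => /=.
    by rewrite lam_loc lam_turn1_tri// lam_turn2_tri// => *; split; lra.
split=> [[/andP[h1 h2] /andP[h3 h4]] [|[|[|[|]]]]//= _|h].
- by rewrite lam_loc.
- by rewrite lam_turn1_par//; lra.
- by rewrite lam_turn2_par//; lra.
- by rewrite lam_turn3_par.
- have := h 0%N isT; have := h 1%N isT; have := h 2%N isT; have := h 3%N isT => /=.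
  by rewrite lam_loc lam_turn1_par// lam_turn2_par// lam_turn3_par// => *; split; apply/andP; split; lra.
Qed.

Lemma aff_cont a b c : continuous (@aff R a b c).
Proof. by move=> x; apply: differentiable_continuous; exact: aff_diff. Qed.

Lemma lam_cont K : continuous (lam K). Proof. exact: aff_cont. Qed.

Lemma open_aff a b c : open [set x | 0 < @aff R a b c x].
Proof.
have := @open_gt R 0; apply: open_comp => x _; exact: aff_cont.
Qed.

Lemma eset_open K : open (eset K).
Proof.
rewrite openE => x /eset_lam h.
have H : \forall y \near x, forall i : 'I_(nb_edges K), 0 < lam (iter i turn K) y.
  apply: (@filter_forall _ _ (fun (i : 'I_(nb_edges K)) => [set y | 0 < lam (iter i turn K) y]) (nbhs x)) => i.
  apply: open_nbhs_nbhs; split; first exact: open_aff.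
  exact: h.
apply: filterS H => y hy; apply/eset_lam => i hi; exact: (hy (Ordinal hi)).
Qed.

Lemma eset_turn K : eset (turn K) = eset K.
Proof.
apply/seteqP; split => x /eset_lam h; apply/eset_lam => i hi; move: hi; rewrite /nb_edges ?turn_shape;
case e : (eshape K) => hi; move: h; rewrite /nb_edges ?turn_shape e => h.
- case: i hi => [|i] hi; first by have := h 2%N isT; rewrite /= lam_turn3_tri.
  have := h i; rewrite -iterSr; apply.
  exact: ltnW.
- case: i hi => [|i] hi; first by have := h 3%N isT; rewrite /= lam_turn4_par.
  have := h i; rewrite -iterSr; apply.
  exact: ltnW.
- have [i2|i2] := ltnP i 2; first by have := h i.+1; rewrite iterSr; apply.
  have -> : i = 2%N by apply/eqP; rewrite eqn_leq i2 andbT -ltnS.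
  by rewrite /= lam_turn3_tri//; have := h 0%N isT.
- have [i2|i2] := ltnP i 3; first by have := h i.+1; rewrite iterSr; apply.
  have -> : i = 3%N by apply/eqP; rewrite eqn_leq i2 andbT -ltnS.
  by rewrite /= lam_turn4_par//; have := h 0%N isT.
Qed.

Lemma eset_iter_turn i K : eset (iter i turn K) = eset K.
Proof. by elim: i => //= i IH; rewrite eset_turn. Qed.

Lemma eset_bounded K : bounded_set (eset K).
Proof.
exists (`|eorg K| + `|edir1 K| + `|edir2 K|); split; first exact: num_real.
move=> M hM x [z hz <-]; apply: le_trans (ltW hM).
have [z1 z2] : `|z.1| <= 1 /\ `|z.2| <= 1.
  move: hz; case: (eshape K) => /= [[? ? ?]|[/andP[? ?] /andP[? ?]]]; rewrite !ger0_norm; try lra; split; lra.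
rewrite /loc (le_trans (ler_normD _ _))// lerD//.
  rewrite (le_trans (ler_normD _ _))// lerD//.
  by rewrite normrZ ler_piMl.
by rewrite normrZ ler_piMl.
Qed.

Lemma closure_lam K x : closure (eset K) x -> forall i, (i < nb_edges K)%N -> 0 <= lam (iter i turn K) x.
Proof.
move=> cx i hi; rewrite leNgt; apply/negP => h.
have o : open [set y | lam (iter i turn K) y < 0].
  have := @open_lt R 0; apply: open_comp => y _; exact: lam_cont.
have : nbhs x [set y | lam (iter i turn K) y < 0] by exact: open_nbhs_nbhs.
move=> /cx[y [/eset_lam /(_ i hi) y1 /= y2]].
by have := lt_trans y1 y2; rewrite ltxx.
Qed.

Lemma refcell_s sh z : @refcell R sh z -> [/\ 0 < z.1, z.1 < 1 & 0 < z.2].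
Proof. by case: sh => /= [[? ? ?]|[/andP[? ?] /andP[? ?]]]; split; lra. Qed.

Lemma refcell_near sh (s : R) (t : R) : 0 < s < 1 -> 0 < t ->
  \forall n \near \oo, @refcell R sh (s, t / n.+1%:R).
Proof.
move=> /andP[s0 s1] t0; near=> n.
have n0 : 0 < n.+1%:R :> R by [].
have h : t / n.+1%:R < 1 - s.
  rewrite ltr_pdivrMr// mulrC -ltr_pdivrMr ?subr_gt0//.
  have : t / (1 - s) < n%:R by near: n; exact: nbhs_infty_gtr.
  by move/lt_trans; apply; rewrite ltr_nat.
have h0 : 0 < t / n.+1%:R by rewrite divr_gt0.
move: (t / n.+1%:R) h h0 => q h h0.
by case: sh => /=; [split => //; lra|split; apply/andP; split; lra].
Unshelve. all: by end_near. Qed.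

Lemma loc_cont K : continuous (loc K).
Proof. exact: affine_cont. Qed.

Lemma closure_edge K (s : R) : 0 <= s <= 1 -> closure (eset K) (loc K (s, 0)).
Proof.
move=> /andP[s0 s1] B hB.
(* moves from the point of the edge towards the interior point of local
   coordinates [(1/4, 1/4)] *)
pose f (d : R) : plane R := loc K ((1 - d) * s + d / 4, d / 4).
have f0 : f 0 = loc K (s, 0) by rewrite /f subr0 mul1r !mul0r addr0.
have cf : f d @[d --> (0 : R)] --> f 0.
  have c1 : (1 - d) * s + d / 4 @[d --> (0 : R)] --> (1 - 0) * s + 0 / 4.
    by apply: cvgD; apply: cvgM; [apply: cvgB; [exact: cvg_cst|exact: cvg_id]|exact: cvg_cst|exact:
        cvg_id|exact: cvg_cst].
  have c2 : d / 4 @[d --> (0 : R)] --> (0 : R) / 4.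
    by apply: cvgM; [exact: cvg_id|exact: cvg_cst].
  by apply: cvgD; [apply: cvgD; [exact: cvg_cst|apply: cvgZr_tmp]|apply: cvgZr_tmp].
have H1 : \forall d \near 0^'+, B (f d).
  by move: hB; rewrite -f0; apply: (cvg_at_right_filter cf).
near (0 : R)^'+ => d.
have d0 : 0 < d by near: d; exact: nbhs_right_gt.
have d1 : d < 1 by near: d; exact: nbhs_right_lt.
exists (f d); split; last by near: d.
apply/eset_loc; case: (eshape K) => /=; first by split; nra.
by split; apply/andP; split; nra.
Unshelve. all: by end_near. Qed.

Lemma cvg_within_seq (A : set (plane R)) (f : plane R -> R) (u : nat -> plane R) x :
  {within A, continuous f} -> A x -> (\forall n \near \oo, A (u n)) ->
  u n @[n --> \oo] --> x -> f (u n) @[n --> \oo] --> f x.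
Proof.
move=> /subspace_continuousP cf Ax Au ux P /(cf x Ax).
rewrite /within /= => hP.
have : \forall n \near \oo, A (u n) -> P (f (u n)) by exact: (ux _ hP).
by move=> H; apply: filterS2 Au H => n An; exact.
Qed.

Lemma compact_closed_bounded (A : set (plane R)) : closed A -> bounded_set A -> compact A.
Proof.
move=> cA bA; have [N N0 hN] := bounded_coords bA.
apply: (@subclosed_compact _ A (cbox (- N) N (- N) N)) => //.
  by apply: compact_setX; exact: segment_compact.
move=> x /hN[h1 h2]; by split => /=; rewrite in_itv /= -ler_norml.
Qed.

Lemma closure_bounded (A : set (plane R)) : bounded_set A -> bounded_set (closure A).
Proof.
move=> [M [Mr hM]]; exists M; split => // N MN x cx.
have [N' h1 h2] : exists2 N', M < N' & N' < N by exists ((M + N) / 2); lra.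
rewrite /= leNgt; apply/negP => Nx.
have o : open [set y : plane R | N' < `|y|].
  by have := @open_gt R N'; apply: open_comp => y _; exact: norm_continuous.
have : nbhs x [set y : plane R | N' < `|y|].
  by apply: open_nbhs_nbhs; split => //=; exact: lt_trans Nx.
move=> /cx[y [/(hM N' h1) /= y1 y2]].
by have := lt_le_trans y2 y1; rewrite ltxx.
Qed.

Lemma eset_closure_compact K : compact (closure (eset K)).
Proof.
apply: compact_closed_bounded; first exact: closed_closure.
exact/closure_bounded/eset_bounded.
Qed.

Lemma eset_mble K : mble (eset K).
Proof. by apply: open_mble; exact: eset_open. Qed.

Lemma eset_fin K : (@lb2 R (eset K) < +oo)%E.
Proof. by apply: bounded_finite; [exact: eset_mble|exact: eset_bounded]. Qed.

End Element.

Section Divergence.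
Variable R : realType.
Implicit Types (K : element R) (x z : plane R).

Definition cutA K n : R := n.+1%:R * lamA K.
Definition cutB K n : R := n.+1%:R * lamB K.
Definition cutC K n : R := n.+1%:R * (- cross (edir1 K) (eorg K) / cell_det K) - 1.
Definition cutoff_arg K n : plane R -> R := aff (cutA K n) (cutB K n) (cutC K n).
(** A smooth function that removes a layer of width of order [1/n] along the
    first edge. *)
Definition edge_cutoff K n : plane R -> R := @flat1 R \o cutoff_arg K n.

Lemma cutoff_argE K n x : cutoff_arg K n x = n.+1%:R * lam K x - 1.
Proof. by rewrite /cutoff_arg /lam /aff /cutA /cutB /cutC; ring. Qed.

Lemma smooth_edge_cutoff K n : smooth (edge_cutoff K n).
Proof. exact: smooth_flat. Qed.

Lemma edge_cutoff01 K n x : 0 <= edge_cutoff K n x <= 1.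
Proof. by rewrite flat1_ge0 flat1_le1. Qed.

Definition elam K : plane R := (lamA K, lamB K).

Lemma cgrad_edge_cutoff K n x : cgrad (edge_cutoff K n) x = (n.+1%:R * dflat1 (cutoff_arg K n x)) *: elam K.
Proof.
have e : 'X^2 * (1 - (1 : {poly R})^`()) = 'X^2 by rewrite derivC subr0 mulr1.
rewrite /cgrad /edge_cutoff; congr (_, _); rewrite flat_aff_is_derive e /dflat1 /cutA /cutB /GRing.scale /=; ring.
Qed.

Lemma edge_cutoff_turn K n : edge_cutoff (iter (nb_edges K) (@turn R) K) n = edge_cutoff K n.
Proof.
apply/funext => x; rewrite /edge_cutoff /= !cutoff_argE /nb_edges; case e : (eshape K).
  by rewrite lam_turn3_tri.
by rewrite lam_turn4_par.
Qed.

Definition other_cutoffs K n x : R :=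
  edge_cutoff (turn K) n x * edge_cutoff (turn (turn K)) n x *
  (if eshape K is Triangle then 1 else edge_cutoff (turn (turn (turn K))) n x).

Lemma smooth_other_cutoffs K n : smooth (other_cutoffs K n).
Proof.
rewrite /other_cutoffs; have h := smooth_edge_cutoff; case: (eshape K).
  exact: smoothM (smoothM (h _ _) (h _ _)) (smooth_cst _).
exact: smoothM (smoothM (h _ _) (h _ _)) (h _ _).
Qed.

Lemma other_cutoffs01 K n x : 0 <= other_cutoffs K n x <= 1.
Proof.
have M (s t : R) : 0 <= s <= 1 -> 0 <= t <= 1 -> 0 <= s * t <= 1.
  by move=> /andP[s0 s1] /andP[t0 t1]; rewrite mulr_ge0// mulr_ile1.
apply: (M); first by apply: M; exact: edge_cutoff01.
by case: (eshape K); [rewrite ler01 lexx|exact: edge_cutoff01].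
Qed.

Definition cutoff K n : plane R -> R := edge_cutoff K n * other_cutoffs K n.

Lemma smooth_cutoff K n : smooth (cutoff K n).
Proof. exact: smoothM (smooth_edge_cutoff _ _) (smooth_other_cutoffs _ _). Qed.

Lemma cutoff01 K n x : 0 <= cutoff K n x <= 1.
Proof.
have /andP[s0 s1] := edge_cutoff01 K n x; have /andP[t0 t1] := other_cutoffs01 K n x.
by apply/andP; split; [exact: mulr_ge0|exact: mulr_ile1].
Qed.

Lemma cutoff_turn K n : cutoff (turn K) n = cutoff K n.
Proof.
apply/funext => x; rewrite /cutoff /other_cutoffs turn_shape; have := edge_cutoff_turn K n; rewrite /nb_edges.
case e : (eshape K) => /= h; rewrite -[LHS]/(_ * _) -[RHS]/(_ * _) /= h; ring.
Qed.

Lemma cutoff_iter_turn i K n : cutoff (iter i (@turn R) K) n = cutoff K n.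
Proof. by elim: i => //= i IH; rewrite cutoff_turn. Qed.

Lemma edge_cutoff_eq0 K n x : lam K x < n.+1%:R^-1 -> edge_cutoff K n x = 0.
Proof.
move=> h; rewrite /edge_cutoff /= cutoff_argE flat1_npos// subr_le0.
have n0 : 0 < n.+1%:R :> R by [].
by rewrite mulrC -ler_pdivlMr// div1r ltW.
Qed.

Lemma cutoff_out K n x i : (i < nb_edges K)%N -> lam (iter i (@turn R) K) x < n.+1%:R^-1 -> cutoff K n x = 0.
Proof.
by move=> hi h; rewrite -(cutoff_iter_turn i) /cutoff -[LHS]/(_ * _) edge_cutoff_eq0// mul0r.
Qed.

Lemma test_cutoff K n : test_fun (eset K) (cutoff K n).
Proof.
split; first exact: smooth_cutoff.
pose C := [set x | forall i, (i < nb_edges K)%N -> n.+1%:R^-1 <= lam (iter i (@turn R) K) x].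
have n0 : 0 < n.+1%:R^-1 :> R by [].
have CK : C `<=` eset K.
  by move=> x h; apply/eset_lam => i hi; apply: lt_le_trans (h i hi).
exists C; split => //.
  apply: compact_closed_bounded.
    have -> : C = \bigcap_(i in [set k | (k < nb_edges K)%N]) [set x | n.+1%:R^-1 <= lam (iter i (@turn R) K) x].
      by apply/seteqP; split => x h i /h.
    apply: closed_bigI => i _; have := @closed_ge R n.+1%:R^-1; apply: closed_comp => x _.
    exact: lam_cont.
  by have [M [Mr hM]] := @eset_bounded R K; exists M; split => // N /hM h x /CK /h.
move=> x nC; have [i /not_implyP[hi /negP h]] : exists i, ~ ((i < nb_edges K)%N -> n.+1%:R^-1 <= lam (iter i
    (@turn R) K) x).
  by apply: contrapT => H; apply: nC => i hi; apply: contrapT => h; apply: H; exists i => /(_ hi).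
by apply: (@cutoff_out _ _ _ i) => //; rewrite ltNge.
Qed.

Lemma edge_cutoff_cvg K x : 0 < lam K x -> edge_cutoff K n x @[n --> \oo] --> (1 : R).
Proof.
move=> h; have e n : edge_cutoff K n x = flat1 (n%:R * lam K x - (1 - lam K x)).
  by rewrite /edge_cutoff /= cutoff_argE -natr1; congr flat1; ring.
by under eq_fun do rewrite e; exact: flat1_cvg.
Qed.

Lemma cutoff_cvg K x : eset K x -> cutoff K n x @[n --> \oo] --> (1 : R).
Proof.
move=> /eset_lam h; rewrite /cutoff /other_cutoffs.
have c i : (i < nb_edges K)%N -> edge_cutoff (iter i (@turn R) K) n x @[n --> \oo] --> (1 : R).
  by move=> hi; apply: edge_cutoff_cvg; exact: h.
suff : edge_cutoff K n x * (edge_cutoff (turn K) n x * edge_cutoff (turn (turn K)) n x *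
  (if eshape K is Triangle then 1 else edge_cutoff (turn (turn (turn K))) n x)) @[n --> \oo] --> (1 * (1 * 1 * 1) : R).
  by rewrite !mulr1.
move: c; rewrite /nb_edges; case: (eshape K) => c.
  apply: cvgM; first exact: (c 0%N). apply: cvgM; last exact: cvg_cst.
  by apply: cvgM; [exact: (c 1%N)|exact: (c 2%N)].
apply: cvgM; first exact: (c 0%N). apply: cvgM; last exact: (c 3%N).
by apply: cvgM; [exact: (c 1%N)|exact: (c 2%N)].
Qed.

Lemma sum_turn3 (F : element R -> plane R) K :
  \sum_(i <- iota 0 3) F (iter i (@turn R) K) = F K + F (turn K) + F (turn (turn K)).
Proof. by rewrite !big_cons big_nil /= addr0 addrA. Qed.

Lemma sum_turn4 (F : element R -> plane R) K :
  \sum_(i <- iota 0 4) F (iter i (@turn R) K) =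
  F K + F (turn K) + F (turn (turn K)) + F (turn (turn (turn K))).
Proof. by rewrite !big_cons big_nil /= addr0 !addrA. Qed.

Lemma cgradM3 (f0 f1 f2 : plane R -> R) x : smooth f0 -> smooth f1 -> smooth f2 ->
  cgrad (f0 * (f1 * f2)) x = (f1 x * f2 x) *: cgrad f0 x + (f2 x * f0 x) *: cgrad f1 x +
    (f0 x * f1 x) *: cgrad f2 x.
Proof.
move=> h0 h1 h2; rewrite (cgradM _ h0 (smoothM h1 h2)) (cgradM _ h1 h2).
rewrite -[(f1 * f2) x]/(f1 x * f2 x).
move: (cgrad f0 x) (cgrad f1 x) (cgrad f2 x) (f0 x) (f1 x) (f2 x) => g0 g1 g2 a0 a1 a2.
by apply: plane_eq; rewrite /= /GRing.scale /=; ring.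
Qed.

Lemma cgradM4 (f0 f1 f2 f3 : plane R -> R) x : smooth f0 -> smooth f1 -> smooth f2 -> smooth f3 ->
  cgrad (f0 * (f1 * f2 * f3)) x = (f1 x * f2 x * f3 x) *: cgrad f0 x +
    (f2 x * f3 x * f0 x) *: cgrad f1 x + (f3 x * f0 x * f1 x) *: cgrad f2 x +
    (f0 x * f1 x * f2 x) *: cgrad f3 x.
Proof.
move=> h0 h1 h2 h3; rewrite (cgradM3 _ h0 (smoothM h1 h2) h3) (cgradM _ h1 h2).
rewrite -[(f1 * f2) x]/(f1 x * f2 x).
move: (cgrad f0 x) (cgrad f1 x) (cgrad f2 x) (cgrad f3 x) (f0 x) (f1 x) (f2 x) (f3 x) => g0 g1 g2 g3 a0 a1 a2 a3.
by apply: plane_eq; rewrite /= /GRing.scale /=; ring.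
Qed.

(** The product rule; the term of index [i] is concentrated near the [i]-th edge. *)
Lemma cgrad_cutoff K n x : cgrad (cutoff K n) x =
  \sum_(i <- iota 0 (nb_edges K)) (other_cutoffs (iter i (@turn R) K) n x) *: cgrad (edge_cutoff (iter i
      (@turn R) K) n) x.
Proof.
have h := smooth_edge_cutoff; rewrite /cutoff /nb_edges.
have := edge_cutoff_turn (turn (turn K)) n; have := edge_cutoff_turn (turn K) n; have := edge_cutoff_turn K n.
rewrite /nb_edges !turn_shape; case e : (eshape K) => /= cr cr1 cr2.
  rewrite (sum_turn3 (fun K' => other_cutoffs K' n x *: cgrad (edge_cutoff K' n) x)).
  have oE K' : eshape K' = Triangle -> other_cutoffs K' n = edge_cutoff (turn K') n * edge_cutoff (turn (turn K')) n.
    by move=> e'; apply/funext => y; rewrite /other_cutoffs e' mulr1.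
  have oEx K' : eshape K' = Triangle -> other_cutoffs K' n x = edge_cutoff (turn K') n x * edge_cutoff (turn
      (turn K')) n x.
    by move=> e'; rewrite /other_cutoffs e' mulr1.
  have e1 : eshape (turn K) = Triangle by rewrite turn_shape.
  have e2 : eshape (turn (turn K)) = Triangle by rewrite turn_shape.
  rewrite (oEx K e) (oEx _ e1) (oEx _ e2) (oE K e) cr ?cr1 ?cr2.
  by rewrite (cgradM3 x (h K n) (h (turn K) n) (h (turn (turn K)) n)).
rewrite (sum_turn4 (fun K' => other_cutoffs K' n x *: cgrad (edge_cutoff K' n) x)).
have oE K' : eshape K' = Parallelogram -> other_cutoffs K' n = edge_cutoff (turn K') n * edge_cutoff (turn
    (turn K')) n * edge_cutoff (turn (turn (turn K'))) n.
  by move=> e'; apply/funext => y; rewrite /other_cutoffs e'.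
have oEx K' : eshape K' = Parallelogram -> other_cutoffs K' n x = edge_cutoff (turn K') n x * edge_cutoff (turn
    (turn K')) n x * edge_cutoff (turn (turn (turn K'))) n x.
  by move=> e'; rewrite /other_cutoffs e'.
have e1 : eshape (turn K) = Parallelogram by rewrite turn_shape.
have e2 : eshape (turn (turn K)) = Parallelogram by rewrite turn_shape.
have e3 : eshape (turn (turn (turn K))) = Parallelogram by rewrite turn_shape.
rewrite (oEx K e) (oEx _ e1) (oEx _ e2) (oEx _ e3) (oE K e) cr ?cr1 ?cr2.
by rewrite (cgradM4 x (h K n) (h (turn K) n) (h (turn (turn K)) n) (h (turn (turn (turn K))) n)).
Qed.

(** Near an interior point of the first edge the coordinates of the other edges
    are bounded away from [0]. *)
Lemma other_cutoffs_cvg K (s t : R) : 0 < s < 1 ->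
  other_cutoffs K n (loc K (s, t / n.+1%:R)) @[n --> \oo] --> (1 : R).
Proof.
move=> /andP[s0 s1].
have c K' (al be : R) : 0 < al -> (forall n, lam K' (loc K (s, t / n.+1%:R)) = al + be * (t / n.+1%:R)) ->
  edge_cutoff K' n (loc K (s, t / n.+1%:R)) @[n --> \oo] --> (1 : R).
  move=> a0 e; have {}e n : edge_cutoff K' n (loc K (s, t / n.+1%:R)) = flat1 (n%:R * al - (1 - al - be * t)).
    rewrite /edge_cutoff /= cutoff_argE e; congr flat1.
    by rewrite -natr1; field; rewrite natr1.
  by under eq_fun do rewrite e; exact: flat1_cvg.
suff : (edge_cutoff (turn K) n (loc K (s, t / n.+1%:R)) * edge_cutoff (turn (turn K)) n (loc K (s, t / n.+1%:R)) *
  (if eshape K is Triangle then 1 else edge_cutoff (turn (turn (turn K))) n (loc K (s,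
      t / n.+1%:R)))) @[n --> \oo] --> (1 * 1 * 1 : R).
  by rewrite !mulr1.
case e : (eshape K).
  apply: cvgM; last exact: cvg_cst.
  apply: cvgM.
    by apply: (c _ (1 - s) (-1)) => [|n]; [lra|rewrite lam_turn1_tri//=; ring].
  by apply: (c _ s 0) => [|n]; [lra|rewrite lam_turn2_tri//=; ring].
apply: cvgM; last first.
  by apply: (c _ s 0) => [|n]; [lra|rewrite lam_turn3_par//=; ring].
apply: cvgM.
  by apply: (c _ (1 - s) 0) => [|n]; [lra|rewrite lam_turn1_par//=; ring].
by apply: (c _ 1 (-1)) => [|n]; [lra|rewrite lam_turn2_par//=; ring].
Qed.

End Divergence.

(** * The divergence theorem on a cell *)

Section Gauss.
Variable R : realType.
Implicit Types (K : element R) (x z : plane R).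

(** The density of the layer along an edge in the stretched coordinate
    [(n+1) lam]. *)
Definition layer (t : R) : R := dflat1 (t - 1).

Lemma layer_ge0 t : 0 <= layer t. Proof. exact: dflat1_ge0. Qed.

Lemma layer_cont : continuous layer.
Proof.
move=> t; apply: (@continuous_comp _ _ _ (fun t : R => t - 1) (@dflat1 R)); last exact: flat_cont.
by apply: cvgB; [exact: cvg_id|exact: cvg_cst].
Qed.

Lemma layer_meas : measurable_fun setT layer.
Proof. by apply: continuous_measurable_fun; exact: layer_cont. Qed.

Lemma layer_integral : (\int[@lb1 R]_t (layer t)%:E = 1)%E.
Proof.
have m : measurable_fun setT (EFin \o @dflat1 R).
  by apply/measurable_EFinP; apply: continuous_measurable_fun; exact: flat_cont.
have d0 (x : R) : (0 <= (EFin \o @dflat1 R) x)%E by rewrite lee_fin dflat1_ge0.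
have h := @integral_affine1 R 1 (-1) (EFin \o @dflat1 R) (oner_neq0 _) m d0.
rewrite normr1 mul1e in h.
have -> : (\int[@lb1 R]_t (layer t)%:E = \int[@lb1 R]_t (EFin \o @dflat1 R) (1 * t + -1)%R)%E.
  by apply: eq_integral => t _; rewrite /layer /= mul1r.
rewrite -h -[RHS](dflat1_integral R) [RHS]integral_mkcond; apply: eq_integral => t _.
rewrite /patch; case: ifPn => //; rewrite notin_setE /= in_itv /= andbT => /negP.
by rewrite -ltNge => t0; rewrite dflat1_npos// ltW.
Qed.

Lemma intg_prod (p q : R -> R) : measurable_fun setT p -> measurable_fun setT q ->
  (forall t, 0 <= p t) -> (forall t, 0 <= q t) ->
  intg (@lb1 R) setT p -> intg (@lb1 R) setT q ->
  intg (@lb2 R) setT (fun z => p z.1 * q z.2).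
Proof.
move=> mp mq p0 q0 ip iq.
have m1 : measurable_fun (setT : set (plane R)) (fun z : plane R => p z.1) by apply: measurableT_comp mp _;
    exact: measurable_fst.
have m2 : measurable_fun (setT : set (plane R)) (fun z : plane R => q z.2) by apply: measurableT_comp mq _;
    exact: measurable_snd.
have m12 : measurable_fun (setT : set (plane R)) (fun z : plane R => p z.1 * q z.2) by exact: measurable_funM.
apply/integrableP; split; first exact/measurable_EFinP.
pose f (z : plane R) : \bar R := (p z.1 * q z.2)%:E.
have mf : measurable_fun setT f by exact/measurable_EFinP.
have f0 z : (0 <= f z)%E by rewrite lee_fin mulr_ge0.
have -> : (\int[@lb2 R]_z `|(EFin \o (fun z : plane R => (p z.1 * q z.2)%R)) z| = \int[@lb2 R]_z f z)%E.
  by apply: eq_integral => z _; rewrite /= ger0_norm// mulr_ge0.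
rewrite (fubini_tonelli1 (m1 := @lb1 R) (m2 := @lb1 R) f mf f0) /fubini_F.
have -> : (\int[@lb1 R]_x \int[@lb1 R]_y f (x, y) = \int[@lb1 R]_x ((p x)%:E * \int[@lb1 R]_y (q y)%:E))%E.
  apply: eq_integral => x _; rewrite -ge0_integralZl//.
    exact/measurable_EFinP.
    by move=> y _; rewrite lee_fin.
  by rewrite lee_fin.
have fq : (\int[@lb1 R]_y (q y)%:E)%E \is a fin_num by exact: integrable_fin_num iq.
have -> : (\int[@lb1 R]_x ((p x)%:E * \int[@lb1 R]_y (q y)%:E) = \int[@lb1 R]_x ((p x)%:E * (fine
    (\int[@lb1 R]_y (q y)%:E))%:E))%E.
  by apply: eq_integral => x _; rewrite fineK.
rewrite ge0_integralZr//; last 3 first.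
- exact/measurable_EFinP.
- by move=> x _; rewrite lee_fin.
- by rewrite lee_fin fine_ge0// integral_ge0// => y _; rewrite lee_fin.
have fp : (\int[@lb1 R]_y (p y)%:E)%E \is a fin_num by exact: integrable_fin_num ip.
by rewrite -(fineK fp) -EFinM ltry.
Qed.

Lemma Rint_prod (p q : R -> R) : intg (@lb2 R) setT (fun z => p z.1 * q z.2) ->
  intg (@lb1 R) setT q -> \int[@lb1 R]_t q t = 1 ->
  \int[@lb2 R]_z (p z.1 * q z.2) = \int[@lb1 R]_s p s.
Proof.
move=> ipq iq q_1; rewrite /Rintegral -(integral12_prod_meas1 (m1 := @lb1 R) (m2 := @lb1 R) ipq).
congr fine; apply: eq_integral => s _; rewrite /fubini_F /=.
transitivity (\int[lb1 R]_y ((p s)%:E * (q y)%:E))%E; first by apply: eq_integral => y _; rewrite EFinM.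
rewrite integralZl//; rewrite -[X in (_ * X)%E](Rint_fin (mu := @lb1 R) measurableT iq) q_1.
by rewrite mule1.
Qed.

(** Coordinates of the cell in which the layer along the first edge has a width
    independent of [n]. *)
Definition stretch K n : plane R -> plane R :=
  fun z => eorg K + z.1 *: edir1 K + z.2 *: (n.+1%:R^-1 *: edir2 K).

Lemma stretchE K n z : stretch K n z = loc K (z.1, z.2 / n.+1%:R).
Proof. by rewrite /stretch /loc scalerA. Qed.

Lemma cont_bound K (G : plane R -> R) : {within closure (eset K), continuous G} ->
  exists2 M, 0 <= M & forall x, closure (eset K) x -> `|G x| <= M.
Proof. by move=> cG; apply: compact_abs_bound => //; exact: eset_closure_compact. Qed.

Lemma cont_meas_eset K (G : plane R -> R) : {within closure (eset K), continuous G} ->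
  measurable_fun (eset K) G.
Proof.
move=> cG; have mc : measurable (closure (eset K)) by apply: closed_measurable2; exact: closed_closure.
by apply: (measurable_funS mc (@subset_closure _ _)); exact: cont_measurable2.
Qed.

Lemma int_cont_smooth K (G phi : plane R -> R) : {within closure (eset K), continuous G} ->
  smooth phi -> intg (@lb2 R) (eset K) (fun x => G x * phi x).
Proof.
move=> cG sp; have [M M0 hM] := cont_bound cG.
have [N N0 hN] := bounded_smooth (@eset_bounded R K) (smooth_cont sp).
apply: (int_bd (eset_mble K) (eset_fin K) (M := M * N)).
  by apply: measurable_funM; [exact: cont_meas_eset|exact: smooth_meas].
by move=> x Kx; rewrite normrM ler_pM// ?hN// hM//; exact: subset_closure.
Qed.

Lemma smooth_dflat a b c : smooth (fun x : plane R => dflat1 (aff a b c x)).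
Proof. exact: smooth_flat. Qed.

Lemma edge_cont K (G : plane R -> R) : {within closure (eset K), continuous G} ->
  {within `[0, 1]%classic, continuous (fun s : R => G (loc K (s, 0)))}.
Proof.
move=> /subspace_continuousP cG; apply/subspace_continuousP => s hs.
have cs : 0 <= s <= 1 by move: hs; rewrite /= in_itv.
move=> P /(cG _ (@closure_edge R K s cs)); rewrite /within /= => hP.
have c : loc K (t, 0) @[t --> s] --> loc K (s, 0).
  have -> : (fun t : R => loc K (t, 0)) = loc K \o (fun t => (t, 0)) by [].
  apply: (@continuous_comp _ _ _ (fun t : R => (t, 0 : R)) (loc K)); last exact: loc_cont.
  move=> B [[/= U V] [hU hV] UV]; apply: filterS hU => t ht; apply: UV; split=> //=.
  exact: nbhs_singleton hV.
suff : nbhs s (fun t : R => `[0, 1]%classic t -> P (G (loc K (t, 0)))) by [].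
have hN : nbhs s (fun t : R => closure (eset K) (loc K (t, 0)) -> P (G (loc K (t, 0)))) := c _ hP.
apply: filterS hN => t ht t01; apply: ht; apply: closure_edge.
by move: t01; rewrite /= in_itv.
Qed.

Lemma edge_int K (G : plane R -> R) : {within closure (eset K), continuous G} ->
  intg (@lb1 R) `[0, 1] (fun s : R => G (loc K (s, 0))).
Proof.
by move=> cG; apply: continuous_compact_integrable; [exact: segment_compact|exact: edge_cont].
Qed.

(** The weight of [G] is the scalar factor of the gradient of the cutoff of the
    first edge, times the other cutoffs. In the coordinates [stretch] it becomes
    the density [layer], of integral [1], and dominated convergence moves [G] to
    the edge. *)
Lemma edge_limit K (G : plane R -> R) : {within closure (eset K), continuous G} ->
  \int[@lb2 R]_(x in eset K) (G x * (n.+1%:R * dflat1 (cutoff_arg K n x) * other_cutoffs K n x)) @[n --> \oo] -->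
  `|cell_det K| * \int[@lb1 R]_(s in `[0, 1]) G (loc K (s, 0)).
Proof.
move=> cG; have [M M0 hM] := cont_bound cG.
pose w n x := n.+1%:R * dflat1 (cutoff_arg K n x) * other_cutoffs K n x.
have sw n : smooth (w n).
  exact: smoothM (smoothZ _ (smooth_dflat _ _ _)) (smooth_other_cutoffs _ _).
have iw n : intg (@lb2 R) (eset K) (fun x => G x * w n x) by exact: int_cont_smooth.
have n0 n : 0 < n.+1%:R :> R by [].
have crn n : cross (edir1 K) (n.+1%:R^-1 *: edir2 K) = n.+1%:R^-1 * cell_det K.
  by rewrite /cell_det /cross /= /GRing.scale /=; ring.
have crn0 n : cross (edir1 K) (n.+1%:R^-1 *: edir2 K) != 0.
  by rewrite crn mulf_neq0 ?cell_det_neq0// invr_neq0// gt_eqF.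
have A n := Rint_affine (eorg K) (crn0 n) (eset_mble K) (iw n).
pose E n := stretch K n @^-1` eset K.
pose h n z := if z \in E n then G (stretch K n z) * (layer z.2 * other_cutoffs K n (stretch K n z)) else 0.
have wE n z : w n (stretch K n z) = n.+1%:R * (layer z.2 * other_cutoffs K n (stretch K n z)).
  rewrite /w -mulrA; congr (_ * (dflat1 _ * _)).
  by rewrite cutoff_argE stretchE lam_loc /= mulrCA divff ?mulr1// gt_eqF.
have mE n : mble (E n).
  by rewrite /mble -[E n]setTI; apply: (@affine_meas R (eorg K) (edir1 K) (n.+1%:R^-1 *: edir2 K)) => //;
      exact: eset_mble.
have hE n : h n = (fun z => n.+1%:R^-1 * (((fun z => G (stretch K n z) * w n (stretch K n z)) \_ (E n)) z)).
  apply/funext => z; rewrite /h /patch; case: ifP => _; last by rewrite mulr0.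
  by rewrite wE; field; rewrite gt_eqF.
have e1 n : \int[@lb2 R]_(x in eset K) (G x * w n x) = `|cell_det K| * \int[@lb2 R]_z h n z.
  have [i1 ->] := A n.
  rewrite hE RintegralZl//; last by have := (integrable_mkcond (mu := @lb2 R) _ (mE n)).1 i1; rewrite restrict_EFin.
  rewrite crn normrM gtr0_norm ?invr_gt0// mulrCA -mulrA; congr (_ * (_ * _)).
  by rewrite Rintegral_mkcond.
under eq_fun do rewrite e1.
apply: cvgM; first exact: cvg_cst.
pose p (s : R) : R := (\1_(`]0, 1[ : set R) s) * G (loc K (s, 0)).
pose p' (s : R) : R := M * \1_(`[0, 1] : set R) s.
have mq2 : measurable_fun setT layer := layer_meas.
have iq : intg (@lb1 R) setT layer.
  apply/integrableP; split; first exact/measurable_EFinP.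
  rewrite (_ : \int[_]_x _ = 1)%E ?ltry// -layer_integral; apply: eq_integral => t _ /=.
  by rewrite ger0_norm// layer_ge0.
have ip' : intg (@lb1 R) setT p'.
  by apply: (intZ (measurableT : @measurable _ (measurableTypeR R) setT));
      have := @integrable_indic_itv R 0 1 true false.
have p'0 s : 0 <= p' s by rewrite mulr_ge0.
have ig : intg (@lb2 R) setT (fun z => p' z.1 * layer z.2).
  apply: intg_prod => //; last exact: layer_ge0.
  by apply: measurable_funM => //; exact: measurable_indic.
(* the local abscissa of a point of the cell lies in the unit interval, whence
   an integrable majorant which does not depend on [n] *)
have hb n z : `|h n z| <= p' z.1 * layer z.2.
  rewrite /h; case: ifPn => [|_]; last by rewrite normr0 mulr_ge0// layer_ge0.
  rewrite inE /E /= => Ez; have Gz : `|G (stretch K n z)| <= M by apply: hM; exact: subset_closure.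
  move: (Ez); rewrite stretchE eset_loc => /refcell_s[/= s0 s1 _].
  rewrite /p' indicE mem_set ?mulr1; last by rewrite /= in_itv /= !ltW.
  have /andP[c0 c1] := other_cutoffs01 K n (stretch K n z); have q0 := layer_ge0 z.2.
  rewrite -stretchE 2!normrM [`|layer _|]ger0_norm// [`|other_cutoffs K n _|]ger0_norm//.
  by apply: ler_pM; rewrite ?normr_ge0 ?(mulr_ge0 q0 c0) ?ler_piMr.
have hc z : h n z @[n --> \oo] --> p z.1 * layer z.2.
  have [s01|ns01] := boolP (0 < z.1 < 1); last first.
    rewrite /p indicE memNset ?mul0r; last by rewrite /= in_itv /=; exact/negP.
    apply: cvg_near_cst; apply: nearW => n; rewrite /h ifF//; apply/negbTE; rewrite notin_setE /E /= stretchE eset_loc.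
    by move=> /refcell_s[/= s0 s1 _]; move: ns01; rewrite s0 s1.
  have [t0|t0] := lerP z.2 0.
    have qz : layer z.2 = 0 by rewrite /layer dflat1_npos//; lra.
    rewrite qz mulr0; apply: cvg_near_cst; apply: nearW => n.
    by rewrite /h qz !(mul0r, mulr0); case: ifP.
  rewrite /p indicE mem_set ?mul1r; last by rewrite /= in_itv.
  have near1 : \forall n \near \oo, eset K (stretch K n z).
    by have := refcell_near (eshape K) s01 t0; apply: filterS => n hn; rewrite stretchE eset_loc.
  have cphi : stretch K n z @[n --> \oo] --> loc K (z.1, 0).
    have -> : loc K (z.1, 0) = eorg K + z.1 *: edir1 K + z.2 *: (0 *: edir2 K).
      by rewrite /loc !scale0r scaler0.
    apply: cvgD; first exact: cvg_cst.
    apply: cvgZl_tmp; apply: cvgZr_tmp; exact: cvg_harmonic.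
  have c1 : G (stretch K n z) @[n --> \oo] --> G (loc K (z.1, 0)).
    apply: (cvg_within_seq cG) cphi.
      by apply: closure_edge; case/andP: s01 => ? ?; rewrite !ltW.
    by apply: filterS near1 => n; exact: subset_closure.
  have c2 : other_cutoffs K n (stretch K n z) @[n --> \oo] --> (1 : R).
    by under eq_fun do rewrite stretchE; exact: other_cutoffs_cvg.
  rewrite -[layer z.2]mulr1; apply: cvg_trans (cvgM c1 (cvgM (cvg_cst (layer z.2)) c2)).
  apply: near_eq_cvg; apply: filterS near1 => n hn; rewrite /h ifT//.
  by rewrite inE.
have mh n : measurable_fun setT (h n).
  rewrite hE; apply: measurable_funM => //; have [i1 _] := A n.
  by have := (integrable_mkcond (mu := @lb2 R) _ (mE n)).1 i1; rewrite restrict_EFin =>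
      /measurable_int/measurable_EFinP.
have C : \int[@lb2 R]_z h n z @[n --> \oo] --> \int[@lb2 R]_z (p z.1 * layer z.2).
  by apply: (Rint_dct (measurableT : mble setT) mh _ ig) => [z _|n z _]; [exact: hc|exact: hb].
have mpq : measurable_fun setT (fun z : plane R => p z.1 * layer z.2).
  apply: (measurable_fun_cvg mh) => z _; exact: hc.
have ipq : intg (@lb2 R) setT (fun z => p z.1 * layer z.2).
  apply: (int_dom (measurableT : mble setT) mpq _ ig) => z _.
  rewrite normrM [`|layer _|]ger0_norm ?layer_ge0// ler_wpM2r ?layer_ge0//.
  rewrite /p /p' !indicE; have [s01|ns01] := boolP (0 < z.1 < 1).
    rewrite !mem_set /= ?in_itv//=; last by case/andP: s01 => ? ?; rewrite !ltW.
    rewrite mul1r mulr1; apply: hM; apply: closure_edge.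
    by case/andP: s01 => ? ?; rewrite !ltW.
  rewrite memNset; last by rewrite /= in_itv /=; exact/negP.
  by rewrite mul0r normr0 mulr_ge0.
have q11 : \int[@lb1 R]_t layer t = 1 by rewrite /Rintegral layer_integral.
rewrite (Rint_prod ipq iq q11) in C.
suff -> : \int[@lb1 R]_(s in `[0, 1]) G (loc K (s, 0)) = \int[@lb1 R]_s p s by [].
pose g s := G (loc K (s, 0)).
have ig1 : intg (@lb1 R) `[0, 1] g by apply: edge_int.
have -> : \int[@lb1 R]_s p s = \int[@lb1 R]_(s in `]0, 1[) g s.
  rewrite [RHS]Rintegral_mkcond; congr Rintegral; apply/funext => s.
  by rewrite /p /patch indicE /g; case: (_ \in _); rewrite ?mul1r ?mul0r.
have i2 : intg (@lb1 R) `]0, 1] g.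
  by apply: integrableS ig1 => //; [exact: subset_itv_oc_cc].
have i3 : intg (@lb1 R) `]0, 1[ g.
  by apply: integrableS ig1 => //; [exact: subset_itv_oo_cc].
rewrite (@Rintegral_itv_bndo_bndc R (BRight 0) 1 g i3).
by rewrite (@Rintegral_itv_obnd_cbnd R 0 (BRight 1) g i2).
Qed.

Lemma cvg_sum_seq I (s : seq I) (a : I -> nat -> R) (l : I -> R) :
  (forall i, a i n @[n --> \oo] --> l i) ->
  \sum_(i <- s) a i n @[n --> \oo] --> \sum_(i <- s) l i.
Proof.
move=> h; elim: s => [|i s IH].
  by under eq_fun do rewrite big_nil; rewrite big_nil; exact: cvg_cst.
by under eq_fun do rewrite big_cons; rewrite big_cons; exact: cvgD.
Qed.

Lemma enorm_edir K : 0 < enorm (edir1 K).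
Proof.
rewrite /enorm sqrtr_gt0 lt_def /dot -!expr2 addr_ge0 ?sqr_ge0// andbT.
apply: contra_neq (cell_det_neq0 K) => /eqP; rewrite paddr_eq0 ?sqr_ge0// !sqrf_eq0 => /andP[/eqP h1 /eqP h2].
by rewrite /cell_det /cross h1 h2 !mul0r subrr.
Qed.

Lemma elam_normal K v : `|cell_det K| * dot v (elam K) =
  - (enorm (edir1 K) * dot v (onormal K (first_edge K))).
Proof.
have e : (first_edge K).2 - (first_edge K).1 = edir1 K by rewrite /first_edge /= addrC addKr.
rewrite /onormal e -/(cell_det K); have n0 := enorm_edir K; have d0 := cell_det_neq0 K.
have -> : `|cell_det K| = Num.sg (cell_det K) * cell_det K by rewrite -normrEsg.
rewrite /dot /elam /lamA /lamB /= /GRing.scale /=; field.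
by rewrite d0 gt_eqF.
Qed.

(** Test the divergence with [cutoff K n]: the volume term converges to the
    integral of [D], and the gradient of the cutoff is a sum over the edges to
    which [edge_limit] applies. Continuity of the field up to the boundary is
    enough, and this is all that the flux of a polynomial satisfies when the
    coefficient is merely continuous. *)
Lemma divergence_theorem K (F : plane R -> plane R) (D : plane R -> R) :
  {within closure (eset K), continuous (fun x => (F x).1)} ->
  {within closure (eset K), continuous (fun x => (F x).2)} ->
  intg (@lb2 R) (eset K) D ->
  (forall psi, test_fun (eset K) psi ->
     \int[@lb2 R]_(x in eset K) dot (F x) (cgrad psi x) =
     - \int[@lb2 R]_(x in eset K) (D x * psi x)) ->
  \int[@lb2 R]_(x in eset K) D x =
  \sum_(e <- edges K) enorm (e.2 - e.1) *
    \int[@lb1 R]_(s in `[0, 1]) dot (F (param e s)) (onormal K e).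
Proof.
move=> c1 c2 iD hdiv; have mK := @eset_mble R K.
pose G i x := dot (F x) (elam (iter i (@turn R) K)).
have cG i : {within closure (eset (iter i (@turn R) K)), continuous (G i)}.
  rewrite eset_iter_turn => x; apply: cvgD; apply: cvgM; [exact: c1|exact: cvg_cst|exact: c2|exact: cvg_cst].
pose w i n x := n.+1%:R * dflat1 (cutoff_arg (iter i (@turn R) K) n x) * other_cutoffs (iter i (@turn R) K) n x.
have sw i n : smooth (w i n).
  exact: smoothM (smoothZ _ (smooth_dflat _ _ _)) (smooth_other_cutoffs _ _).
have A n : \int[@lb2 R]_(x in eset K) dot (F x) (cgrad (cutoff K n) x) =
  \sum_(i <- iota 0 (nb_edges K)) \int[@lb2 R]_(x in eset (iter i (@turn R) K)) (G i x * w i n x).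
  under [RHS]eq_bigr do rewrite eset_iter_turn.
  rewrite -(Rint_sum mK); last first.
    move=> i; have := int_cont_smooth (cG i) (sw i n); by rewrite eset_iter_turn.
  apply: Rint_ext => x _; rewrite cgrad_cutoff.
  under eq_bigr do rewrite cgrad_edge_cutoff scalerA.
  elim: (iota _ _) => [|i s IH]; first by rewrite !big_nil /dot /= !mulr0 addr0.
  rewrite !big_cons -IH /G /w /dot /= /GRing.scale /=; ring.
have L : \sum_(i <- iota 0 (nb_edges K)) \int[@lb2 R]_(x in eset (iter i (@turn R) K))
    (G i x * w i n x) @[n --> \oo] -->
  \sum_(i <- iota 0 (nb_edges K)) (`|cell_det K| * \int[@lb1 R]_(s in `[0, 1]) G i (loc (iter i (@turn R) K) (s, 0))).
  by apply: cvg_sum_seq => i; have := edge_limit (cG i); rewrite iter_turn_det.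
have B : \int[@lb2 R]_(x in eset K) (D x * cutoff K n x) @[n --> \oo] --> \int[@lb2 R]_(x in eset K) D x.
  apply: (Rint_dct mK _ _ (int_abs iD)).
  - by move=> n; apply: measurable_funM; [exact: int_meas iD|exact: smooth_meas (smooth_cutoff _ _)].
  - by move=> x Kx; rewrite -[X in _ --> X]mulr1; apply: cvgM; [exact: cvg_cst|exact: cutoff_cvg].
  - move=> n x _; rewrite normrM ler_piMr//; have /andP[b0 b1] := cutoff01 K n x.
    by rewrite ger0_norm.
have E n : \int[@lb2 R]_(x in eset K) (D x * cutoff K n x) =
  - \sum_(i <- iota 0 (nb_edges K)) \int[@lb2 R]_(x in eset (iter i (@turn R) K)) (G i x * w i n x).
  by rewrite -A (hdiv _ (test_cutoff K n)) opprK.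
have B' : - (\int[@lb2 R]_(x in eset K) (D x * cutoff K n x)) @[n --> \oo] --> - \int[@lb2 R]_(x in eset K) D x.
  exact: cvgN.
have {}B' : \sum_(i <- iota 0 (nb_edges K)) \int[@lb2 R]_(x in eset (iter i (@turn R) K))
    (G i x * w i n x) @[n --> \oo] -->
  - \int[@lb2 R]_(x in eset K) D x.
  by apply: cvg_trans B'; apply: near_eq_cvg; apply: nearW => n; rewrite E opprK.
have := cvg_lim _ B'; rewrite (cvg_lim _ L)// => /(_ _) H.
apply: oppr_inj; rewrite -H// edgesE big_map -sumrN; apply: eq_bigr => i _.
set K' := iter i (@turn R) K; rewrite (_ : (first_edge K').2 - (first_edge K').1 = edir1 K'); last
    by rewrite /first_edge /= addrC addKr.
have -> : onormal K (first_edge K') = onormal K' (first_edge K') by rewrite /onormal -!/(cell_det _) iter_turn_det.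
have cF : {within closure (eset K'), continuous (fun x => dot (F x) (onormal K' (first_edge K')))}.
  rewrite eset_iter_turn => x; apply: cvgD; apply: cvgM; [exact: c1|exact: cvg_cst|exact: c2|exact: cvg_cst].
have iF : intg (@lb1 R) `[0, 1] (fun s => dot (F (loc K' (s, 0))) (onormal K' (first_edge K'))) by exact: (edge_int cF).
have iG : intg (@lb1 R) `[0, 1] (fun s => G i (loc K' (s, 0))) by exact: (edge_int (cG i)).
rewrite -(iter_turn_det i K) -/K' -mulrN -(RintegralZl _ _ iG)//.
have -> : (fun s => dot (F (param (first_edge K') s)) (onormal K' (first_edge K'))) = (fun s => dot (F (loc K'
    (s, 0))) (onormal K' (first_edge K'))).
  by apply/funext => s; rewrite param_first_edge.
rewrite mulrN -mulNr -RintegralZl//; apply: Rint_ext => s _.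
by rewrite /G elam_normal mulNr.
Qed.

End Gauss.

(** * Almost everywhere limits and the trace inequality *)

Section FastCauchy.
Context d (T : measurableType d) (R : realType).
Variables (mu : {measure set T -> \bar R}) (D : set T).
Hypotheses (mD : measurable D) (fD : (mu D < +oo)%E).

Lemma half_sum n : \sum_(i < n) (2^-1 : R) ^+ i <= 2.
Proof.
suff -> : \sum_(i < n) (2^-1 : R) ^+ i = 2 - 2 * 2^-1 ^+ n.
  by rewrite gerBl mulr_ge0// exprn_ge0.
elim: n => [|n IH]; first by rewrite big_ord0 expr0; lra.
by rewrite big_ord_recr /= IH exprS; lra.
Qed.

(** A representative of the limit that is defined pointwise: it is zero wherever
    all the terms are. *)
Definition limsup_repr (psi : nat -> T -> R) : T -> R :=
  fun x => fine (limn_esup (fun j => (psi j x)%:E)).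

Lemma limsup_repr_cvg (psi : nat -> T -> R) x : cvgn (fun j => psi j x) ->
  psi j x @[j --> \oo] --> limsup_repr psi x.
Proof.
move=> cv; have c : (psi j x)%:E @[j --> \oo] --> (limn (fun j => psi j x))%:E.
  by apply: cvg_EFin; [exact: nearW|exact: cv].
by rewrite /limsup_repr (cvg_limn_einf_sup c).2 /=.
Qed.

Lemma nrm_telescope (psi : nat -> T -> R) (C : R) k j : 0 <= C -> (forall j, sqint mu D (psi j)) ->
  (forall j, nrm mu D (fun x => psi j.+1 x - psi j x) <= C * 2^-1 ^+ j) ->
  nrm mu D (fun x => psi (k + j)%N x - psi k x) <= 2 * C * 2^-1 ^+ k.
Proof.
move=> C0 sp hp; pose q i := C * 2^-1 ^+ k * 2^-1 ^+ i.
have H : nrm mu D (fun x => psi (k + j)%N x - psi k x) <= \sum_(i < j) q i.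
  elim: j => [|j IH].
    rewrite big_ord0 addn0 /nrm (_ : \int[mu]_(x in D) _ = 0) ?sqrtr0//.
    rewrite (@Rint_ext _ _ _ _ _ _ (fun=> 0)); first by rewrite /Rintegral integral0.
    by move=> x _; rewrite subrr expr0n.
  rewrite big_ord_recr /= (le_trans _ (lerD IH (_ : nrm mu D (fun x => psi (k + j).+1 x - psi (k + j)%N x) <= q j)))//.
    rewrite addnS; apply: (le_trans _ (nrmD mD _ _)); try exact: sqintB.
    by rewrite le_eqVlt; apply/orP; left; apply/eqP/nrm_ext => x _; ring.
  by rewrite /q -mulrA -exprD.
apply: le_trans H _; rewrite -mulr_sumr mulrAC [2 * C]mulrC ler_wpM2r ?exprn_ge0//.
by rewrite ler_wpM2l// half_sum.
Qed.

(** On a set of finite measure the increments are summable in mean, so that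
    their series converges absolutely almost everywhere. *)
Lemma fast_ae (psi : nat -> T -> R) (C : R) : 0 <= C -> (forall j, sqint mu D (psi j)) ->
  (forall j, nrm mu D (fun x => psi j.+1 x - psi j x) <= C * 2^-1 ^+ j) ->
  all_ae mu (fun x => D x -> psi j x @[j --> \oo] --> limsup_repr psi x).
Proof.
move=> C0 sp hp; pose h j x : R := `|psi j.+1 x - psi j x|.
have sh j : sqint mu D (h j) by apply: (sqint_abs mD); exact: sqintB.
have s1 : sqint mu D (fun=> 1) by apply: (@sqint_bd _ _ _ _ _ mD fD _ 1) => // x _; rewrite normr1.
pose M := nrm mu D (fun=> 1).
have hj j : (\int[mu]_(x in D) (h j x)%:E <= (M * C * 2^-1 ^+ j)%:E)%E.
  have ih : intg mu D (h j) by apply: (sqint_int (mu := mu) mD fD).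
  rewrite -(Rint_fin mD ih) lee_fin.
  have := cauchy_schwarz mD s1 (sh j); rewrite -/M => /(le_trans (ler_norm _)).
  rewrite (@Rint_ext _ _ _ _ _ _ (h j)); last by move=> x _; rewrite mul1r.
  move=> /le_trans; apply; rewrite -mulrA ler_wpM2l ?nrm_ge0// (le_trans _ (hp j))//.
  rewrite /nrm le_eqVlt; apply/orP; left; apply/eqP; congr Num.sqrt; apply: Rint_ext => x _.
  by rewrite /h real_normK// num_real.
pose H x := (\sum_(j <oo) (h j x)%:E)%E.
have mh j : measurable_fun D (EFin \o h j) by apply/measurable_EFinP; case: (sh j).
have h0 j x : D x -> (0 <= (EFin \o h j) x)%E by move=> _; rewrite lee_fin /h normr_ge0.
have mH : measurable_fun D H.
  by apply: (ge0_emeasurable_sum (P := xpredT) (h := fun j => EFin \o h j)) => [k x Dx _|k _]; [exact: h0|exact: mh].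
have IH : (\int[mu]_(x in D) H x < +oo)%E.
  rewrite (integral_nneseries mu mD mh h0).
  apply: (@le_lt_trans _ _ (2 * (M * C))%:E); last exact: ltry.
  apply: lime_le.
    by apply: is_cvg_nneseries => n _ _; apply: integral_ge0 => x Dx; exact: h0.
  apply: nearW => n; apply: (@le_trans _ _ (\sum_(0 <= j < n) (M * C * 2^-1 ^+ j)%:E)%E).
    by apply: lee_sum => j _; exact: hj.
  rewrite sumEFin lee_fin big_mkord -mulr_sumr mulrC ler_wpM2r ?half_sum//.
  by rewrite mulr_ge0// nrm_ge0.
have iH : eintg mu D H.
  apply/integrableP; split => //; apply: le_lt_trans IH.
  rewrite le_eqVlt; apply/orP; left; apply/eqP; apply: eq_integral => x; rewrite inE => Dx.
  by rewrite gee0_abs//; apply: nneseries_ge0 => n _ _; rewrite lee_fin /h normr_ge0.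
apply: all_aeS (integrable_ae mD iH) => x hx Dx; apply: limsup_repr_cvg.
have fx := hx Dx.
have cs : cvgn (series (fun j => psi j.+1 x - psi j x)).
  apply: normed_cvg; apply: nondecreasing_is_cvgn.
    by apply: nondecreasing_series => n _ _; exact: normr_ge0.
  exists (fine (H x)) => _ [n _ <-]; rewrite /= -lee_fin fineK// -sumEFin.
  by apply: nneseries_lim_ge => i _ _; rewrite lee_fin.
have -> : (fun j => psi j x) = (fun n => series (fun j => psi j.+1 x - psi j x) n + psi 0%N x).
  by apply/funext => n; rewrite /series /= telescope_sumr// subrK.
by apply: is_cvgD => //; exact: is_cvg_cst.
Qed.

Lemma limsup_repr_meas (psi : nat -> T -> R) : (forall j, measurable_fun D (psi j)) ->
  measurable_fun D (limsup_repr psi).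
Proof.
move=> mp; apply: (@measurableT_comp _ _ _ _ _ _ fine) => //.
by apply: measurable_fun_limn_esup => j; apply/measurable_EFinP.
Qed.

Lemma limn_einf_le (u : nat -> \bar R) (B : \bar R) : (forall n, (u n <= B)%E) -> (limn_einf u <= B)%E.
Proof.
move=> h; rewrite limn_einf_lim; apply: lime_le; first exact: is_cvg_einfs.
by apply: nearW => n; apply: le_trans (h n); apply: ereal_inf_lbound; exists n => /=.
Qed.

(** By Fatou's lemma the bounds on the differences of two terms pass to the
    difference of a term and the limit. *)
Lemma fast_limit (psi : nat -> T -> R) (C : R) : 0 <= C -> (forall j, sqint mu D (psi j)) ->
  (forall j, nrm mu D (fun x => psi j.+1 x - psi j x) <= C * 2^-1 ^+ j) ->
  sqint mu D (limsup_repr psi) /\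
  nrm mu D (fun x => psi j x - limsup_repr psi x) @[j --> \oo] --> (0 : R).
Proof.
move=> C0 sp hp; have cae := fast_ae C0 sp hp; set t := limsup_repr psi in cae *.
have mt : measurable_fun D t by apply: limsup_repr_meas => j; case: (sp j).
have mB k : measurable_fun D (fun x => psi k x - t x) by apply: measurable_funB => //; case: (sp k).
have K k : (\int[mu]_(x in D) ((psi k x - t x) ^+ 2)%:E <= ((2 * C * 2^-1 ^+ k) ^+ 2)%:E)%E.
  pose g j x := ((psi (k + j)%N x - psi k x) ^+ 2)%:E.
  have sB j : sqint mu D (fun x => psi (k + j)%N x - psi k x) by exact: sqintB.
  have mg j : measurable_fun D (g j).
    by apply/measurable_EFinP; apply: measurable_funX; case: (sB j).
  have g0 j x : D x -> (0 <= g j x)%E by move=> _; rewrite lee_fin sqr_ge0.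
  have -> : (\int[mu]_(x in D) ((psi k x - t x) ^+ 2)%:E = \int[mu]_(x in D) limn_einf (g^~ x))%E.
    apply: ae_eq_integral => //.
    - by apply/measurable_EFinP; exact: measurable_funX.
    - rewrite /limn_einf; apply: (@measurableT_comp _ _ _ _ _ _ (@oppe R)) => //.
      apply: (measurable_fun_limn_esup (f := fun j x => - g j x)%E) => j.
      by apply: measurableT_comp.
    - apply: all_aeS cae => x hx Dx; apply/esym/(cvg_limn_einf_sup _).1.
      apply: cvg_EFin; first exact: nearW.
      suff c : psi (k + j)%N x - psi k x @[j --> \oo] --> t x - psi k x.
        rewrite -sqrrN opprB expr2 (_ : fine \o _ = fun j => (psi (k + j)%N x - psi k x) * (psi (k
            + j)%N x - psi k x)); last by apply/funext => j; rewrite /g /= expr2.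
        exact: cvgM.
      apply: cvgB; last exact: cvg_cst.
      by have := hx Dx; rewrite -(cvg_shiftn k); under eq_fun do rewrite addnC.
  apply: le_trans (fatou mu mD mg g0) _; apply: limn_einf_le => j.
  rewrite /g -(Rint_fin mD); last by case: (sB j).
  rewrite lee_fin -nrm_sqr lerXn2r ?nnegrE ?nrm_ge0//; last exact: nrm_telescope.
  by rewrite !mulr_ge0// exprn_ge0.
have sBt k : sqint mu D (fun x => psi k x - t x).
  split => //; apply/integrableP; split; first by apply/measurable_EFinP; exact: measurable_funX.
  apply: (@le_lt_trans _ _ ((2 * C * 2^-1 ^+ k) ^+ 2)%:E); last exact: ltry.
  apply: le_trans (K k); rewrite le_eqVlt; apply/orP; left; apply/eqP; apply: eq_integral => x _ /=.
  by rewrite ger0_norm// sqr_ge0.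
split.
  have := sqintB mD (sp 0%N) (sBt 0%N); apply: (sqint_ext mD) => x _; ring.
apply: (cvg0_le (b := fun k => 2 * C * 2^-1 ^+ k)).
  move=> k; rewrite nrm_ge0/= -(ler_pXn2r (n := 2))// ?nnegrE ?nrm_ge0//; last by rewrite !mulr_ge0// exprn_ge0.
  by rewrite nrm_sqr -lee_fin (Rint_fin mD) ?K//; case: (sBt k).
by apply: cvg_geometric; rewrite ger0_norm//; lra.
Qed.

End FastCauchy.

Section Trace.
Variable R : realType.
Implicit Types (K : element R) (x z : plane R).

(** The field [phi F] has the divergence [F . grad phi + d phi]. *)
Lemma green_smooth K (F : plane R -> plane R) (d phi : plane R -> R) :
  {within closure (eset K), continuous (fun x => (F x).1)} ->
  {within closure (eset K), continuous (fun x => (F x).2)} ->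
  intg (@lb2 R) (eset K) d ->
  (forall psi, test_fun (eset K) psi ->
     \int[@lb2 R]_(x in eset K) dot (F x) (cgrad psi x) =
     - \int[@lb2 R]_(x in eset K) (d x * psi x)) -> smooth phi ->
  \int[@lb2 R]_(x in eset K) (dot (F x) (cgrad phi x) + d x * phi x) =
  \sum_(e <- edges K) enorm (e.2 - e.1) *
    \int[@lb1 R]_(s in `[0, 1]) (dot (F (param e s)) (onormal K e) * phi (param e s)).
Proof.
move=> c1 c2 id hdiv sp; have mK := @eset_mble R K.
have iF psi : smooth psi -> intg (@lb2 R) (eset K) (fun x => dot (F x) (cgrad psi x)).
  move=> spsi; apply: (intD mK).
    exact: int_cont_smooth (smooth_cgrad1 spsi).
  exact: int_cont_smooth (smooth_cgrad2 spsi).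
have ib f psi : intg (@lb2 R) (eset K) f -> smooth psi -> intg (@lb2 R) (eset K) (fun x => f x * psi x).
  move=> i_f spsi; have [M M0 hM] := bounded_smooth (@eset_bounded R K) (smooth_cont spsi).
  apply: (int_dom mK _ _ (intZ mK M (int_abs i_f))).
    by apply: measurable_funM; [exact: int_meas i_f|exact: smooth_meas].
  by move=> x Kx; rewrite normrM mulrC ler_wpM2r// hM.
rewrite (divergence_theorem (F := fun x => phi x *: F x)).
- apply: eq_bigr => e _; congr (_ * _); apply: Rint_ext => s _.
  by rewrite dotZl mulrC.
- by move=> x; apply: cvgM; [exact: (continuous_subspaceT (smooth_cont sp))|exact: c1].
- by move=> x; apply: cvgM; [exact: (continuous_subspaceT (smooth_cont sp))|exact: c2].
- by apply: (intD mK); [exact: iF|exact: ib].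
move=> psi tp; have [spsi _] := tp.
have h0 := hdiv _ (test_mulr sp tp).
have e0 : \int[@lb2 R]_(x in eset K) dot (F x) (cgrad (phi * psi) x) =
  \int[@lb2 R]_(x in eset K) (dot (phi x *: F x) (cgrad psi x) + dot (F x) (cgrad phi x) * psi x).
  by apply: Rint_ext => x _; rewrite cgradM// dotDZr dotZl [psi x * _]mulrC.
have i1 : intg (@lb2 R) (eset K) (fun x => dot (phi x *: F x) (cgrad psi x)).
  apply: (int_ext mK _ (ib _ _ (iF _ spsi) sp)) => x _; by rewrite dotZl mulrC.
have i2 := ib _ _ (iF _ sp) spsi.
have i3 : intg (@lb2 R) (eset K) (fun x => d x * phi x * psi x) by apply: (ib); first exact: ib.
have e1 : \int[@lb2 R]_(x in eset K) ((dot (F x) (cgrad phi x) + d x * phi x) * psi x) =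
  \int[@lb2 R]_(x in eset K) (dot (F x) (cgrad phi x) * psi x + d x * phi x * psi x).
  by apply: Rint_ext => x _; ring.
have e2 : \int[@lb2 R]_(x in eset K) (d x * (phi * psi) x) = \int[@lb2 R]_(x in eset K) (d x * phi x * psi x).
  by apply: Rint_ext => x _; rewrite -mulrA.
rewrite e1 (RintegralD mK i2 i3); rewrite e0 e2 (RintegralD mK i1 i2) in h0.
have aux (a b c : R) : a + b = - c -> a = - (b + c) by move=> h; rewrite opprD -h addrCA addNr addr0.
exact: aux h0.
Qed.

Lemma eset_point K : exists c, eset K c.
Proof.
exists (loc K (3^-1, 3^-1)); apply/eset_loc; rewrite /refcell; case: (eshape K) => /=; last by split; lra.
by split; lra.
Qed.

(** The normal component of [x - c] is constant along an edge: it is the distance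
    from [c] to the line of the edge. *)
Lemma edge_height K (c : plane R) s : enorm (edir1 K) * dot (loc K (s, 0) - c) (onormal K (first_edge K)) =
  `|cell_det K| * lam K c.
Proof.
apply: oppr_inj; rewrite -elam_normal.
have -> : dot (loc K (s, 0) - c) (elam K) = lam K (loc K (s, 0)) - lam K c.
  by rewrite /dot /elam /lam /aff /=; ring.
by rewrite lam_loc /=; ring.
Qed.

Definition energy_sq (D : set (plane R)) (phi : plane R -> R) :=
  \int[@lb2 R]_(x in D) (phi x ^+ 2 + dot (cgrad phi x) (cgrad phi x)).

Lemma div_radial K (c : plane R) (psi : plane R -> R) : test_fun (eset K) psi ->
  \int[@lb2 R]_(x in eset K) dot (x - c) (cgrad psi x) = - \int[@lb2 R]_(x in eset K) (2 * psi x).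
Proof.
have mK := @eset_mble R K; pose F x : plane R := x - c.
have s1 : smooth (fun x : plane R => (F x).1).
  by have := smooth_aff 1 0 (- c.1); congr smooth; apply/funext => x; rewrite /aff /F /=; ring.
have s2 : smooth (fun x : plane R => (F x).2).
  by have := smooth_aff 0 1 (- c.2); congr smooth; apply/funext => x; rewrite /aff /F /=; ring.
move=> tp; have [spsi _] := tp.
  have ia f g : smooth f -> smooth g -> intg (@lb2 R) (eset K) (fun x => f x * g x).
    move=> sf sg; apply: sqint_mul => //; apply/L2E/L2_smooth => //; exact: eset_bounded.
  have e1 : (fun x : plane R => (F x).1) = aff 1 0 (- c.1) by apply/funext => x; rewrite /aff /F /=; ring.
  have e2 : (fun x : plane R => (F x).2) = aff 0 1 (- c.2) by apply/funext => x; rewrite /aff /F /=; ring.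
  rewrite RintegralD//; [|exact: ia s1 (smooth_cgrad1 spsi)|exact: ia s2 (smooth_cgrad2 spsi)].
  rewrite (ibp_test mK s1 tp (@Rint_D1 R _)) (ibp_test mK s2 tp (@Rint_D2 R _)).
  have h1 : \int[@lb2 R]_(x in eset K) ('D_(1, 0) (fun x : plane R => (F x).1) x * psi x)
      = \int[@lb2 R]_(x in eset K) psi x.
    by apply: Rint_ext => x _; rewrite e1 aff_deriv /=; ring.
  have h2 : \int[@lb2 R]_(x in eset K) ('D_(0, 1) (fun x : plane R => (F x).2) x * psi x)
      = \int[@lb2 R]_(x in eset K) psi x.
    by apply: Rint_ext => x _; rewrite e2 aff_deriv /=; ring.
  rewrite h1 h2 RintegralZl//; first ring.
  by have := ia _ _ (smooth_cst 1) spsi; apply: (int_ext mK) => x _; rewrite mul1r.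
Qed.

(** The divergence theorem for the field [(x - c) phi^2] with [c] in the cell: by
    [edge_height] its normal component is a positive multiple of [phi^2] on
    every edge. *)
Lemma trace_ineq K : exists2 C, 0 <= C & forall phi, smooth phi ->
  \sum_(e <- edges K) enorm (e.2 - e.1) * \int[@lb1 R]_(s in `[0, 1]) (phi (param e s)) ^+ 2
  <= C * energy_sq (eset K) phi.
Proof.
have [c Kc] := eset_point K; have lc := (eset_lam K c).1 Kc.
have mK := @eset_mble R K.
have [N0 N00 hN0] := bounded_coords (@eset_bounded R K).
pose B := N0 + (`|c.1| + `|c.2|).
have B0 : 0 <= B by rewrite !addr_ge0// ltW.
have hB x : eset K x -> `|x.1 - c.1| <= B /\ `|x.2 - c.2| <= B.
  move=> Kx; have [h1 h2] := hN0 _ Kx; have := ler_normB x.1 c.1; have := ler_normB x.2 c.2.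
  have := normr_ge0 c.1; have := normr_ge0 c.2; rewrite /B; split; lra.
pose M := \sum_(i <- iota 0 (nb_edges K)) enorm (edir1 (iter i (@turn R) K)) / (`|cell_det K| * lam (iter i
    (@turn R) K) c).
have dp : 0 < `|cell_det K| by rewrite normr_gt0 cell_det_neq0.
have li i : i \in iota 0 (nb_edges K) -> 0 < `|cell_det K| * lam (iter i (@turn R) K) c.
  by rewrite mem_iota add0n => /andP[_ hi]; rewrite mulr_gt0// lc.
have t0 i : i \in iota 0 (nb_edges K) -> 0 <= enorm (edir1 (iter i (@turn R) K)) / (`|cell_det K| * lam (iter i
    (@turn R) K) c).
  by move=> hi; rewrite divr_ge0// ?ltW// ?enorm_edir// ?li.
have M0 : 0 <= M by rewrite /M big_seq sumr_ge0.
exists (M * (2 + 2 * B)); first by rewrite mulr_ge0// addr_ge0// mulr_ge0.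
move=> phi sp.
pose F x : plane R := x - c.
have s1 : smooth (fun x : plane R => (F x).1).
  by have := smooth_aff 1 0 (- c.1); congr smooth; apply/funext => x; rewrite /aff /F /=; ring.
have s2 : smooth (fun x : plane R => (F x).2).
  by have := smooth_aff 0 1 (- c.2); congr smooth; apply/funext => x; rewrite /aff /F /=; ring.
have cF1 : {within closure (eset K), continuous (fun x => (F x).1)}.
  by apply: continuous_subspaceT; exact: smooth_cont.
have cF2 : {within closure (eset K), continuous (fun x => (F x).2)}.
  by apply: continuous_subspaceT; exact: smooth_cont.
have i2 : intg (@lb2 R) (eset K) (fun=> 2).
  by apply: (int_bd mK (eset_fin K) (M := 2)) => // x _; rewrite ger0_norm.
have := @green_smooth K F (fun=> 2) (phi * phi) cF1 cF2 i2 (@div_radial K c) (smoothM sp sp).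
pose I e := \int[@lb1 R]_(s in `[0, 1]) (phi (param e s)) ^+ 2.
have I0 e : 0 <= I e by apply: Rintegral_ge0 => s _; exact: sqr_ge0.
have ip e : intg (@lb1 R) `[0, 1] (fun s => phi (param e s) ^+ 2).
  apply: continuous_compact_integrable; first exact: segment_compact.
  apply: continuous_subspaceT => s; apply: (@continuous_comp _ _ _ (param e) (fun x => phi x ^+ 2)).
    by apply: cvgD; [exact: cvg_cst|apply: cvgZr_tmp; exact: cvg_id].
  exact: (smooth_cont (smooth_exp 2 sp)).
have -> : \sum_(e <- edges K) enorm (e.2 - e.1) *
    \int[@lb1 R]_(s in `[0, 1]) (dot (F (param e s)) (onormal K e) * (phi * phi) (param e s)) =
  \sum_(i <- iota 0 (nb_edges K)) `|cell_det K| * lam (iter i (@turn R) K) c * I (first_edge (iter i (@turn R) K)).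
  rewrite edgesE big_map; apply: eq_bigr => i _; set K' := iter i (@turn R) K.
  rewrite (_ : (first_edge K').2 - (first_edge K').1 = edir1 K'); last by rewrite /first_edge /= addrC addKr.
  have -> : onormal K (first_edge K') = onormal K' (first_edge K') by rewrite /onormal -!/(cell_det _) iter_turn_det.
  rewrite -(RintegralZl _ _ (ip _))// -(iter_turn_det i K) -/K'.
  have i' : intg (@lb1 R) `[0, 1] (fun s => dot (F (param (first_edge K') s)) (onormal K' (first_edge K')) *
      (phi * phi) (param (first_edge K') s)).
    apply: (int_ext _ _ (intZ _ (`|cell_det K'| * lam K' c / enorm (edir1 K')) (ip (first_edge K')))) => // s _.
    have e0 : enorm (edir1 K') != 0 by rewrite gt_eqF ?enorm_edir.
    by rewrite -(edge_height K' c s) param_first_edge [enorm _ * _]mulrC mulfK// expr2.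
  rewrite -(RintegralZl _ _ i')//; apply: Rint_ext => s _.
  by rewrite mulrA param_first_edge edge_height expr2.
rewrite edgesE big_map => G.
apply: (@le_trans _ _ (M * \sum_(i <- iota 0 (nb_edges K)) `|cell_det K| * lam (iter i (@turn R) K) c * I
    (first_edge (iter i (@turn R) K)))).
  rewrite mulr_sumr big_seq [leRHS]big_seq; apply: ler_sum => i hi; set K' := iter i (@turn R) K.
  rewrite (_ : (first_edge K').2 - (first_edge K').1 = edir1 K'); last by rewrite /first_edge /= addrC addKr.
  rewrite mulrA; apply: ler_wpM2r; first exact: I0.
  rewrite -ler_pdivrMr; last exact: li.
  rewrite /M (bigD1_seq i)//= ?iota_uniq// lerDl.
  by rewrite big_seq_cond sumr_ge0// => j /andP[hj _]; exact: t0.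
rewrite -G -mulrA ler_wpM2l//.
have s12 : sqint (@lb2 R) (eset K) phi by apply/L2E/L2_smooth => //; exact: eset_bounded.
have sc1 : sqint (@lb2 R) (eset K) (fun x => (cgrad phi x).1) by apply/L2E/L2_smooth;
    [exact: mK|exact: eset_bounded|exact: smooth_cgrad1].
have sc2 : sqint (@lb2 R) (eset K) (fun x => (cgrad phi x).2) by apply/L2E/L2_smooth;
    [exact: mK|exact: eset_bounded|exact: smooth_cgrad2].
have ie : intg (@lb2 R) (eset K) (fun x => phi x ^+ 2 + dot (cgrad phi x) (cgrad phi x)).
  apply: (intD mK); first by case: s12.
  exact: (intD mK (sqint_mul mK sc1 sc1) (sqint_mul mK sc2 sc2)).
rewrite /energy_sq -(RintegralZl _ _ ie)//; apply: le_Rintegral => //.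
- apply: (intD mK); first apply: (intD mK).
  + exact: int_cont_smooth (smooth_cgrad1 (smoothM sp sp)).
  + exact: int_cont_smooth (smooth_cgrad2 (smoothM sp sp)).
  + by apply: (intZ mK); apply: sqint_mul.
- exact: (intZ mK).
move=> x Kx; rewrite cgradM//.
have [h1 h2] := hB _ Kx; rewrite /dot /F /= /GRing.scale /= -[(phi * phi) x]/(phi x * phi x).
set a := x.1 - c.1 in h1 *; set b := x.2 - c.2 in h2 *.
move: (phi x) ('D_(1, 0) phi x) ('D_(0, 1) phi x) => q g1 g2.
(* Young's inequality for one component of the product rule *)
have k1 (y g : R) : `|y| <= B -> 2 * y * (q * g) <= B * (q ^+ 2 + g ^+ 2).
  move=> hy; apply: le_trans (ler_norm _) _; rewrite !normrM ger0_norm//.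
  have := normr_ge0 y; have := normr_ge0 q; have := normr_ge0 g; rewrite -(real_normK (num_real q)) -(real_normK
      (num_real g)).
  move: (`|y|) (`|q|) (`|g|) hy => y' q' g' hy g0 q0 y0.
  have := sqr_ge0 (q' - g'); have : 0 <= (B - y') * (q' * g') by rewrite !mulr_ge0// subr_ge0.
  move=> u1 u2; have : 0 <= B * (q' - g') ^+ 2 by rewrite mulr_ge0.
  lra.
have u1 := k1 _ g1 h1; have u2 := k1 _ g2 h2.
rewrite -subr_ge0; rewrite -subr_ge0 in u1; rewrite -subr_ge0 in u2.
rewrite [leRHS](_ : _ = (B * (q ^+ 2 + g1 ^+ 2) - 2 * a * (q * g1)) + (B * (q ^+ 2 + g2 ^+ 2) - 2 * b * (q * g2))
  + (B * g1 ^+ 2 + B * g2 ^+ 2 + 2 * g1 ^+ 2 + 2 * g2 ^+ 2)); last by ring.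
apply: addr_ge0; first exact: addr_ge0 u1 u2.
by apply: addr_ge0; [apply: addr_ge0; [apply: addr_ge0|]|]; apply: mulr_ge0 => //; exact: sqr_ge0.
Qed.
End Trace.

(** * Traces *)

Section TraceExist.
Variable R : realType.
Implicit Types (K : element R) (x z : plane R).
Local Notation sq := (sqint (@lb2 R)).
Local Notation nrm2 := (nrm (@lb2 R)).
Local Notation aeD D P := (all_ae (@lb2 R) (fun x => D x -> P x)).

Lemma fast_subseq (a : nat -> R) : a n @[n --> \oo] --> (0 : R) ->
  exists h : nat -> nat, [/\ (forall j, (j <= h j)%N), (forall j, (h j <= h j.+1)%N) &
    forall j n, (h j <= n)%N -> `|a n| <= 2^-1 ^+ j].
Proof.
move=> ca.
have H j : exists N, forall n, (N <= n)%N -> `|a n| <= 2^-1 ^+ j.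
  have /cvgr0Pnorm_le/(_ (2^-1 ^+ j)) := ca; case=> [|N _ hN]; first by rewrite exprn_gt0.
  by exists N => n; exact: hN.
pose N j := xget 0%N [set N | forall n, (N <= n)%N -> `|a n| <= 2^-1 ^+ j].
have hN j n : (N j <= n)%N -> `|a n| <= 2^-1 ^+ j.
  by rewrite /N; case: xgetP => [m _ hm|/(_ _)]; [exact: hm|have [m hm] := H j; move=> /(_ m)].
(* the sum makes [h] monotone, the summand [j] makes it unbounded *)
pose h j := (\sum_(i < j.+1) N i + j)%N.
exists h; split=> [j|j|j n hn].
- exact: leq_addl.
- by rewrite /h [in leqRHS]big_ord_recr /= leq_add// leq_addr.
- by apply: hN; apply: leq_trans hn; rewrite /h big_ord_recr /= -addnA addnCA leq_addr.
Qed.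

Lemma nrm3 (D : set (plane R)) (f0 f1 f2 : plane R -> R) : mble D -> sq D f0 -> sq D f1 -> sq D f2 ->
  \int[@lb2 R]_(x in D) (f0 x ^+ 2 + (f1 x ^+ 2 + f2 x ^+ 2)) =
  nrm2 D f0 ^+ 2 + (nrm2 D f1 ^+ 2 + nrm2 D f2 ^+ 2).
Proof.
move=> mD [_ i0] [_ i1] [_ i2]; rewrite RintegralD//; last exact: intD.
by rewrite RintegralD// !nrm_sqr.
Qed.

Lemma energy_sq_le (D Om : set (plane R)) psi (b : R) : mble D -> mble Om -> bounded_set Om -> D `<=` Om ->
  smooth psi -> 0 <= b -> nrm2 Om psi <= b -> nrm2 Om (fun x => (cgrad psi x).1) <= b ->
  nrm2 Om (fun x => (cgrad psi x).2) <= b -> energy_sq D psi <= 3 * b ^+ 2.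
Proof.
move=> mD mO bO DO sp b0 h0 h1 h2.
have S f : smooth f -> nrm2 Om f <= b -> sq D f /\ nrm2 D f ^+ 2 <= b ^+ 2.
  move=> sf hf; have so : sq Om f by apply/L2E/L2_smooth.
  split; first exact: sqint_sub so.
  by rewrite lerXn2r ?nnegrE ?nrm_ge0// (le_trans (nrm_sub mD mO DO so)).
have [i0 n0] := S _ sp h0.
have [i1 n1] := S _ (smooth_cgrad1 sp) h1; have [i2 n2] := S _ (smooth_cgrad2 sp) h2.
have -> : energy_sq D psi = nrm2 D psi ^+ 2 + (nrm2 D (fun x => (cgrad psi x).1) ^+ 2 + nrm2 D (fun x =>
    (cgrad psi x).2) ^+ 2).
  rewrite -(nrm3 mD i0 i1 i2); apply: Rint_ext => x _.
  by rewrite /dot -!expr2.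
have -> : 3 * b ^+ 2 = b ^+ 2 + (b ^+ 2 + b ^+ 2) by ring.
exact: (lerD n0 (lerD n1 n2)).
Qed.

Lemma edge_length_gt0 K (e : edge R) : e \in edges K -> 0 < enorm (e.2 - e.1).
Proof.
rewrite edgesE => /mapP[i _ ->]; rewrite /first_edge /= addrC addKr; exact: enorm_edir.
Qed.

Lemma param_meas (e : edge R) (phi : plane R -> R) : smooth phi ->
  {within `[0, 1]%classic, continuous (fun s : R => phi (param e s))}.
Proof.
move=> sp; apply: continuous_subspaceT => s; apply: (@continuous_comp _ _ _ (param e) phi).
  by apply: cvgD; [exact: cvg_cst|apply: cvgZr_tmp; exact: cvg_id].
exact: (smooth_cont sp).
Qed.

Lemma itv01_fin : (@lb1 R `[0%R, 1%R]%classic < +oo)%E.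
Proof. by rewrite /lb1 /= lebesgue_measure_itv /= lte_fin ltr01 oppr0 adde0 ltry. Qed.

Lemma param_sqint (e : edge R) (phi : plane R -> R) : smooth phi ->
  sqint (@lb1 R) `[0, 1]%classic (fun s => phi (param e s)).
Proof.
move=> sp; split; first by apply: subspace_continuous_measurable_fun => //; exact: param_meas.
apply: continuous_compact_integrable; first exact: segment_compact.
exact: (param_meas (phi := fun x => phi x ^+ 2) (smooth_exp 2 sp)).
Qed.

(** A subsequence of the defining sequence, thinned out so that the traces on
    the edges satisfy the assumptions of [fast_limit]. *)
Lemma H10_fast (Om : set (plane R)) w : open Om -> bounded_set Om -> H10 Om w ->
  exists phi : nat -> plane R -> R,
    [/\ forall n, test_fun Om (phi n), H1cvg Om phi w (wgrad Om w),
       forall n, nrm2 Om (fun x => phi n.+1 x - phi n x) <= 2 * 2^-1 ^+ n,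
       forall n, nrm2 Om (fun x => (cgrad (phi n.+1) x).1 - (cgrad (phi n) x).1) <= 2 * 2^-1 ^+ n &
       forall n, nrm2 Om (fun x => (cgrad (phi n.+1) x).2 - (cgrad (phi n) x).2) <= 2 * 2^-1 ^+ n].
Proof.
move=> oO bO [h1 [phi0 [tp0 cv0]]]; have mO := open_mble oO.
have sp0 n : smooth (phi0 n) by case: (tp0 n).
have [lw _] := h1; have wg := wgradP h1; have [G1 G2] := wgrad_sq wg.
have [c0 c1 c2] := (H1norm_smooth_cvg oO bO sp0 lw wg).1 cv0.
set g := wgrad Om w in wg G1 G2 c0 c1 c2 *.
pose N n := nrm2 Om (fun x => phi0 n x - w x) + (nrm2 Om (fun x => (cgrad (phi0 n) x).1 - (g x).1) +
  nrm2 Om (fun x => (cgrad (phi0 n) x).2 - (g x).2)).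
have N0 n : 0 <= N n by rewrite !addr_ge0// nrm_ge0.
have cN : N n @[n --> \oo] --> (0 : R).
  by rewrite -[X in _ --> X](addr0 (0 : R)) -[X in _ --> _ + X](addr0 (0 : R)); apply: cvgD c0 (cvgD c1 c2).
have [h [hj hm hb]] := fast_subseq cN.
have hy : h n @[n --> \oo] --> \oo.
  by move=> P [M _ hM]; exists M => // n hn; apply: hM; exact: leq_trans hn (hj n).
have sO psi : smooth psi -> sq Om psi by move=> spsi; apply/L2E/L2_smooth.
have Nh j n : (h j <= n)%N -> N n <= 2^-1 ^+ j.
  by move=> hn; have := hb j n hn; rewrite ger0_norm.
have inc (f : nat -> plane R -> R) F j : (forall n, sq Om (f n)) -> sq Om F ->
   (forall n, nrm2 Om (fun x => f n x - F x) <= N n) ->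
   nrm2 Om (fun x => f (h j.+1) x - f (h j) x) <= 2 * 2^-1 ^+ j.
  move=> sf sF hf.
  have -> : nrm2 Om (fun x => f (h j.+1) x - f (h j) x) = nrm2 Om (fun x => (f (h j.+1) x - F x) - (f (h j) x - F x)).
    by apply: nrm_ext => x _; rewrite opprB addrA subrK.
  apply: (le_trans (nrmB mO (sqintB mO (sf _) sF) (sqintB mO (sf _) sF))).
  rewrite mulr_natl mulr2n lerD// (le_trans (hf _))//; first exact: Nh (hm j).
  exact: Nh.
exists (fun n => phi0 (h n)); split.
- by move=> n; exact: tp0.
- split; [exact: (cvg_comp _ _ hy c0)|exact: (cvg_comp _ _ hy c1)|exact: (cvg_comp _ _ hy c2)].
- move=> n; apply: (inc phi0 w) => [m||m]; [exact: (sO _ (sp0 m))|exact/L2E|].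
  by rewrite lerDl addr_ge0// nrm_ge0.
- move=> n; apply: (inc (fun m x => (cgrad (phi0 m) x).1) (fun x => (g x).1)) => [m||m]; [exact: (sO _
    (smooth_cgrad1 (sp0 m)))|exact: G1|].
  by rewrite /N addrCA lerDl addr_ge0// nrm_ge0.
- move=> n; apply: (inc (fun m x => (cgrad (phi0 m) x).2) (fun x => (g x).2)) => [m||m]; [exact: (sO _
    (smooth_cgrad2 (sp0 m)))|exact: G2|].
  by rewrite /N addrA lerDr addr_ge0// nrm_ge0.
Qed.

(** By the trace inequality the thinned test functions also converge fast on the
    edges of every cell. Their upper limit is a function on the plane that does
    not refer to a cell, so it is the trace from both sides of an edge; on the
    boundary of the domain all the test functions are zero, and so is the limit. *)
Lemma trace_exists (Om : set (plane R)) w : open Om -> bounded_set Om -> H10 Om w ->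
  exists (tau : plane R -> R) (phi : nat -> plane R -> R),
    [/\ forall x, bdry Om x -> tau x = 0,
        forall n, test_fun Om (phi n), H1cvg Om phi w (wgrad Om w) &
        forall K, eset K `<=` Om -> is_trace K w tau /\
          (forall e, e \in edges K -> sqint (@lb1 R) `[0, 1] (fun s => tau (param e s)) /\
           nrm (@lb1 R) `[0, 1] (fun s => phi n (param e s) - tau (param e s)) @[n --> \oo] --> (0 : R))].
Proof.
move=> oO bO hw; have mO := open_mble oO.
have [phi [tp cv i0 i1 i2]] := H10_fast oO bO hw.
have sp n : smooth (phi n) by case: (tp n).
have [[lw _] _] := hw; have wg := wgradP (proj1 hw); have [G1 G2] := wgrad_sq wg.
have sO psi D : mble D -> bounded_set D -> smooth psi -> sq D psi.
  by move=> mD bD spsi; apply/L2E/L2_smooth.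
exists (limsup_repr phi), phi; split => //.
  move=> x [clx nx]; rewrite /limsup_repr (_ : (fun j => _) = fun=> 0%E).
    by rewrite (cvg_limn_einf_sup (@cvg_cst _ (0%E : \bar R) _ _ _)).2.
  apply/funext => j; have [_ [C [_ CO C0]]] := tp j; rewrite C0// => /CO Ox.
  by apply: nx; rewrite (interior_id _).1.
move=> K KO; have mK := @eset_mble R K; have bK := @eset_bounded R K.
have [C C0 hC] := trace_ineq K.
have edge_fast e : e \in edges K -> sqint (@lb1 R) `[0, 1] (fun s => limsup_repr phi (param e s)) /\
   nrm (@lb1 R) `[0, 1] (fun s => phi n (param e s) - limsup_repr phi (param e s)) @[n --> \oo] --> (0 : R).
  move=> he; have l0 := edge_length_gt0 he; set l := enorm _ in l0.
  pose B := Num.sqrt (C / l * 12).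
  have B0 : 0 <= B by exact: sqrtr_ge0.
  have H := @fast_limit _ _ _ (@lb1 R) `[0, 1] _ itv01_fin (fun n s => phi n (param e s)) B B0.
  apply: H => // [n|n]; first exact: param_sqint.
  rewrite /nrm -[leRHS]ger0_norm ?mulr_ge0 ?exprn_ge0// -sqrtr_sqr ler_wsqrtr//.
  have Cl : 0 <= C / l * 12 by apply: mulr_ge0 => //; apply: divr_ge0 => //; exact: ltW.
  rewrite exprMn (sqr_sqrtr Cl).
  have sd : smooth (phi n.+1 - phi n) by exact: smoothB.
  have E := hC _ sd.
  have {}E : l * \int[@lb1 R]_(s in `[0, 1]) (phi n.+1 (param e s) - phi n (param e s)) ^+ 2 <= C * energy_sq
      (eset K) (phi n.+1 - phi n).
    apply: le_trans E; rewrite (big_rem e)//= lerDl sumr_ge0// => e' _.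
    by rewrite mulr_ge0 ?sqrtr_ge0// Rintegral_ge0// => s _; exact: sqr_ge0.
  rewrite -ler_pdivlMl// in E; apply: (le_trans E) => {E}.
  have -> : C / l * 12 * 2^-1 ^+ n ^+ 2 = l^-1 * (C * (12 * (2^-1 ^+ n) ^+ 2)) by ring.
  have li : 0 <= l^-1 by rewrite invr_ge0 ltW.
  apply: (ler_wpM2l li); apply: (ler_wpM2l C0).
  have -> : 12 * (2^-1 ^+ n) ^+ 2 = 3 * (2 * 2^-1 ^+ n) ^+ 2 :> R by ring.
  apply: (energy_sq_le mK mO bO KO sd).
  - by rewrite mulr_ge0// exprn_ge0.
  - exact: i0.
  - apply: le_trans (i1 n); rewrite le_eqVlt; apply/orP; left; apply/eqP/nrm_ext => x _.
    by rewrite cgradB.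
  - apply: le_trans (i2 n); rewrite le_eqVlt; apply/orP; left; apply/eqP/nrm_ext => x _.
    by rewrite cgradB.
split => //.
have wK : is_wgrad (eset K) w (wgrad Om w) by exact: (wgrad_sub mK mO KO wg).
split; first by split; [exact: L2_sub mK mO KO lw|exists (wgrad Om w)].
  move=> e he; by have [] := edge_fast e he.
exists phi; split => //.
  apply: (proj2 (H1norm_smooth_cvg (@eset_open R K) bK sp (L2_sub mK mO KO lw) wK)).
  have [d0 d1 d2] := cv.
  have S f F : (forall n, sq Om (f n)) -> sq Om F -> nrm2 Om (fun x => f n x - F x) @[n --> \oo] --> (0 : R) ->
    nrm2 (eset K) (fun x => f n x - F x) @[n --> \oo] --> (0 : R).
    move=> sf sF; apply: cvg0_le => n; rewrite nrm_ge0/= nrm_sub//; exact: sqintB.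
  split.
  - by apply: (S phi w) => // [n|]; [exact: sO|exact/L2E].
  - by apply: (S (fun n x => (cgrad (phi n) x).1) (fun x => (wgrad Om w x).1)) => // n; apply: sO => //;
      exact: smooth_cgrad1.
  - by apply: (S (fun n x => (cgrad (phi n) x).2) (fun x => (wgrad Om w x).2)) => // n; apply: sO => //;
      exact: smooth_cgrad2.
pose A (e : edge R) n := enorm (e.2 - e.1) * nrm (@lb1 R) `[0, 1] (fun s => phi n (param e s) - limsup_repr phi
    (param e s)) ^+ 2.
have cA : \sum_(e <- edges K) A e n @[n --> \oo] --> (0 : R).
  have -> : (fun n => \sum_(e <- edges K) A e n) = (fun n => \sum_(e <- edges K) (if e \in edges K then A e n else 0)).
    by apply/funext => n; rewrite big_seq [RHS]big_seq; apply: eq_bigr => e ->.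
  rewrite -[X in _ --> X](_ : \sum_(e <- edges K) 0 = 0); last by rewrite big1.
  apply: cvg_sum_seq => e; case he : (e \in edges K); last exact: cvg_cst.
  have [_ ce] := edge_fast e he; rewrite -(mulr0 (enorm (e.2 - e.1))).
  by apply: cvgM; [exact: cvg_cst|apply/cvg_sqr0].
apply/cvg_sqr0; apply: cvg_trans cA; apply: near_eq_cvg; apply: nearW => n.
rewrite /L2bdnorm sqr_sqrtr; last first.
  by apply: sumr_ge0 => e _; rewrite mulr_ge0 ?sqrtr_ge0// Rintegral_ge0// => s _; exact: sqr_ge0.
by apply: eq_bigr => e _; rewrite /A nrm_sqr.
Qed.
End TraceExist.

(** * Monotonicity and Lipschitz continuity of the form *)

Section Pointwise.
Variable R : realType.
Implicit Types (x y : plane R).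

Lemma dotC x y : dot x y = dot y x. Proof. by rewrite /dot; ring. Qed.

Lemma dot_ge0 x : 0 <= dot x x. Proof. by rewrite /dot addr_ge0// -expr2 sqr_ge0. Qed.

Lemma enorm_ge0 x : 0 <= enorm x. Proof. exact: sqrtr_ge0. Qed.

Lemma enorm_sqr x : enorm x ^+ 2 = dot x x.
Proof. by rewrite sqr_sqrtr// dot_ge0. Qed.

Lemma dot_le x y : `|dot x y| <= enorm x * enorm y.
Proof.
rewrite -(@ler_pXn2r _ 2)// ?nnegrE ?mulr_ge0 ?enorm_ge0//.
rewrite exprMn !enorm_sqr real_normK ?num_real// -subr_ge0.
rewrite (_ : _ - _ = (x.1 * y.2 - x.2 * y.1) ^+ 2) ?sqr_ge0//.
by rewrite /dot; ring.
Qed.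

Lemma enorm_eq0 x : enorm x = 0 -> x = 0.
Proof.
move=> h; have : dot x x = 0 by rewrite -enorm_sqr h expr0n.
rewrite /dot -!expr2 => /eqP; rewrite paddr_eq0 ?sqr_ge0// !sqrf_eq0 => /andP[/eqP h1 /eqP h2].
by apply: plane_eq.
Qed.

Section Nonlin.
Variables (m : R -> R) (a1 a2 : R).
Hypotheses (a20 : 0 < a2) (a21 : a2 <= a1).
Hypothesis hm : forall t s, 0 <= s -> s <= t ->
  a2 * (t - s) <= m t * t - m s * s /\ m t * t - m s * s <= a1 * (t - s).

Lemma m_bounds t : 0 < t -> a2 <= m t <= a1.
Proof.
move=> t0; have := hm (lexx 0) (ltW t0); rewrite !(mulr0, subr0) => -[h1 h2].
by rewrite -(ler_pM2r t0) h1 -(ler_pM2r t0) h2.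
Qed.

Lemma m_mono s t : 0 <= s -> 0 <= t ->
  a2 * (s - t) ^+ 2 <= (m s * s - m t * t) * (s - t) /\
  (m s * s - m t * t) ^+ 2 <= a1 ^+ 2 * (s - t) ^+ 2.
Proof.
wlog st : s t / t <= s => [H|] s0 t0.
  have [st|/ltW st] := leP t s; first exact: H.
  have [h1 h2] := H t s st t0 s0; split.
    by rewrite -sqrrN opprB -(opprB (m t * t)) mulNr -mulrN opprB.
  by rewrite -(opprB (m t * t)) sqrrN -(opprB t) [in leRHS]sqrrN.
have [h1 h2] := hm t0 st; have d0 : 0 <= s - t by rewrite subr_ge0.
split; first by rewrite expr2 mulrA ler_wpM2r.
rewrite -exprMn lerXn2r ?nnegrE//; last by rewrite mulr_ge0// (le_trans (ltW a20)).
by apply: le_trans h1; rewrite mulr_ge0// ltW.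
Qed.

(** The defect in the Cauchy-Schwarz inequality is zero if [x] or [y] is, so the
    bounds on [m] at positive arguments are sufficient. *)
Lemma cross_term x y : 0 <= enorm x * enorm y - dot x y /\
  (2 * a2 * (enorm x * enorm y - dot x y) <= (m (enorm x) + m (enorm y)) * (enorm x * enorm y - dot x y) /\
   m (enorm x) * m (enorm y) * (enorm x * enorm y - dot x y) <= a1 ^+ 2 * (enorm x * enorm y - dot x y)).
Proof.
have c0 : 0 <= enorm x * enorm y - dot x y by rewrite subr_ge0 (le_trans (ler_norm _))// dot_le.
split => //; have [x0|x0] := eqVneq (enorm x) 0.
  by rewrite x0 (enorm_eq0 x0) /dot /= !mul0r addr0 subr0 !mulr0.
have [y0|y0] := eqVneq (enorm y) 0.
  by rewrite y0 (enorm_eq0 y0) /dot /= !mulr0 addr0 subr0 !mulr0.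
have px : 0 < enorm x by rewrite lt_def x0 enorm_ge0.
have py : 0 < enorm y by rewrite lt_def y0 enorm_ge0.
have /andP[h1 h2] := m_bounds px; have /andP[h3 h4] := m_bounds py.
split; apply: ler_wpM2r => //; first by rewrite mulr_natl mulr2n lerD.
by rewrite expr2 ler_pM// (le_trans (ltW a20)).
Qed.

Lemma dist_sqr x y : dot (x - y) (x - y) = (enorm x - enorm y) ^+ 2 + 2 * (enorm x * enorm y - dot x y).
Proof. by rewrite sqrrB !enorm_sqr /dot /=; ring. Qed.

(** Both sides are the sum of a term in the moduli of [x] and [y], where the scalar
    hypothesis applies, and of a multiple of the defect [|x| |y| - x . y]. *)
Lemma vec_mono x y : a2 * dot (x - y) (x - y) <=
  dot (m (enorm x) *: x - m (enorm y) *: y) (x - y).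
Proof.
have [c0 [c1 _]] := cross_term x y.
have [h _] := m_mono (enorm_ge0 x) (enorm_ge0 y).
have -> : dot (m (enorm x) *: x - m (enorm y) *: y) (x - y) =
  (m (enorm x) * enorm x - m (enorm y) * enorm y) * (enorm x - enorm y) +
  (m (enorm x) + m (enorm y)) * (enorm x * enorm y - dot x y).
  transitivity (m (enorm x) * dot x x + m (enorm y) * dot y y - (m (enorm x) + m (enorm y)) * dot x y).
    by rewrite /dot /= /GRing.scale /=; ring.
  by rewrite -!enorm_sqr; ring.
by rewrite dist_sqr mulrDr; apply: lerD => //; rewrite mulrA [a2 * 2]mulrC.
Qed.

(** The splitting into moduli and defect, for the squares of both sides. *)
Lemma vec_lip x y : enorm (m (enorm x) *: x - m (enorm y) *: y) <= a1 * enorm (x - y).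
Proof.
have [c0 [_ c1]] := cross_term x y.
have [_ h] := m_mono (enorm_ge0 x) (enorm_ge0 y).
rewrite -(@ler_pXn2r _ 2)// ?nnegrE ?mulr_ge0 ?enorm_ge0 ?(le_trans (ltW a20))//.
rewrite exprMn !enorm_sqr dist_sqr.
have -> : dot (m (enorm x) *: x - m (enorm y) *: y) (m (enorm x) *: x - m (enorm y) *: y) =
  (m (enorm x) * enorm x - m (enorm y) * enorm y) ^+ 2 +
  2 * (m (enorm x) * m (enorm y) * (enorm x * enorm y - dot x y)).
  transitivity (m (enorm x) ^+ 2 * dot x x + m (enorm y) ^+ 2 * dot y y - 2 * (m (enorm x) * m (enorm y) * dot x y)).
    by rewrite /dot /= /GRing.scale /=; ring.
  by rewrite -!enorm_sqr; ring.
rewrite [leRHS]mulrDr; apply: lerD => //.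
by rewrite [leRHS]mulrCA ler_wpM2l.
Qed.

Lemma vec_growth x : enorm (m (enorm x) *: x) <= a1 * enorm x.
Proof.
have := vec_lip x 0; rewrite subr0; suff -> : m (enorm 0) *: (0 : plane R) = 0 by rewrite subr0.
by rewrite scaler0.
Qed.

End Nonlin.

(** Multiplied by the denominator of [L], the difference of the two sides is the
    product of [b a2 - a1 b2] and [(CP X)^2 - Y^2], for [b] the maximum. *)
Lemma L_bound (a1 a2 b1 b2 CP X Y : R) : 0 < a2 -> a2 <= a1 -> 0 <= b2 -> b2 <= b1 -> 0 < CP ->
  0 <= X -> 0 <= Y -> Y <= CP * X ->
  a1 * X ^+ 2 + Num.max b1 (a1 * b2 / a2) * Y ^+ 2 <=
  Lconst a1 a2 b1 b2 CP * (a2 * X ^+ 2 + b2 * Y ^+ 2).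
Proof.
move=> a20 a21 b20 b21 C0 X0 Y0 XY; rewrite /Lconst; set b := Num.max _ _.
have hb : a1 * b2 <= b * a2 by rewrite -ler_pdivrMr// le_max lexx orbT.
have d0 : 0 < a2 + b2 * CP ^+ 2 by rewrite ltr_wpDr// mulr_ge0// exprn_ge0// ltW.
rewrite mulrAC ler_pdivlMr// -subr_ge0.
rewrite (_ : _ - _ = (b * a2 - a1 * b2) * ((CP * X) ^+ 2 - Y ^+ 2)); last by ring.
by rewrite mulr_ge0// subr_ge0// lerXn2r// nnegrE// (le_trans Y0).
Qed.

Lemma L_ge1 (a1 a2 b1 b2 CP : R) : 0 < a2 -> a2 <= a1 -> 0 <= b2 -> b2 <= b1 -> 0 < CP ->
  1 <= Lconst a1 a2 b1 b2 CP.
Proof.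
move=> a20 a21 b20 b21 C0; have d0 : 0 < a2 + b2 * CP ^+ 2 by rewrite ltr_wpDr// mulr_ge0// exprn_ge0// ltW.
rewrite /Lconst ler_pdivlMr// mul1r lerD// ler_wpM2r ?exprn_ge0 ?(ltW C0)//.
by rewrite le_max b21.
Qed.

Lemma sqrt_le_mul (a c e : R) : 0 <= c -> 0 <= e -> a <= c * e ^+ 2 -> Num.sqrt a <= Num.sqrt c * e.
Proof. by move=> c0 e0 h; rewrite -[e in leRHS]ger0_norm// -sqrtr_sqr -sqrtrM// ler_wsqrtr. Qed.

Lemma cauchy_schwarz2 (a b X Y X' Y' : R) : 0 <= a -> 0 <= b ->
  a * (X * X') + b * (Y * Y') <= Num.sqrt (a * X ^+ 2 + b * Y ^+ 2) * Num.sqrt (a * X' ^+ 2 + b * Y' ^+ 2).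
Proof.
move=> a0 b0; have n0 (x y : R) : 0 <= a * x ^+ 2 + b * y ^+ 2 by rewrite addr_ge0// mulr_ge0// sqr_ge0.
rewrite -sqrtrM// (le_trans (ler_norm _))// -sqrtr_sqr ler_wsqrtr// -subr_ge0.
have -> : (a * X ^+ 2 + b * Y ^+ 2) * (a * X' ^+ 2 + b * Y' ^+ 2) - (a * (X * X') + b * (Y * Y')) ^+ 2 = a * b *
    (X * Y' - Y * X') ^+ 2 by ring.
by rewrite mulr_ge0 ?sqr_ge0// mulr_ge0.
Qed.

End Pointwise.

Section Operator.
Variable R : realType.
Implicit Types (x y : plane R).
Local Notation sq := (sqint (@lb2 R)).
Local Notation nrm2 := (nrm (@lb2 R)).
Local Notation aeD D P := (all_ae (@lb2 R) (fun x => D x -> P x)).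

Lemma Rint_le_ae (D : set (plane R)) (p q : plane R -> R) : mble D -> intg (@lb2 R) D p -> intg (@lb2 R) D q ->
  aeD D (fun x => p x <= q x) -> \int[@lb2 R]_(x in D) p x <= \int[@lb2 R]_(x in D) q x.
Proof.
move=> mD ip iq pq; pose r x := q x - `|q x - p x|.
have ir : intg (@lb2 R) D r by apply: (intB mD) => //; apply: int_abs; exact: intB.
have -> : \int[@lb2 R]_(x in D) p x = \int[@lb2 R]_(x in D) r x.
  apply: Rint_ae => //; [|exact: int_meas ip|exact: int_meas ir].
  by apply: all_aeS pq => x h Dx; rewrite /r ger0_norm ?subr_ge0 ?h// opprB addrC subrK.
by apply: le_Rintegral => // x _; rewrite /r gerBl.
Qed.

(** [F] is continuous on a closed set, hence measurable there, and is composed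
    with the measurable map [x |-> (x, v x)]. *)
Lemma caratheodory_meas (Om : set (plane R)) (S : set R) (F : plane R -> R -> R) (v : plane R -> R) :
  mble Om -> closed S ->
  {within closure Om `*` S, continuous (fun z : plane R * R => F z.1 z.2)} ->
  measurable_fun (Om : set (mplane R)) v -> (forall x, Om x -> S (v x)) ->
  measurable_fun (Om : set (mplane R)) (fun x => F x (v x)).
Proof.
move=> mO cS cF mv Sv.
pose v' := v \_ Om.
have mv' : measurable_fun (setT : set (mplane R)) v' by apply/(measurable_restrictT _ _).1.
have mh : measurable_fun (setT : set (mplane R)) (fun x : mplane R => (x, v' x)).
  by apply: measurable_fun_pair => //.
have mS : measurable (closure Om `*` S).
  apply: closed_measurable3; rewrite (_ : _ `*` _ = (fst @^-1` closure Om) `&` (snd @^-1` S)) //.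
  apply: closedI; (apply: closed_comp; last by [exact: closed_closure|exact: cS]) => z _.
    exact: cvg_fst.
  exact: cvg_snd.
have H := measurable_comp mS _ (cont_measurable3 mS cF) (measurable_funS (measurableT) (@subsetT _ Om) mh).
apply: (eq_measurable_fun ((fun z : plane R * R => F z.1 z.2) \o (fun x : mplane R => (x, v' x)))).
  by move=> x xO; rewrite /= /v' /patch xO.
apply: H => _ [x Ox <-]; split => /=; first exact: subset_closure.
by rewrite /v' /patch mem_set//; exact: Sv.
Qed.

Lemma meas_sqrt (D : set (plane R)) (v : plane R -> R) : measurable_fun (D : set (mplane R)) v ->
  measurable_fun (D : set (mplane R)) (fun x => Num.sqrt (v x)).
Proof.
move=> mv; apply: (@measurableT_comp _ _ _ _ _ _ (@Num.sqrt R) _ v) => //.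
by apply: continuous_measurable_fun; exact: sqrt_continuous.
Qed.

Definition vsq (D : set (plane R)) (g : plane R -> plane R) :=
  sq D (fun x => (g x).1) /\ sq D (fun x => (g x).2).

Lemma vsq_enorm D g : mble D -> vsq D g -> sq D (fun x => enorm (g x)).
Proof.
move=> mD [s1 s2]; have [m1 i1] := s1; have [m2 i2] := s2; split.
  by apply: meas_sqrt; apply: measurable_funD; exact: measurable_funM.
apply: (int_ext mD _ (intD mD i1 i2)) => x _; by rewrite enorm_sqr /dot !expr2.
Qed.

Lemma vsq_dot D g h : mble D -> vsq D g -> vsq D h -> intg (@lb2 R) D (fun x => dot (g x) (h x)).
Proof. by move=> mD [g1 g2] [h1 h2]; apply: (intD mD); exact: sqint_mul. Qed.

Lemma vsq_norm D g : mble D -> L2vnorm D g = nrm2 D (fun x => enorm (g x)).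
Proof.
move=> mD; congr Num.sqrt; apply: Rint_ext => x _; by rewrite enorm_sqr.
Qed.

Variables (Om : set (plane R)) (mu f : plane R -> R -> R) (a1 a2 b1 b2 CP : R).
Hypotheses (oO : open Om) (bO : bounded_set Om).
Hypothesis cmu : {within closure Om `*` [set t : R | 0 <= t],
     continuous (fun z : plane R * R => mu z.1 z.2)}.
Hypothesis cf : {within closure Om `*` [set: R],
     continuous (fun z : plane R * R => f z.1 z.2)}.
Hypotheses (a21 : a2 <= a1) (a20 : 0 < a2) (b21 : b2 <= b1) (b20 : 0 <= b2).
Hypothesis hmu : forall (x : plane R) (t s : R), closure Om x -> 0 <= s -> s <= t ->
     a2 * (t - s) <= mu x t * t - mu x s * s /\
     mu x t * t - mu x s * s <= a1 * (t - s).
Hypothesis hf : forall (x : plane R) (t s : R), closure Om x -> s <= t ->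
     b2 * (t - s) <= f x t - f x s /\ f x t - f x s <= b1 * (t - s).
Hypothesis CP0 : 0 < CP.
Hypothesis poinc : forall v, H10 Om v -> L2norm Om v <= CP * L2vnorm Om (wgrad Om v).
Let mO : mble Om := open_mble oO.
Local Notation L := (Lconst a1 a2 b1 b2 CP).

Definition mu_flux (g : plane R -> plane R) x : plane R := mu x (enorm (g x)) *: g x.

Lemma mu_meas D g : mble D -> D `<=` Om -> vsq D g -> measurable_fun (D : set (mplane R)) (fun x => mu x (enorm (g x))).
Proof.
move=> mD DO sg; have [ms _] := vsq_enorm mD sg.
apply: (caratheodory_meas (S := [set t : R | 0 <= t]) mD _ _ ms) => [||x _]; [exact: closed_ge| |exact: enorm_ge0].
by apply: continuous_subspaceW cmu => z [h1 h2]; split => //; exact: (closure_subset DO).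
Qed.

Lemma mu_flux_sq D g : mble D -> D `<=` Om -> vsq D g -> vsq D (mu_flux g).
Proof.
move=> mD DO sg; have mm := mu_meas mD DO sg; have [[m1 _] [m2 _]] := sg.
have se := sqintZ mD a1 (vsq_enorm mD sg).
have h x : D x -> enorm (mu_flux g x) <= a1 * enorm (g x).
  by move=> Dx; apply: (vec_growth a20 a21 (m := mu x)) => t s; apply: hmu; exact/subset_closure/DO.
have c1 y : `|y.1| <= enorm y :> R by rewrite -sqrtr_sqr ler_wsqrtr// /dot expr2 lerDl -expr2 sqr_ge0.
have c2 y : `|y.2| <= enorm y :> R by rewrite -sqrtr_sqr ler_wsqrtr// /dot expr2 lerDr -expr2 sqr_ge0.
split; (apply: (sqint_dom mD _ _ se); first exact: measurable_funM) => x Dx;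
  by apply: le_trans (le_trans _ (h x Dx)) (ler_norm _).
Qed.

Lemma f_lip x s t : closure Om x -> `|f x s - f x t| <= b1 * `|s - t|.
Proof.
move=> cx; wlog st : s t / t <= s => [H|].
  by have [st|/ltW st] := leP t s; [exact: H|rewrite distrC (distrC s); exact: H].
have [h1 h2] := hf cx st; have d0 : 0 <= s - t by rewrite subr_ge0.
by rewrite (ger0_norm d0) ger0_norm// (le_trans _ h1)// mulr_ge0.
Qed.

Lemma f_mono x s t : closure Om x -> b2 * (s - t) ^+ 2 <= (f x s - f x t) * (s - t).
Proof.
move=> cx; wlog st : s t / t <= s => [H|].
  have [st|/ltW st] := leP t s; first exact: H.
  by have := H t s st; rewrite -(opprB s) sqrrN mulrN -mulNr opprB.
have [h1 h2] := hf cx st; have d0 : 0 <= s - t by rewrite subr_ge0.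
by rewrite expr2 mulrA ler_wpM2r.
Qed.

Lemma b10 : 0 <= b1. Proof. exact: le_trans b21. Qed.
Lemma a10 : 0 <= a1. Proof. exact: le_trans (ltW a20) a21. Qed.

Lemma f_sq D v : mble D -> D `<=` Om -> sq D v -> sq D (fun x => f x (v x)).
Proof.
move=> mD DO sv; have [mv _] := sv.
have bD : bounded_set D by have [M [Mr hM]] := bO; exists M; split => // N MN x /DO; exact: hM.
have mf : measurable_fun (D : set (mplane R)) (fun x => f x (v x)).
  apply: (caratheodory_meas (S := setT) mD _ _ mv) => [||//]; first exact: closedT.
  by apply: continuous_subspaceW cf => z [h1 h2]; split => //; exact: (closure_subset DO).
have [M M0 hM] : exists2 M, 0 <= M & forall x, closure Om x -> `|f x 0| <= M.
  apply: compact_abs_bound.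
    by apply: compact_closed_bounded; [exact: closed_closure|exact: closure_bounded].
  have : {within closure Om, continuous ((fun z : plane R * R => f z.1 z.2) \o (fun x => (x, 0 : R)))}.
    apply/subspace_continuousP => x cx; move/subspace_continuousP : (cf).
    move=> /(_ (x, 0) (conj cx I)) h P /h; rewrite /within /= => -[[A B] [/= hA hB] AB].
    apply: filterS hA => y Ay cy; apply: AB; last by [].
    by split => //=; exact: nbhs_singleton hB.
  by [].
have sM : sq D (fun=> M) by apply: (sqint_bd mD (bounded_finite mD bD) (M := M)) => // x _; rewrite ger0_norm.
apply: (sqint_dom mD mf _ (sqintD mD sM (sqintZ mD b1 (sqint_abs mD sv)))) => x Dx.
have cx : closure Om x by exact/subset_closure/DO.
rewrite [leRHS]ger0_norm ?addr_ge0 ?mulr_ge0 ?b10//.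
have -> : f x (v x) = f x 0 + (f x (v x) - f x 0) by ring.
apply: (le_trans (ler_normD _ _)); apply: lerD; first exact: hM.
by have := f_lip (v x) 0 cx; rewrite subr0.
Qed.

Lemma H1_sq v : H1 Om v -> vsq Om (wgrad Om v) /\ sq Om v.
Proof. by move=> h; split; [exact: wgrad_meas|apply/L2E; case: h]. Qed.

Lemma formA_int v w : H1 Om v -> H1 Om w -> intg (@lb2 R) Om (fun x =>
  mu x (enorm (wgrad Om v x)) * dot (wgrad Om v x) (wgrad Om w x) + f x (v x) * w x).
Proof.
move=> /H1_sq[gv sv] /H1_sq[gw sw]; apply: (intD mO).
  apply: (int_ext mO _ (vsq_dot mO (mu_flux_sq mO (@subset_refl _ _) gv) gw)) => x _.
  by rewrite /mu_flux dotZl.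
by apply: sqint_mul => //; apply: f_sq.
Qed.

Lemma ip_int (c1 c2 : R) v w : H1 Om v -> H1 Om w -> intg (@lb2 R) Om (fun x =>
  c1 * dot (wgrad Om v x) (wgrad Om w x) + c2 * (v x * w x)).
Proof.
move=> /H1_sq[gv sv] /H1_sq[gw sw]; apply: (intD mO); apply: (intZ mO); first exact: vsq_dot.
exact: sqint_mul.
Qed.

Lemma energy_sqr v : H1 Om v -> energy Om a2 b2 v ^+ 2 = a2 * L2vnorm Om (wgrad Om v) ^+ 2 + b2 * L2norm Om v ^+ 2.
Proof.
move=> hv; have [gv sv] := H1_sq hv.
have i1 := vsq_dot mO gv gv; have i2 : intg (@lb2 R) Om (fun x => v x * v x) by exact: sqint_mul.
rewrite /energy sqr_sqrtr; last first.
  apply: Rintegral_ge0 => x _; rewrite addr_ge0// mulr_ge0 ?dot_ge0 ?(ltW a20)//.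
  by rewrite -expr2 sqr_ge0.
rewrite /ip lb2E RintegralD//; [|exact: intZ|exact: intZ].
rewrite !RintegralZl//; congr (_ * _ + _ * _).
  by rewrite /L2vnorm sqr_sqrtr// Rintegral_ge0// => x _; exact: dot_ge0.
rewrite /L2norm sqr_sqrtr ?lb2E; last by rewrite Rintegral_ge0// => x _; exact: sqr_ge0.
by apply: Rint_ext => x _; rewrite expr2.
Qed.

(** Integrate [vec_mono] and [f_mono]. *)
Lemma formA_mono u v : H1 Om u -> H1 Om v ->
  energy Om a2 b2 (u - v) ^+ 2 <= formA Om mu f u (u - v) - formA Om mu f v (u - v).
Proof.
move=> hu hv; have he : H1 Om (u - v).
  have [lu _] := hu; have [lv _] := hv; split; first exact: L2B.
  by eexists; apply: wgradB => //; exact: wgradP.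
have iu := formA_int hu he; have iv := formA_int hv he; have ie := ip_int a2 b2 he he.
rewrite /energy sqr_sqrtr; last first.
  apply: Rintegral_ge0 => x _; rewrite addr_ge0// mulr_ge0 ?dot_ge0 ?(ltW a20)//.
  by rewrite -expr2 sqr_ge0.
rewrite /ip /formA !lb2E -(RintegralB mO iu iv).
have [ge se] := H1_sq he; have [gu su] := H1_sq hu; have [gv sv] := H1_sq hv.
have ew := wgradB_ae oO hu hv.
apply: (Rint_le_ae mO ie (intB mO iu iv)); apply: all_aeS ew => x hx Ox; rewrite (hx Ox).
have cx : closure Om x by exact: subset_closure.
have h1 := vec_mono a20 a21 (fun t s => @hmu x t s cx) (wgrad Om u x) (wgrad Om v x).
have h2 := f_mono (u x) (v x) cx.
apply: (le_trans (lerD h1 h2)); rewrite le_eqVlt; apply/orP; left; apply/eqP.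
by rewrite -[(u - v) x]/(u x - v x) dotBl !dotZl mulrBl opprD addrACA.
Qed.

(** By [vec_lip] and [f_lip] the left-hand side is a scalar product of the moduli
    with weights [a1] and [max b1 (a1 b2 / a2)]; [L_bound] compares each of the
    two weighted norms with the energy norm. *)
Lemma formA_lip u v w : H1 Om u -> H1 Om v -> H10 Om (u - v) -> H10 Om w ->
  `|formA Om mu f u w - formA Om mu f v w| <= L * (energy Om a2 b2 (u - v) * energy Om a2 b2 w).
Proof.
move=> hu hv he0 hw0; have he := proj1 he0; have hw := proj1 hw0.
have iu := formA_int hu hw; have iv := formA_int hv hw.
have [ge se] := H1_sq he; have [gw sw] := H1_sq hw.
have [gu su] := H1_sq hu; have [gv sv] := H1_sq hv.
have ew := wgradB_ae oO hu hv.
rewrite /formA !lb2E -(RintegralB mO iu iv).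
set b := Num.max b1 (a1 * b2 / a2).
have bb1 : b1 <= b by rewrite /b le_max lexx.
have bb0 : 0 <= b by exact: le_trans b10 bb1.
pose F x := a1 * (enorm (wgrad Om (u - v) x) * enorm (wgrad Om w x)) + b * (`|(u - v) x| * `|w x|).
have s1 := vsq_enorm mO ge; have s2 := vsq_enorm mO gw.
have s3 := sqint_abs mO se; have s4 := sqint_abs mO sw.
have i1 := sqint_mul mO s1 s2; have i2 := sqint_mul mO s3 s4.
have iF : intg (@lb2 R) Om F by apply: (intD mO); exact: intZ.
apply: (le_trans (le_normr_Rintegral mO (intB mO iu iv))).
apply: (le_trans (Rint_le_ae mO (int_abs (intB mO iu iv)) iF _)).
  apply: all_aeS ew => x hx Ox; rewrite /F (hx Ox).
  have cx : closure Om x by exact: subset_closure.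
  have h1 := vec_lip a20 a21 (fun t s => @hmu x t s cx) (wgrad Om u x) (wgrad Om v x).
  have h2 := f_lip (u x) (v x) cx.
  have -> : (mu x (enorm (wgrad Om u x)) * dot (wgrad Om u x) (wgrad Om w x) + f x (u x) * w x) -
    (mu x (enorm (wgrad Om v x)) * dot (wgrad Om v x) (wgrad Om w x) + f x (v x) * w x) =
    dot (mu x (enorm (wgrad Om u x)) *: wgrad Om u x - mu x (enorm (wgrad Om v x)) *: wgrad Om v x) (wgrad Om w x)
    + (f x (u x) - f x (v x)) * w x.
    by rewrite dotBl !dotZl mulrBl opprD addrACA.
  apply: (le_trans (ler_normD _ _)); apply: lerD.
    by apply: (le_trans (dot_le _ _)); rewrite mulrA ler_wpM2r// enorm_ge0.
  rewrite normrM mulrA ler_wpM2r// (le_trans h2)// ler_wpM2r//.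
have -> : \int[@lb2 R]_(x in Om) F x = \int[@lb2 R]_(x in Om) (a1 * (enorm (wgrad Om (u - v) x) * enorm
    (wgrad Om w x))) +
  \int[@lb2 R]_(x in Om) (b * (`|(u - v) x| * `|w x|)).
  by apply: RintegralD => //; exact: intZ.
rewrite (RintegralZl _ _ i1)// (RintegralZl _ _ i2)//.
pose X := L2vnorm Om (wgrad Om (u - v)); pose Y := L2norm Om (u - v).
pose X' := L2vnorm Om (wgrad Om w); pose Y' := L2norm Om w.
have hX : \int[@lb2 R]_(x in Om) (enorm (wgrad Om (u - v) x) * enorm (wgrad Om w x)) <= X * X'.
  by rewrite /X /X' !vsq_norm//; exact: le_trans (ler_norm _) (cauchy_schwarz mO s1 s2).
have nE q : L2norm Om q = nrm2 Om (fun x => `|q x|).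
  by rewrite /L2norm lb2E; congr Num.sqrt; apply: Rint_ext => x _; rewrite real_normK// num_real.
have hY : \int[@lb2 R]_(x in Om) (`|(u - v) x| * `|w x|) <= Y * Y'.
  by rewrite /Y /Y' !nE; exact: le_trans (ler_norm _) (cauchy_schwarz mO s3 s4).
apply: (@le_trans _ _ (a1 * (X * X') + b * (Y * Y'))); first by apply: lerD; apply: ler_wpM2l => //; exact: a10.
apply: (le_trans (cauchy_schwarz2 _ _ _ _ a10 bb0)).
have L0 : 0 <= L by exact: le_trans (L_ge1 a20 a21 b20 b21 CP0).
have E q : H10 Om q -> Num.sqrt (a1 * L2vnorm Om (wgrad Om q) ^+ 2 + b * L2norm Om q ^+ 2)
    <= Num.sqrt L * energy Om a2 b2 q.
  move=> hq; apply: (sqrt_le_mul L0 (sqrtr_ge0 _)); rewrite (energy_sqr (proj1 hq)).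
  exact: (L_bound a20 a21 b20 b21 CP0 (sqrtr_ge0 _) (sqrtr_ge0 _) (poinc hq)).
apply: (le_trans (ler_pM (sqrtr_ge0 _) (sqrtr_ge0 _) (E _ he0) (E _ hw0))).
by rewrite mulrACA -expr2 sqr_sqrtr.
Qed.
End Operator.

(** * Finite element functions *)

Section Fem.
Variable R : realType.
Implicit Types (K : element R) (x y z : plane R).
Local Notation sq := (sqint (@lb2 R)).
Local Notation nrm2 := (nrm (@lb2 R)).
Local Notation aeD D P := (all_ae (@lb2 R) (fun x => D x -> P x)).

Lemma unloc1E K : (fun x => (unloc K x).1) = aff ((edir2 K).2 / cell_det K) (- (edir2 K).1 / cell_det K)
   (- cross (eorg K) (edir2 K) / cell_det K).
Proof. by apply/funext => x; rewrite /unloc /aff /cross /=; ring. Qed.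

Lemma unloc2E K : (fun x => (unloc K x).2) = aff (- (edir1 K).2 / cell_det K) ((edir1 K).1 / cell_det K)
   (- cross (edir1 K) (eorg K) / cell_det K).
Proof. by apply/funext => x; rewrite /unloc /aff /cross /=; ring. Qed.

(** On a parallelogram, the polynomial is composed with the affine map [unloc K]. *)
Lemma Sp_smooth p K v : Sp p K v -> exists2 q, smooth q & forall x, eset K x -> v x = q x.
Proof.
rewrite /Sp; case es : (eshape K) => -[q [c hq] hv].
  exists q => //; rewrite (_ : q = fun x => \sum_(i < p.+1) \sum_(j < p.+1 | (i + j <= p)%N) c i j *
      (aff 1 0 0 x ^+ i * aff 0 1 0 x ^+ j)).
    apply: smooth_sum => i _; apply: smooth_sum => j _; apply: smoothZ.
    exact: smoothM (smooth_exp _ (smooth_aff _ _ _)) (smooth_exp _ (smooth_aff _ _ _)).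
  apply/funext => x; rewrite hq; apply: eq_bigr => i _; apply: eq_bigr => j _.
  by rewrite /aff !mul1r !mul0r !addr0 add0r mulrA.
exists (q \o unloc K); last by move=> x /esetE; rewrite es => hx; rewrite -[in LHS](unlocK K x) hv.
rewrite (_ : q \o unloc K = fun x => \sum_(i < p.+1) \sum_(j < p.+1) c i j * ((unloc K x).1 ^+ i * (unloc K x).2 ^+ j)).
  apply: smooth_sum => i _; apply: smooth_sum => j _; apply: smoothZ.
  apply: smoothM; [apply: (smooth_exp i)|apply: (smooth_exp j)].
    by rewrite unloc1E; exact: smooth_aff.
  by rewrite unloc2E; exact: smooth_aff.
apply/funext => x; rewrite /= hq; apply: eq_bigr => i _; apply: eq_bigr => j _; by rewrite mulrA.
Qed.

Lemma Sp_lin p K v w (a b : R) : Sp p K v -> Sp p K w -> Sp p K (fun x => a * v x + b * w x).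
Proof.
rewrite /Sp; case es : (eshape K) => -[q [c hq] hv] [q' [c' hq'] hw].
  exists (fun x => a * q x + b * q' x); last by move=> x Kx; rewrite hv// hw.
  exists (fun i j => a * c i j + b * c' i j) => x; rewrite hq hq' !mulr_sumr -big_split /=.
  apply: eq_bigr => i _; rewrite !mulr_sumr -big_split /=; apply: eq_bigr => j _; ring.
exists (fun x => a * q x + b * q' x); last by move=> x Kx; rewrite hv// hw.
exists (fun i j => a * c i j + b * c' i j) => x; rewrite hq hq' !mulr_sumr -big_split /=.
apply: eq_bigr => i _; rewrite !mulr_sumr -big_split /=; apply: eq_bigr => j _; ring.
Qed.

Lemma Sp0 p K : Sp p K (fun=> 0).
Proof.
have h x : (0 : R) = \sum_(i < p.+1) \sum_(j < p.+1) 0 * x.1 ^+ i * x.2 ^+ j.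
  by rewrite big1// => i _; rewrite big1// => j _; rewrite !mul0r.
rewrite /Sp; case: (eshape K); exists (fun=> 0) => //.
  exists (fun _ _ => 0) => x; rewrite big1// => i _; rewrite big1// => j _; by rewrite !mul0r.
by exists (fun _ _ => 0) => x; exact: h.
Qed.

Lemma VFEM_lin Om p T v w (a b : R) : open Om -> bounded_set Om -> VFEM Om p T v -> VFEM Om p T w ->
  VFEM Om p T (fun x => a * v x + b * w x).
Proof. by move=> oO bO [v1 v2] [w1 w2]; split; [exact: H10_lin|move=> k; exact: Sp_lin]. Qed.

Lemma VFEM0 Om p (T : mesh R) : open Om -> bounded_set Om -> VFEM Om p T (fun=> 0).
Proof. by move=> oO bO; split; [exact: H10_0|move=> k; exact: Sp0]. Qed.

(** Each nodal function lies in the space: if no function has the prescribed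
    nodal values the choice returns zero, which lies in it too. *)
Lemma clement_VFEM Om p (T : mesh R) v : open Om -> bounded_set Om -> VFEM Om p T (clement Om p T v).
Proof.
move=> oO bO; have V0 := VFEM0 p T oO bO.
have B x : VFEM Om p T (lagrange_basis Om p T x).
  by rewrite /lagrange_basis; case: xgetP => [phi _ [h _ _]|_].
rewrite /clement; elim: (interior_nodes Om p T) => [|x s IH].
  by rewrite (_ : (fun y => _) = fun=> 0)//; apply/funext => y; rewrite big_nil.
have := VFEM_lin (L2proj p (supp_in Om (lagrange_basis Om p T x)) v x) 1 oO bO (B x) IH.
by congr (VFEM _ _ _ _); apply/funext => y; rewrite big_cons mul1r.
Qed.

Lemma near_eset K (v q : plane R -> R) x : (forall x, eset K x -> v x = q x) -> eset K x ->
  \forall y \near x, v y = q y.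
Proof.
move=> h Kx; have : nbhs x (eset K) by apply: open_nbhs_nbhs; split => //; exact: eset_open.
by apply: filterS => y; exact: h.
Qed.

(** Weak gradients restrict to open subsets, and the classical gradient of a
    smooth function is its weak gradient. *)
Lemma wgrad_cell Om K v q : mble Om -> eset K `<=` Om -> H1 Om v -> smooth q ->
  (forall x, eset K x -> v x = q x) -> aeD (eset K) (fun x => wgrad Om v x = cgrad q x).
Proof.
move=> mO KO hv sq' hq; have mK := @eset_mble R K.
apply: (wgrad_uniq (@eset_open R K) (wgrad_sub mK mO KO (wgradP hv))).
apply: (wgrad_ext (v := q)); first by move=> x Kx; rewrite hq.
by apply: wgrad_smooth => //; exact: eset_bounded.
Qed.

Lemma lam_null K : @lb2 R [set x | lam K x = 0] = 0%E.
Proof.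
rewrite -[RHS](@null_line R (lamA K) (lamB K) (cross (edir1 K) (eorg K) / cell_det K)).
  congr (lb2 R _); apply/seteqP; split => x; rewrite /lam /aff /= mulNr => h.
    by apply/eqP; rewrite -subr_eq0; apply/eqP.
  by apply/eqP; rewrite subr_eq0; apply/eqP.
apply/orP; rewrite /lamA /lamB !mulf_eq0 !invr_eq0 (negbTE (cell_det_neq0 K)) !orbF oppr_eq0.
apply/orP; rewrite -negb_and; apply/negP => /andP[/eqP h1 /eqP h2].
by have /eqP := cell_det_neq0 K; rewrite /cell_det /cross h1 h2 !mul0r subrr.
Qed.

Lemma lam_ae K : all_ae (@lb2 R) (fun x => lam K x <> 0).
Proof.
apply: (@all_ae_null _ _ _ (@lb2 R) [set x | lam K x = 0]); last exact: lam_null.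
have -> : [set x | lam K x = 0] = lam K @^-1` [set 0] by [].
apply: (closed_measurable2 (U := lam K @^-1` [set 0])).
apply: closed_comp; last exact: closed_eq.
by move=> z _; exact: lam_cont.
Qed.

(** A point in the closure of a cell but not in the cell lies on one of the lines
    through its edges. *)
Lemma cells_ae Om (T : mesh R) : partition_of Om T ->
  aeD Om (fun x => exists k, eset (cell T k) x).
Proof.
move=> [h1 h2 h3].
have : all_ae (@lb2 R) (fun x => forall n m : nat, forall k : 'I_(ncells T), k = n :> nat ->
    lam (iter m (@turn R) (cell T k)) x <> 0).
  apply: all_ae_foralln => n; apply: all_ae_foralln => m.
  case: (ltnP n (ncells T)) => hn; last first.
    by apply: all_aeW => x k kn; move: (ltn_ord k); rewrite kn ltnNge hn.
  apply: all_aeS (lam_ae (iter m (@turn R) (cell T (Ordinal hn)))) => x hx k kn.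
  by rewrite (_ : k = Ordinal hn) //; exact: val_inj.
apply: all_aeS => x hx Ox.
have : closure Om x by exact: subset_closure.
rewrite h3 => -[k _ ck]; exists k; apply/eset_lam => i hi.
rewrite lt_def (closure_lam ck hi) andbT; apply/eqP; exact: hx.
Qed.

Lemma Rint_cells Om (T : mesh R) (F : plane R -> R) : mble Om -> partition_of Om T -> intg (@lb2 R) Om F ->
  \int[@lb2 R]_(x in Om) F x = \sum_(k < ncells T) \int[@lb2 R]_(x in eset (cell T k)) F x.
Proof.
move=> mO hp iF; have [h1 h2 h3] := hp.
pose G k := F \_ (eset (cell T k)).
have mK k := @eset_mble R (cell T k).
have iG k : intg (@lb2 R) Om (G k).
  apply/(int_supp (@lb2 R) (mK k) mO (h1 k)); first by move=> x _ nx; rewrite /G /patch memNset.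
  apply: (int_ext (mK k) _ (integrableS mO (mK k) (h1 k) iF)) => x Kx; by rewrite /G /patch mem_set.
have e1 : \int[@lb2 R]_(x in Om) F x = \int[@lb2 R]_(x in Om) (\sum_(k < ncells T) G k x).
  apply: Rint_ae => //; [|exact: int_meas iF|apply: (int_meas (int_sum mO _ iG))].
  apply: all_aeS (cells_ae hp) => x hx Ox; have [k Kx] := hx Ox.
  rewrite (bigD1 k)//= [G k x]/patch mem_set// big1 ?addr0// => l lk.
  rewrite /G /patch memNset// => Lx; have := h2 _ _ lk.
  by apply/eqP/set0P; exists x.
rewrite e1 Rint_sum//; apply: eq_bigr => k _.
rewrite (Rint_supp (@lb2 R) (h1 k)); last by move=> x _ nx; rewrite /G /patch memNset.
by apply: Rint_ext => x Kx; rewrite /G /patch mem_set.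
Qed.

End Fem.

(** * Edges of a regular mesh *)

Section Edges.
Variable R : realType.
Implicit Types (K : element R) (x y z : plane R) (e : edge R).

Lemma same_edgeC e e' : same_edge e e' = same_edge e' e.
Proof.
rewrite /same_edge; case: e e' => [a b] [a' b'] /=; rewrite !xpair_eqE.
by rewrite [a == a']eq_sym [b == b']eq_sym [a == b']eq_sym [b == a']eq_sym [(b' == a) && _]andbC.
Qed.

Lemma param_rev e s : param (e.2, e.1) s = param e (1 - s).
Proof. by apply: plane_eq; rewrite /param /= /GRing.scale /=; ring. Qed.

Lemma same_edge_param e e' s : same_edge e' e -> 0 < s < 1 ->
  exists2 s', 0 < s' < 1 & param e s = param e' s'.
Proof.
move=> /orP[/eqP ->|/eqP ->] s01; first by exists s.
exists (1 - s); first by move: s01 => /andP[? ?]; apply/andP; split; lra.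
by rewrite param_rev; congr param; lra.
Qed.

Definition edge_pos (sh : Defs.shape) (i : nat) (s : R) : plane R :=
  match sh, i with
  | _, 0 => (s, 0)
  | Triangle, 1 => (1 - s, s)
  | Triangle, _ => (0, 1 - s)
  | Parallelogram, 1 => (1, s)
  | Parallelogram, 2 => (1 - s, 1)
  | Parallelogram, _ => (0, 1 - s)
  end.

Lemma edge_posE K i s : (i < nb_edges K)%N -> loc (iter i (@turn R) K) (s, 0) = loc K (edge_pos (eshape K) i s).
Proof.
rewrite /nb_edges; case es : (eshape K); case: i => [|[|[|[|i]]]]//= _;
  rewrite /turn ?es /= ?es /=; apply: plane_eq; rewrite /loc /= /GRing.scale /=; ring.
Qed.

Lemma lam_edge K i j s : (i < nb_edges K)%N -> (j < nb_edges K)%N -> i != j -> 0 < s < 1 ->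
  0 < lam (iter j (@turn R) K) (loc (iter i (@turn R) K) (s, 0)).
Proof.
move=> hi hj ij /andP[s0 s1]; rewrite (edge_posE _ hi); move: hi hj ij; rewrite /nb_edges.
case es : (eshape K).
  case: j => [|[|[|j]]]//= hi _; [rewrite lam_loc|rewrite lam_turn1_tri//|rewrite lam_turn2_tri//];
  by case: i hi => [|[|[|i]]]//= _ _; lra.
case: j => [|[|[|[|j]]]]//= hi _; [rewrite lam_loc|rewrite lam_turn1_par//|rewrite lam_turn2_par//|rewrite
    lam_turn3_par//];
by case: i hi => [|[|[|[|i]]]]//= _ _; lra.
Qed.

Lemma edgeP K e : e \in edges K -> exists2 i, (i < nb_edges K)%N & e = first_edge (iter i (@turn R) K).
Proof. by rewrite edgesE => /mapP[i]; rewrite mem_iota add0n => /andP[_ hi] ->; exists i. Qed.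

Lemma edge_inj K i j : (i < nb_edges K)%N -> (j < nb_edges K)%N ->
  first_edge (iter i (@turn R) K) = first_edge (iter j (@turn R) K) -> i = j.
Proof.
move=> hi hj h; apply/eqP; apply: contraT => ij.
have s01 : 0 < (2^-1 : R) < 1 by apply/andP; split; lra.
have := lam_edge hi hj ij s01.
by rewrite -param_first_edge h param_first_edge lam_loc /= ltxx.
Qed.

Lemma edges_uniq K : uniq (edges K).
Proof.
rewrite edgesE map_inj_in_uniq ?iota_uniq// => i j; rewrite !mem_iota !add0n /= => hi hj.
exact: edge_inj.
Qed.

Lemma edge_unique K e e1 s : e \in edges K -> e1 \in edges K -> 0 < s < 1 ->
  segment e1 (param e s) -> e1 = e.
Proof.
move=> /edgeP[i hi ->] /edgeP[j hj ->] s01 [s' _ h].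
have [->//|ij] := eqVneq i j; have := lam_edge hi hj ij s01.
by rewrite -param_first_edge -h param_first_edge lam_loc /= ltxx.
Qed.

Lemma edge_not_vertex K e s : e \in edges K -> 0 < s < 1 -> param e s \notin vertices K.
Proof.
move=> /edgeP[i hi ->] /andP[s0 s1]; rewrite param_first_edge (edge_posE _ hi); apply/negP.
have H z z' : (loc K z == loc K z') = (z == z') by rewrite (can_eq (@locK R K)).
move: hi; rewrite /vertices /nb_edges; case: (eshape K); case: i => [|[|[|[|i]]]]//= _;
rewrite !inE !H !xpair_eqE /=; repeat (case/orP); move=> /andP[/eqP h1 /eqP h2]; lra.
Qed.

Definition enormal e : plane R := (- (e.2 - e.1).2, (e.2 - e.1).1).

Lemma lam_line K x d t : lam K (x + t *: d) = lam K x + t * dot (elam K) d.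
Proof. by rewrite /lam /aff /dot /elam /= /GRing.scale /=; ring. Qed.

Lemma edge_in K i s d : (i < nb_edges K)%N -> 0 < s < 1 -> 0 < dot (elam (iter i (@turn R) K)) d ->
  \forall n \near \oo, eset K (loc (iter i (@turn R) K) (s, 0) + n.+1%:R^-1 *: d).
Proof.
move=> hi s01 hd; set x := loc _ _.
have H (j : 'I_(nb_edges K)) : \forall n \near \oo, 0 < lam (iter j (@turn R) K) (x + n.+1%:R^-1 *: d).
  have [ji|ij] := eqVneq i j.
    apply: nearW => n; rewrite lam_line -ji /x lam_loc /= add0r mulr_gt0//.
  have l0 : 0 < lam (iter j (@turn R) K) x by apply: lam_edge.
  have c : lam (iter j (@turn R) K) x + n.+1%:R^-1 * dot (elam (iter j (@turn R) K)) d @[n --> \oo] --> lam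
      (iter j (@turn R) K) x.
    rewrite -[X in _ --> X]addr0 -[X in _ --> _ + X](mul0r (dot (elam (iter j (@turn R) K)) d)).
    by apply: cvgD; [exact: cvg_cst|apply: cvgM; [exact: cvg_harmonic|exact: cvg_cst]].
  near=> n; rewrite lam_line; near: n; exact: (cvgr_gt _ c _ l0).
have H' : \forall n \near \oo, forall j : 'I_(nb_edges K), 0 < lam (iter j (@turn R) K) (x + n.+1%:R^-1 *: d)
    by apply: filter_forall; exact: H.
near=> n; have hn : forall j : 'I_(nb_edges K), 0 < lam (iter j (@turn R) K) (x + n.+1%:R^-1 *: d) by near: n.
apply/eset_lam => j hj; exact: (hn (Ordinal hj)).
Unshelve. all: by end_near. Qed.

Lemma edge_out K i s d t : (i < nb_edges K)%N -> dot (elam (iter i (@turn R) K)) d < 0 -> 0 < t ->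
  ~ closure (eset K) (loc (iter i (@turn R) K) (s, 0) + t *: d).
Proof.
move=> hi hd t0 /closure_lam/(_ i hi); rewrite lam_line lam_loc /= add0r.
by rewrite leNgt pmulr_rlt0// hd.
Qed.

Definition side e (b : bool) : plane R := if b then enormal e else - enormal e.

(** Across an edge its own coordinate changes sign, while those of the other
    edges are positive near an interior point of the edge. *)
Lemma edge_side K e e' s : e' \in edges K -> same_edge e' e -> 0 < s < 1 ->
  exists b, (\forall n \near \oo, eset K (param e s + n.+1%:R^-1 *: side e b)) /\
    forall t, 0 < t -> ~ closure (eset K) (param e s + t *: side e (~~ b)).
Proof.
move=> /edgeP[i hi ->]; set K' := iter i (@turn R) K => se s01.
have [s' s'01 ->] := same_edge_param se s01; rewrite param_first_edge.
have dn : dot (elam K') (enormal e) != 0.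
  have e0 : dot (edir1 K') (edir1 K') != 0 by rewrite -enorm_sqr expf_neq0// gt_eqF// enorm_edir.
  have d0 := cell_det_neq0 K'.
  have [h|h] : e.2 - e.1 = edir1 K' \/ e.2 - e.1 = - edir1 K'.
    move: se; rewrite /same_edge /first_edge => /orP[/eqP h|/eqP h].
      by left; rewrite -h /= addrC addKr.
    have h1 := congr1 fst h; have h2 := congr1 snd h; simpl in h1, h2.
    by right; rewrite -h1 -h2 opprD addrA subrr add0r.
  - rewrite (_ : dot _ _ = dot (edir1 K') (edir1 K') / cell_det K') ?mulf_neq0 ?invr_eq0//.
    by rewrite /dot /elam /enormal h /lamA /lamB /=; ring.
  - rewrite (_ : dot _ _ = - (dot (edir1 K') (edir1 K') / cell_det K')) ?oppr_eq0 ?mulf_neq0 ?invr_eq0//.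
    by rewrite /dot /elam /enormal h /lamA /lamB /=; ring.
have dN : dot (elam K') (- enormal e) = - dot (elam K') (enormal e) by rewrite /dot /=; ring.
exists (0 < dot (elam K') (enormal e)); case: ltrP => hd /=; split.
- exact: edge_in.
- by move=> t t0; apply: edge_out => //; rewrite dN oppr_lt0.
- by apply: edge_in => //; rewrite dN oppr_gt0 lt_neqAle dn.
- by move=> t t0; apply: edge_out => //; rewrite lt_neqAle dn.
Qed.

Lemma same_edge_seg e e' s : same_edge e' e -> 0 < s < 1 -> segment e' (param e s).
Proof.
move=> se s01; have [s' /andP[? ?] ->] := same_edge_param se s01.
by exists s' => //; rewrite /= in_itv /= !ltW.
Qed.

Lemma closure_param K e s : e \in edges K -> 0 <= s <= 1 -> closure (eset K) (param e s).
Proof.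
move=> /edgeP[i hi ->] s01; rewrite param_first_edge -(eset_iter_turn i K); exact: closure_edge.
Qed.

(** Small steps from a point of an interior edge to the side away from the cell
    stay in the domain, which the closed cells cover; so a second closed cell
    contains the point. As there are no hanging nodes it has the edge in common.
    A third cell would lie on the same side as one of the two and meet it. *)
Lemma edge_two (Om : set (plane R)) (T : mesh R) k e s : open Om -> partition_of Om T -> no_hanging_nodes T ->
  e \in edges (cell T k) -> 0 < s < 1 -> ~ bdry Om (param e s) ->
  exists l e1, [/\ k != l, e1 \in edges (cell T l), same_edge e1 e &
    forall m e', e' \in edges (cell T m) -> same_edge e' e -> (m = k /\ e' = e) \/ (m = l /\ e' = e1)].
Proof.
move=> oO [h1 h2 h3] nh he s01 nb; set x := param e s.
have see : same_edge e e by rewrite /same_edge eqxx.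
have [b [b1 b2]] := edge_side he see s01.
have s01' : 0 <= s <= 1 by case/andP: s01 => ? ?; rewrite !ltW.
have ckx : closure (eset (cell T k)) x by exact: closure_param.
have Ox : Om x.
  have : closure Om x by rewrite h3; exists k.
  by move=> cx; apply: contrapT => nx; apply: nb; split => // /interior_subset.
have tcvg d : x + n.+1%:R^-1 *: d @[n --> \oo] --> x.
  have c : n.+1%:R^-1 *: d @[n --> \oo] --> 0 *: d by apply: cvgZr_tmp; exact: cvg_harmonic.
  by have := cvgD (cvg_cst x) c; rewrite scale0r addr0; exact.
have [l kl clx] : exists2 l, k != l & closure (eset (cell T l)) x.
  apply: contrapT => nl.
  have H (l : 'I_(ncells T)) : \forall n \near \oo, ~ closure (eset (cell T l)) (x + n.+1%:R^-1 *: side e (~~ b)).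
    have [<-|kl] := eqVneq k l; first by apply: nearW => n; apply: b2.
    have nx : ~ closure (eset (cell T l)) x by move=> cx; apply: nl; exists l.
    have oC : nbhs x (~` closure (eset (cell T l))).
      by apply: open_nbhs_nbhs; split => //; apply: closed_openC; exact: closed_closure.
    exact: (tcvg (side e (~~ b)) (~` closure (eset (cell T l))) oC).
  have HO : \forall n \near \oo, Om (x + n.+1%:R^-1 *: side e (~~ b)).
    have oN : nbhs x Om by exact: open_nbhs_nbhs.
    exact: (tcvg (side e (~~ b)) _ oN).
  have H' : \forall n \near \oo, forall l : 'I_(ncells T), ~ closure (eset (cell T l)) (x + n.+1%:R^-1 *: side e
      (~~ b)) by apply: filter_forall; exact: H.
  have [n [hn On]] := @filter_ex _ \oo _ _ (filterI H' HO).
  have : closure Om (x + n.+1%:R^-1 *: side e (~~ b)) by exact: subset_closure.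
  by rewrite h3 => -[m _]; exact: hn.
have [e1 he1 se1] : exists2 e1, e1 \in edges (cell T l) & same_edge e1 e.
  case: (nh _ _ kl) => [S0|[z [zk zl Sz]]|[ek [el [hk hl se S]]]].
  - by have : (set0 : set (plane R)) x by rewrite -S0.
  - have : [set z] x by rewrite -Sz.
    by move=> xz; have := edge_not_vertex he s01; rewrite -/x xz zk.
  - have sx : segment ek x by rewrite -S.
    by rewrite (edge_unique he hk s01 sx) in se; exists el => //; rewrite same_edgeC.
exists l, e1; split => //.
(* two cells on the same side of a common edge would overlap *)
have sameside m e' m' e'' c : e' \in edges (cell T m) -> e'' \in edges (cell T m') ->
    same_edge e' e -> same_edge e'' e ->
    (\forall n \near \oo, eset (cell T m) (x + n.+1%:R^-1 *: side e c)) ->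
    (\forall n \near \oo, eset (cell T m') (x + n.+1%:R^-1 *: side e c)) -> m = m' /\ e' = e''.
  move=> he' he'' s' s'' n1 n2.
  have mm : m = m'.
    apply/eqP; apply: contraT => mm; have [n [c1 c2]] := @filter_ex _ \oo _ _ (filterI n1 n2).
    by have : (set0 : set (plane R)) (x + n.+1%:R^-1 *: side e c) by rewrite -(h2 _ _ mm).
  split => //; subst m'; have [s0 s001 xE] := same_edge_param s'' s01.
  by apply: (edge_unique he'' he' s001); rewrite -xE; exact: same_edge_seg.
have [c [c1 c2]] := edge_side he1 se1 s01.
have cb : c = ~~ b.
  case: (eqVneq c b) => [cb|]; last by case: c b {b1 b2 c1 c2} => -[].
  rewrite cb in c1; have [] := sameside _ _ _ _ _ he he1 see se1 b1 c1.
  by move=> kl'; rewrite kl' eqxx in kl.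
move=> m e' he' se'; have [c' [c1' c2']] := edge_side he' se' s01.
have [cb'|cb'] := eqVneq c' b.
  by left; apply: sameside he' he se' see _ b1; rewrite -cb'.
right; apply: sameside he' he1 se' se1 c1' _.
by rewrite (_ : c' = c)//; move: cb' cb; case: (c'); case: (b) => //= _ ->.
Qed.

Lemma sum_two (T : mesh R) (F : forall k : 'I_(ncells T), edge R -> R) k l e e1 :
  k != l -> e \in edges (cell T k) -> e1 \in edges (cell T l) -> same_edge e1 e ->
  (forall m e', e' \in edges (cell T m) -> same_edge e' e -> (m = k /\ e' = e) \/ (m = l /\ e' = e1)) ->
  \sum_m \sum_(e' <- edges (cell T m) | same_edge e' e) F m e' = F k e + F l e1.
Proof.
move=> kl he he1 se1 H.
have one m e' : e' \in edges (cell T m) -> same_edge e' e ->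
  (forall e'', e'' \in edges (cell T m) -> same_edge e'' e -> e'' = e') ->
  \sum_(e'' <- edges (cell T m) | same_edge e'' e) F m e'' = F m e'.
  move=> he' se' U; rewrite big_mkcond (bigD1_seq e')//= ?edges_uniq// se'.
  rewrite big_seq_cond big1 ?addr0// => e'' /andP[he'' ne]; case: ifP => // se''.
  by rewrite (U _ he'' se'') eqxx in ne.
have see : same_edge e e by rewrite /same_edge eqxx.
rewrite (bigD1 k)//= (bigD1 l)/=; last by rewrite eq_sym.
rewrite (one k e)//; last first.
  by move=> e'' h1 h2; case: (H _ _ h1 h2) => -[//]; move=> kl'; rewrite kl' eqxx in kl.
rewrite (one l e1)//; last first.
  by move=> e'' h1 h2; case: (H _ _ h1 h2) => -[//]; move=> kl'; rewrite -kl' eqxx in kl.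
rewrite big1 ?addr0// => m /andP[mk ml]; rewrite big_seq_cond big1// => e' /andP[h1' h2'].
case: (H _ _ h1' h2') => -[mm _]; first by rewrite mm eqxx in mk.
by rewrite mm eqxx in ml.
Qed.

End Edges.

(** * Green's formula on a cell *)

Section L2lim.
Context d (T : measurableType d) (R : realType).
Variables (mu : {measure set T -> \bar R}) (D : set T).
Hypothesis mD : measurable D.

Lemma Rint_cvg_L2 (G F : T -> R) (f : nat -> T -> R) : sqint mu D G -> sqint mu D F ->
  (forall n, sqint mu D (f n)) -> nrm mu D (fun x => f n x - F x) @[n --> \oo] --> (0 : R) ->
  \int[mu]_(x in D) (G x * f n x) @[n --> \oo] --> \int[mu]_(x in D) (G x * F x).
Proof.
move=> sG sF sf cf.
have h n : `|\int[mu]_(x in D) (G x * f n x) - \int[mu]_(x in D) (G x * F x)| <= nrm mu D G * nrm mu D (fun x =>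
    f n x - F x).
  have i1 := sqint_mul mD sG (sf n); have i2 := sqint_mul mD sG sF.
  rewrite -(RintegralB mD i1 i2) (@Rint_ext _ _ _ _ _ _ (fun x => G x * (f n x - F x))); last by move=> x _;
      rewrite mulrBr.
  exact: (cauchy_schwarz mD sG (sqintB mD (sf n) sF)).
set l := \int[mu]_(x in D) (G x * F x) in h *; set a := fun n => \int[mu]_(x in D) (G x * f n x).
have z : nrm mu D G * nrm mu D (fun x => f n x - F x) @[n --> \oo] --> (0 : R).
  by rewrite -[X in _ --> X](mulr0 (nrm mu D G)); apply: cvgM => //; exact: cvg_cst.
have dd : `|a n - l| @[n --> \oo] --> (0 : R) by apply: cvg0_le z => n; rewrite normr_ge0 h.
have e : a n - l @[n --> \oo] --> (0 : R) by apply/norm_cvg0P.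
have -> : a = (fun n => (a n - l) + l) by apply/funext => n; rewrite subrK.
by rewrite -[X in _ --> X]add0r; apply: cvgD => //; exact: cvg_cst.
Qed.
End L2lim.

Section SumCS.
Variable R : realType.
Lemma cauchy_schwarz_sum I (s : seq I) (a b : I -> R) : (forall i, 0 <= a i) -> (forall i, 0 <= b i) ->
  \sum_(i <- s) a i * b i <= Num.sqrt (\sum_(i <- s) a i ^+ 2) * Num.sqrt (\sum_(i <- s) b i ^+ 2).
Proof.
move=> a0 b0; elim: s => [|i s IH]; first by rewrite !big_nil sqrtr0 mul0r.
rewrite !big_cons.
have s0 (c : I -> R) : 0 <= \sum_(j <- s) c j ^+ 2 by rewrite sumr_ge0// => j _; exact: sqr_ge0.
have := @cauchy_schwarz2 R 1 1 (a i) (Num.sqrt (\sum_(j <- s) a j ^+ 2)) (b i) (Num.sqrt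
    (\sum_(j <- s) b j ^+ 2)) ler01 ler01.
by rewrite !mul1r !sqr_sqrtr//; apply: le_trans; rewrite lerD2l.
Qed.
End SumCS.

Section Reflect.
Variable R : realType.

Lemma Rint_reverse (h : R -> R) : intg (@lb1 R) `[0, 1] h ->
  intg (@lb1 R) `[0, 1] (fun s => h (1 - s)) /\
  \int[@lb1 R]_(s in `[0, 1]) h (1 - s) = \int[@lb1 R]_(s in `[0, 1]) h s.
Proof.
move=> ih; pose H : R -> \bar R := (EFin \o h) \_ `[0, 1]%classic.
have m01 : @measurable _ (measurableTypeR R) `[0, 1]%classic by exact: measurable_itv.
have iH : (@lb1 R).-integrable setT H := (integrable_mkcond (mu := @lb1 R) _ m01).1 ih.
have mH : measurable_fun setT H by exact: measurable_int iH.
pose r (s : R) : R := -1 * s + 1.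
have HE : H \o r = (EFin \o (fun s => h (1 - s))) \_ `[0, 1]%classic.
  apply/funext => s; rewrite /H /r /= /patch.
  have -> : -1 * s + 1 = 1 - s by ring.
  rewrite !mem_setE !in_itv /= subr_ge0 gerBl andbC; by case: ifP.
have n1 : (-1 : R) != 0 by rewrite oppr_eq0 oner_neq0.
have mr : measurable_fun setT r.
  by apply: measurable_funD => //; exact: measurable_funM.
have A (g : R -> \bar R) : measurable_fun setT g -> (forall x, (0 <= g x)%E) ->
   (\int[@lb1 R]_x g x = \int[@lb1 R]_t (g \o r) t)%E.
  by move=> mg g0; rewrite (@integral_affine1 R (-1) 1 g n1 mg g0) normrN1 mul1e.
have iHr : (@lb1 R).-integrable setT (H \o r).
  apply/integrableP; split; first exact: measurableT_comp.
  have /integrableP[_] := iH; rewrite (A (fun x => `|H x|)%E) //.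
  by apply: measurableT_comp.
split.
  by apply: (integrable_mkcond (mu := @lb1 R) _ m01).2; rewrite -HE.
rewrite /Rintegral; congr fine; rewrite [LHS]integral_mkcond [RHS]integral_mkcond -HE -/H.
have Ap := A _ (measurable_funepos mH) (fun x => funepos_ge0 H x).
have An := A _ (measurable_funeneg mH) (fun x => funeneg_ge0 H x).
rewrite [LHS]integralE [RHS]integralE Ap An;
congr (_ - _)%E; apply: eq_integral => x _; by rewrite ?funeposE ?funenegE /comp; rewrite ?funeposE ?funenegE.
Qed.

End Reflect.

Section Cell.
Variable R : realType.
Implicit Types (K : element R) (x y z : plane R) (e : edge R).
Local Notation sq := (sqint (@lb2 R)).
Local Notation nrm2 := (nrm (@lb2 R)).
Local Notation aeD D P := (all_ae (@lb2 R) (fun x => D x -> P x)).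
Local Notation ccont K F := {within closure (eset K), continuous F}.

Definition vcont K (S : plane R -> plane R) := ccont K (fun x => (S x).1) /\ ccont K (fun x => (S x).2).

Lemma cont_sq K (F : plane R -> R) : ccont K F -> sq (eset K) F.
Proof.
move=> cF; have [M M0 hM] := cont_bound cF.
apply: (sqint_bd (@eset_mble R K) (eset_fin K) (M := M)); first exact: cont_meas_eset.
by move=> x Kx; apply: hM; exact: subset_closure.
Qed.

Lemma edge_continuous K (F : plane R -> R) e : e \in edges K -> ccont K F ->
  {within `[0, 1]%classic, continuous (fun s : R => F (param e s))}.
Proof.
move=> /edgeP[i hi ->] cF.
rewrite (_ : (fun s => _) = fun s => F (loc (iter i (@turn R) K) (s, 0))); last by apply/funext => s;
    rewrite param_first_edge.
by apply: edge_cont; rewrite eset_iter_turn.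
Qed.

Lemma edge_cont_sq K (F : plane R -> R) e : e \in edges K -> ccont K F ->
  sqint (@lb1 R) `[0, 1] (fun s => F (param e s)).
Proof.
move=> he cF; have c := edge_continuous he cF.
have [M [_ hM]] := compact_bounded (continuous_compact c (@segment_compact R 0 1)).
apply: (sqint_bd _ (itv01_fin R) (M := `|M| + 1)) => //.
  by apply: subspace_continuous_measurable_fun => //.
move=> s hs; apply: (hM (`|M| + 1)); last by exists s.
by rewrite (le_lt_trans (ler_norm _))// ltrDl.
Qed.

Lemma dot_ccont K S (v : plane R) : vcont K S -> ccont K (fun x => dot (S x) v).
Proof.
move=> [c1 c2] x; apply: cvgD; apply: cvgM; [exact: c1|exact: cvg_cst|exact: c2|exact: cvg_cst].
Qed.

(** The limit of [green_smooth]: the volume terms converge by convergence in [H^1],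
    the edge terms by convergence of the boundary values. *)
Lemma green_cell K (S : plane R -> plane R) (D w tau : plane R -> R) (g : plane R -> plane R)
   (phi : nat -> plane R -> R) : vcont K S -> sq (eset K) D ->
  (forall psi, test_fun (eset K) psi ->
     \int[@lb2 R]_(x in eset K) dot (S x) (cgrad psi x) =
     - \int[@lb2 R]_(x in eset K) (D x * psi x)) ->
  (forall n, smooth (phi n)) -> sq (eset K) w -> vsq (eset K) g -> H1cvg (eset K) phi w g ->
  (forall e, e \in edges K -> sqint (@lb1 R) `[0, 1] (fun s => tau (param e s)) /\
           nrm (@lb1 R) `[0, 1] (fun s => phi n (param e s) - tau (param e s)) @[n --> \oo] --> (0 : R)) ->
  \int[@lb2 R]_(x in eset K) (dot (S x) (g x) + D x * w x) =
  \sum_(e <- edges K) enorm (e.2 - e.1) *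
    \int[@lb1 R]_(s in `[0, 1]) (dot (S (param e s)) (onormal K e) * tau (param e s)).
Proof.
move=> [c1 c2] sD hdiv sp sw [sg1 sg2] [d0 d1 d2] htau; have mK := @eset_mble R K.
have sS1 := cont_sq c1; have sS2 := cont_sq c2.
have sO f : smooth f -> sq (eset K) f by move=> sf; apply/L2E/L2_smooth => //; exact: eset_bounded.
have iD : intg (@lb2 R) (eset K) D by exact: (sqint_int mK (eset_fin K)).
have split3 f0 f1 f2 : sq (eset K) f0 -> sq (eset K) f1 -> sq (eset K) f2 ->
  \int[@lb2 R]_(x in eset K) ((S x).1 * f1 x + (S x).2 * f2 x + D x * f0 x) =
  \int[@lb2 R]_(x in eset K) ((S x).1 * f1 x) + \int[@lb2 R]_(x in eset K) ((S x).2 * f2 x) +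
  \int[@lb2 R]_(x in eset K) (D x * f0 x).
  move=> s0 s1 s2; have i0 := sqint_mul mK sD s0; have i1 := sqint_mul mK sS1 s1; have i2 := sqint_mul mK sS2 s2.
  by rewrite RintegralD//; [rewrite RintegralD|exact: intD].
have cL : \int[@lb2 R]_(x in eset K) (dot (S x) (cgrad (phi n) x) + D x * phi n x) @[n --> \oo] -->
  \int[@lb2 R]_(x in eset K) (dot (S x) (g x) + D x * w x).
  rewrite (split3 w (fun x => (g x).1) (fun x => (g x).2))//.
  have -> : (fun n => \int[@lb2 R]_(x in eset K) (dot (S x) (cgrad (phi n) x) + D x * phi n x)) =
    (fun n => \int[@lb2 R]_(x in eset K) ((S x).1 * (cgrad (phi n) x).1) + \int[@lb2 R]_(x in eset K) ((S x).2 *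
        (cgrad (phi n) x).2) +
       \int[@lb2 R]_(x in eset K) (D x * phi n x)).
    by apply/funext => n; rewrite -(split3 _ _ _ (sO _ (sp n)) (sO _ (smooth_cgrad1 (sp n))) (sO _
        (smooth_cgrad2 (sp n)))).
  apply: cvgD; first apply: cvgD.
  - by apply: (Rint_cvg_L2 mK sS1 sg1 (fun n => sO _ (smooth_cgrad1 (sp n)))).
  - by apply: (Rint_cvg_L2 mK sS2 sg2 (fun n => sO _ (smooth_cgrad2 (sp n)))).
  - by apply: (Rint_cvg_L2 mK sD sw (fun n => sO _ (sp n))).
have cR : \sum_(e <- edges K) enorm (e.2 - e.1) *
    \int[@lb1 R]_(s in `[0, 1]) (dot (S (param e s)) (onormal K e) * phi n (param e s)) @[n --> \oo] -->
  \sum_(e <- edges K) enorm (e.2 - e.1) *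
    \int[@lb1 R]_(s in `[0, 1]) (dot (S (param e s)) (onormal K e) * tau (param e s)).
  have -> : (fun n => \sum_(e <- edges K) enorm (e.2 - e.1) * \int[@lb1 R]_(s in `[0, 1]) (dot (S (param e s))
      (onormal K e) * phi n (param e s))) =
    (fun n => \sum_(e <- edges K) (if e \in edges K then enorm (e.2 - e.1) * \int[@lb1 R]_(s in `[0, 1]) (dot (S
        (param e s)) (onormal K e) * phi n (param e s)) else 0)).
    by apply/funext => n; rewrite big_seq [RHS]big_seq; apply: eq_bigr => e ->.
  rewrite (_ : \sum_(e <- edges K) _ = \sum_(e <- edges K) (if e \in edges K then enorm
      (e.2 - e.1) * \int[@lb1 R]_(s in `[0, 1]) (dot (S (param e s)) (onormal K e) * tau (param e s)) else 0));
      last first.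
    by rewrite big_seq [RHS]big_seq; apply: eq_bigr => e ->.
  apply: cvg_sum_seq => e; case he : (e \in edges K); last exact: cvg_cst.
  have [st ct] := htau e he; apply: cvgM; first exact: cvg_cst.
  have m01 : @measurable _ (measurableTypeR R) `[0, 1]%classic by exact: measurable_itv.
  have H := (@Rint_cvg_L2 _ _ _ (@lb1 R) `[0, 1]%classic m01 _ (fun s => tau (param e s)) (fun n s => phi n (param e s))
    (edge_cont_sq he (@dot_ccont K S (onormal K e) (conj c1 c2))) st (fun n => param_sqint e (sp n)) ct).
  exact: H.
have E n := green_smooth c1 c2 iD hdiv (sp n).
have cL' : \sum_(e <- edges K) enorm (e.2 - e.1) *
    \int[@lb1 R]_(s in `[0, 1]) (dot (S (param e s)) (onormal K e) * phi n (param e s)) @[n --> \oo] -->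
   \int[@lb2 R]_(x in eset K) (dot (S x) (g x) + D x * w x).
  by apply: cvg_trans cL; apply: near_eq_cvg; apply: nearW => n; rewrite E.
exact: (cvg_unique _ cL' cR).
Qed.

Lemma vtraceE K (S sigma : plane R -> plane R) x : vcont K S ->
  (forall y, eset K y -> sigma y = S y) -> closure (eset K) x -> vtrace K sigma x = S x.
Proof.
move=> [c1 c2] hS cx.
have pf : ProperFilter (within (eset K) (nbhs x)) by exact: within_nbhs_proper.
have H (p : plane R -> R) (q : plane R -> R) : ccont K q -> (forall y, eset K y -> p y = q y) ->
   lim (p y @[y --> within (eset K) (nbhs x)]) = q x.
  move=> /subspace_continuousP/(_ x cx) cq hp; apply: cvg_lim => //.
  suff : p y @[y --> within (eset K) (nbhs x)] --> q x by [].
    move=> P /cq hP; have {}hP : nbhs x (fun y => closure (eset K) y -> P (q y)) := hP.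
    suff : nbhs x (fun y => eset K y -> P (p y)) by [].
    by apply: filterS hP => y h Ky; rewrite hp//; apply: h; exact: subset_closure.
apply: plane_eq.
  by apply: (H (fun y => (sigma y).1) (fun y => (S y).1) c1) => y Ky; rewrite hS.
by apply: (H (fun y => (sigma y).2) (fun y => (S y).2) c2) => y Ky; rewrite hS.
Qed.

Lemma hK_gt0 K : 0 < hK K.
Proof.
have [M M0 hM] := bounded_coords (@eset_bounded R K).
have [c Kc] := eset_point K.
have e1 : eset K (loc K (3^-1, 3^-1)).
  by apply/eset_loc; rewrite /refcell; case: (eshape K) => /=; split; try split; lra.
have e2 : eset K (loc K (2^-1, 3^-1)).
  by apply/eset_loc; rewrite /refcell; case: (eshape K) => /=; split; try split; lra.
have p : 0 < enorm (loc K (3^-1, 3^-1) - loc K (2^-1, 3^-1)).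
  rewrite lt_def enorm_ge0 andbT; apply/eqP => /enorm_eq0/eqP; rewrite subr_eq0 (can_eq (@locK R K)) xpair_eqE =>
      /andP[/eqP h _]; lra.
apply: lt_le_trans p _; apply: sup_upper_bound; last by exists (loc K (3^-1, 3^-1)) => //; exists (loc K (2^-1, 3^-1)).
split; first by do 2 eexists; [exact: e1|exists (loc K (2^-1, 3^-1))].
exists (2 * M + 2 * M) => _ [x Kx [y Ky <-]]; have [x1 x2] := hM _ Kx; have [y1 y2] := hM _ Ky.
have l1 : `|(x - y).1| <= 2 * M by have := ler_normB x.1 y.1; move=> h /=; lra.
have l2 : `|(x - y).2| <= 2 * M by have := ler_normB x.2 y.2; move=> h /=; lra.
have M20 : 0 <= 2 * M + 2 * M by lra.
rewrite -[leRHS](ger0_norm M20) -sqrtr_sqr ler_wsqrtr//.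
have s1 : (x - y).1 ^+ 2 <= (2 * M) ^+ 2 by rewrite -(real_normK (num_real (x - y).1)) lerXn2r// nnegrE; lra.
have s2 : (x - y).2 ^+ 2 <= (2 * M) ^+ 2 by rewrite -(real_normK (num_real (x - y).2)) lerXn2r// nnegrE; lra.
have -> : dot (x - y) (x - y) = (x - y).1 ^+ 2 + (x - y).2 ^+ 2 by rewrite /dot !expr2.
have -> : (2 * M + 2 * M) ^+ 2 = (2 * M) ^+ 2 + (2 * M) ^+ 2 + 2 * (2 * M) ^+ 2 by ring.
by apply: (le_trans (lerD s1 s2)); rewrite lerDl mulr_ge0// sqr_ge0.
Qed.

Lemma gammaK_gt0 (a2 b2 : R) K : 0 < a2 -> 0 <= b2 -> 0 < gammaK a2 b2 K.
Proof.
move=> a20 b20; have h : 0 < a2^-1 * hK K ^+ 2 by rewrite mulr_gt0 ?invr_gt0// exprn_gt0// hK_gt0.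
rewrite /gammaK; case: ifPn => // b2n; rewrite lt_min h invr_gt0 lt_def b2n b20 //.
Qed.

End Cell.

(** * From edge fluxes to jumps *)

Section Jump.
Variable R : realType.
Implicit Types (x y z : plane R) (e : edge R).

Definition edge_integral e (h : plane R -> R) : R :=
  enorm (e.2 - e.1) * \int[@lb1 R]_(s in `[0, 1]) h (param e s).

Lemma edge_integral_same e e' h : same_edge e' e -> intg (@lb1 R) `[0, 1] (fun s => h (param e' s)) ->
  intg (@lb1 R) `[0, 1] (fun s => h (param e s)) /\ edge_integral e h = edge_integral e' h.
Proof.
rewrite same_edgeC => /orP[/eqP ->//|/eqP -> ih].
have [i1 e1] := Rint_reverse ih.
have E : (fun s => h (param (e'.2, e'.1) s)) = (fun s => h (param e' (1 - s))) by apply/funext => s; rewrite param_rev.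
split; first by rewrite E.
rewrite /edge_integral /= E e1; congr (_ * _).
by rewrite /enorm /dot /=; congr Num.sqrt; ring.
Qed.

Lemma edge_integral_eq0 e h : intg (@lb1 R) `[0, 1] (fun s => h (param e s)) ->
  (forall s, 0 < s < 1 -> h (param e s) = 0) -> edge_integral e h = 0.
Proof.
move=> ih h0; rewrite /edge_integral.
have i2 : intg (@lb1 R) `]0, 1] (fun s => h (param e s)).
  by apply: integrableS ih => //; [exact: subset_itv_oc_cc].
have i3 : intg (@lb1 R) `]0, 1[ (fun s => h (param e s)).
  by apply: integrableS ih => //; [exact: subset_itv_oo_cc].
rewrite -(@Rintegral_itv_obnd_cbnd R 0 (BRight 1) _ i2) -(@Rintegral_itv_bndo_bndc R (BRight 0) 1 _ i3).
rewrite (@Rint_ext _ _ _ (@lb1 R) _ _ (fun=> 0)); last by move=> s; rewrite /= in_itv /=; exact: h0.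
by rewrite /Rintegral integral0 mulr0.
Qed.

Lemma exchange_edges (T : mesh R) (P : rel (edge R)) (G : forall m : 'I_(ncells T), edge R -> R) :
  \sum_k \sum_(e <- edges (cell T k)) \sum_m \sum_(e' <- edges (cell T m) | P e' e) G m e' =
  \sum_m \sum_(e' <- edges (cell T m)) \sum_k \sum_(e <- edges (cell T k) | P e' e) G m e'.
Proof.
transitivity (\sum_k \sum_m \sum_(e <- edges (cell T k)) \sum_(e' <- edges (cell T m)) if P e' e then G m e' else 0).
  apply: eq_bigr => k _; rewrite exchange_big /=; apply: eq_bigr => m _.
  by apply: eq_bigr => e _; rewrite big_mkcond.
rewrite exchange_big /=; apply: eq_bigr => m _.
transitivity (\sum_k \sum_(e' <- edges (cell T m)) \sum_(e <- edges (cell T k)) if P e' e then G m e' else 0).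
  by apply: eq_bigr => k _; rewrite exchange_big.
rewrite exchange_big /=; apply: eq_bigr => e' _; apply: eq_bigr => k _.
by rewrite [RHS]big_mkcond.
Qed.

Variables (Om : set (plane R)) (T : mesh R) (S : 'I_(ncells T) -> plane R -> plane R) (tau : plane R -> R).
Hypotheses (oO : open Om) (hp : partition_of Om T) (nh : no_hanging_nodes T).
Hypothesis hS : forall k, vcont (cell T k) (S k).
Hypothesis tau0 : forall x, bdry Om x -> tau x = 0.
Hypothesis stau : forall k e, e \in edges (cell T k) -> sqint (@lb1 R) `[0, 1] (fun s => tau (param e s)).

Definition normal_comp k e x : R := dot (S k x) (onormal (cell T k) e).
Definition jump_ext e x : R := \sum_(m < ncells T) \sum_(e' <- edges (cell T m) | same_edge e' e) normal_comp m e' x.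

Lemma normal_comp_sq m e e' : e' \in edges (cell T m) -> same_edge e' e ->
  sqint (@lb1 R) `[0, 1] (fun s => normal_comp m e' (param e s)).
Proof.
move=> he' se.
have s' := edge_cont_sq he' (@dot_ccont R (cell T m) (S m) (onormal (cell T m) e') (hS m)).
have m01 : @measurable _ (measurableTypeR R) `[0, 1]%classic by exact: measurable_itv.
move: se; rewrite same_edgeC => /orP[/eqP ->//|/eqP ->].
have [mh ih] := s'.
have E : (fun s => normal_comp m e' (param (e'.2, e'.1) s)) = (fun s => normal_comp m e' (param e' (1 - s))).
  by apply/funext => s; rewrite param_rev.
have [i1 _] := Rint_reverse (sqint_int m01 (itv01_fin R) s').
have [i2 _] := Rint_reverse ih.
by rewrite E; split; [exact: int_meas i1|exact: i2].
Qed.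

Lemma jump_ext_sq e : sqint (@lb1 R) `[0, 1] (fun s => jump_ext e (param e s)).
Proof.
have m01 : @measurable _ (measurableTypeR R) `[0, 1]%classic by exact: measurable_itv.
rewrite /jump_ext; elim: (index_enum _) => [|m s IH].
  by rewrite (_ : (fun s => _) = fun=> 0); [exact: sqint0|apply/funext => s; rewrite big_nil].
rewrite (_ : (fun s => _) = fun t => \sum_(e' <- edges (cell T m) | same_edge e' e) normal_comp m e' (param e t) +
   \sum_(m <- s) \sum_(e' <- edges (cell T m) | same_edge e' e) normal_comp m e' (param e t)); last first.
  by apply/funext => t; rewrite big_cons.
apply: (sqintD m01) IH => {s}.
have : {subset edges (cell T m) <= edges (cell T m)} by [].
elim: {1 3}(edges (cell T m)) => [_|e' s IH H].
  by rewrite (_ : (fun s => _) = fun=> 0); [exact: sqint0|apply/funext => s; rewrite big_nil].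
have IH' := IH (fun e0 he0 => H e0 (mem_behead (s := e' :: s) he0)).
have [se|nse] := boolP (same_edge e' e); last first.
  rewrite (_ : (fun s => _) = fun t => \sum_(e' <- s | same_edge e' e) normal_comp m e' (param e t))//.
  by apply/funext => t; rewrite big_cons (negbTE nse).
rewrite (_ : (fun s => _) = fun t => normal_comp m e' (param e t)
    + \sum_(e' <- s | same_edge e' e) normal_comp m e' (param e t)).
  by apply: (sqintD m01) IH'; apply: normal_comp_sq => //; apply: H; rewrite mem_head.
by apply/funext => t; rewrite big_cons se.
Qed.

Lemma ntau_int m e : e \in edges (cell T m) -> intg (@lb1 R) `[0, 1] (fun s => normal_comp m e (param e s) * tau
    (param e s)).
Proof.
move=> he; have m01 : @measurable _ (measurableTypeR R) `[0, 1]%classic by exact: measurable_itv.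
by apply: (sqint_mul m01); [apply: normal_comp_sq => //; rewrite /same_edge eqxx|exact: stau he].
Qed.

Lemma edge_integral_jump k e : e \in edges (cell T k) ->
  edge_integral e (fun x => jump_ext e x * tau x) =
  \sum_m \sum_(e' <- edges (cell T m) | same_edge e' e) edge_integral e' (fun x => normal_comp m e' x * tau x).
Proof.
move=> he; have m01 : @measurable _ (measurableTypeR R) `[0, 1]%classic by exact: measurable_itv.
pose h m e' s := if (e' \in edges (cell T m)) && same_edge e' e then normal_comp m e' (param e s) * tau
    (param e s) else 0.
have ih m e' : intg (@lb1 R) `[0, 1] (h m e').
  rewrite /h; case hse : (_ && _); first by case/andP: hse => he' se; have [] := @edge_integral_same e e'
      (fun x => normal_comp m e' x * tau x) se (ntau_int he').
  exact: (sqint_int m01 (itv01_fin R) (sqint0 _ m01)).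
have E s : jump_ext e (param e s) * tau (param e s) = \sum_m \sum_(e' <- edges (cell T m)) h m e' s.
  rewrite /jump_ext mulr_suml; apply: eq_bigr => m _; rewrite mulr_suml big_mkcond big_seq [RHS]big_seq.
  by apply: eq_bigr => e' he'; rewrite /h he' /=.
have -> : edge_integral e (fun x => jump_ext e x * tau x) = enorm (e.2 - e.1) * \int[@lb1 R]_(s in `[0,
    1]) \sum_m \sum_(e' <- edges (cell T m)) h m e' s.
  by rewrite /edge_integral; congr (_ * _); apply: Rint_ext => s _; exact: E.
rewrite (Rint_sum m01); last by move=> m; apply: (int_sum m01).
rewrite mulr_sumr; apply: eq_bigr => m _.
rewrite (Rint_sum m01)// mulr_sumr [RHS]big_mkcond big_seq [RHS]big_seq.
apply: eq_bigr => e' he'; rewrite /h he' /=; case: ifP => se.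
  by have [_ <-] := @edge_integral_same e e' (fun x => normal_comp m e' x * tau x) se (ntau_int he').
by rewrite /Rintegral integral0 mulr0.
Qed.

(** After exchange of the sums, the term of a cell and one of its edges appears in
    the jump once for each cell with this edge: twice inside the domain. On the
    boundary of the domain [tau] is zero. *)
Lemma jump_sum :
  \sum_k \sum_(e <- edges (cell T k)) edge_integral e (fun x => normal_comp k e x * tau x) =
  2^-1 * \sum_k \sum_(e <- edges (cell T k)) edge_integral e (fun x => jump_ext e x * tau x).
Proof.
pose c m e := edge_integral e (fun x => normal_comp m e x * tau x).
have E : \sum_k \sum_(e <- edges (cell T k)) edge_integral e (fun x => jump_ext e x * tau x) =
  \sum_k \sum_(e <- edges (cell T k)) \sum_m \sum_(e' <- edges (cell T m) | same_edge e' e) c m e'.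
  apply: eq_bigr => k _; rewrite big_seq [RHS]big_seq; apply: eq_bigr => e he; exact: edge_integral_jump he.
rewrite E (exchange_edges (fun e' e => same_edge e' e) c) mulr_sumr; apply: eq_bigr => m _.
rewrite mulr_sumr big_seq [RHS]big_seq; apply: eq_bigr => e he; rewrite -/(c m e).
have [[s s01 nb]|ns] := pselect (exists2 s, 0 < s < 1 & ~ bdry Om (param e s)).
  have [l [e1 [ml he1 se1 H]]] := edge_two oO hp nh he s01 nb.
  under eq_bigr do under eq_bigl do rewrite same_edgeC.
  rewrite (sum_two (fun _ _ => c m e) ml he he1 se1 H); lra.
have -> : c m e = 0.
  apply: (edge_integral_eq0 (ntau_int he)) => s s01; rewrite tau0 ?mulr0//.
  by apply: contrapT => nb; apply: ns; exists s.
by rewrite big1 ?mulr0// => k _; rewrite big1.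
Qed.

End Jump.

(** * The estimator in terms of continuous fluxes *)

Section Estim.
Variable R : realType.
Implicit Types (K : element R) (x y z : plane R) (e : edge R).
Local Notation sq := (sqint (@lb2 R)).
Local Notation nrm2 := (nrm (@lb2 R)).
Local Notation aeD D P := (all_ae (@lb2 R) (fun x => D x -> P x)).

Lemma flux_cont (Om : set (plane R)) (mu : plane R -> R -> R) K q :
  {within closure Om `*` [set t : R | 0 <= t], continuous (fun z : plane R * R => mu z.1 z.2)} ->
  eset K `<=` Om -> smooth q ->
  {within closure (eset K), continuous (fun x => mu x (enorm (cgrad q x)))}.
Proof.
move=> /subspace_continuousP cmu KO sq'; apply/subspace_continuousP => x cx.
have ce : enorm (cgrad q y) @[y --> x] --> enorm (cgrad q x).
  apply: (@continuous_comp _ _ _ (fun y => dot (cgrad q y) (cgrad q y)) (@Num.sqrt R)); last exact: sqrt_continuous.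
  have s1 := smooth_cgrad1 sq'; have s2 := smooth_cgrad2 sq'.
  have sd : smooth (fun y => dot (cgrad q y) (cgrad q y)) := smoothD (smoothM s1 s1) (smoothM s2 s2).
  exact: (smooth_cont sd).
have cOx : closure Om x by exact: (closure_subset KO).
have := cmu (x, enorm (cgrad q x)) (conj cOx (enorm_ge0 (cgrad q x))).
move=> c P /c hP; have {hP}[[A B] [/= hA hB] AB] : nbhs (x, enorm (cgrad q x))
   (fun z : plane R * R => (closure Om `*` [set t : R | 0 <= t]) z -> P (mu z.1 z.2)) := hP.
suff : nbhs x (fun y => closure (eset K) y -> P (mu y (enorm (cgrad q y)))) by [].
have hB' : nbhs x (fun y => B (enorm (cgrad q y))) := ce _ hB.
apply: filterS (filterI hA hB') => y [Ay By] cy; apply: (AB (y, enorm (cgrad q y))) => //.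
by split; [exact: (closure_subset KO)|exact: enorm_ge0].
Qed.

Lemma loc_test_int D f psi : mble D -> (forall C, compact C -> C `<=` D -> intg (@lb2 R) C f) ->
  test_fun D psi -> intg (@lb2 R) D (fun x => f x * psi x).
Proof.
move=> mD lf tp; have [M M0 hM] := test_bd tp; have [h [C [C1 C2 C3]]] := tp.
have [_ mC _] := compact_plane C1; have {}mC : mble C := mC.
apply/(int_supp (@lb2 R) mC mD C2); first by move=> x _ nC; rewrite C3// mulr0.
have i_f := lf _ C1 C2; apply: (int_dom mC _ _ (intZ mC M (int_abs i_f))).
  by apply: measurable_funM; [exact: int_meas i_f|exact: smooth_meas].
by move=> x _; rewrite normrM mulrC ler_wpM2r.
Qed.

Lemma is_div_uniq D sigma d d' : open D -> is_div D sigma d -> is_div D sigma d' ->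
  aeD D (fun x => d x = d' x).
Proof.
move=> oD [m1 l1 h1] [m2 l2 h2]; have mD := open_mble oD.
have {}l1 C : compact C -> C `<=` D -> intg (@lb2 R) C d by move=> *; apply/integrable_leb2; exact: l1.
have {}l2 C : compact C -> C `<=` D -> intg (@lb2 R) C d' by move=> *; apply/integrable_leb2; exact: l2.
have : aeD D (fun x => d x - d' x = 0).
  apply: fund_lemma => // [C cC CD|phi tp].
    have [_ mC _] := compact_plane cC; have {}mC : mble C := mC.
    by apply: (intB mC); [exact: l1|exact: l2].
  have i1 := loc_test_int mD l1 tp; have i2 := loc_test_int mD l2 tp.
  have -> : \int[@lb2 R]_(x in D) ((d x - d' x) * phi x) = \int[@lb2 R]_(x in D) (d x * phi x - d' x * phi x).
    by apply: Rint_ext => x _; rewrite mulrBl.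
  rewrite RintegralB//; apply/eqP; rewrite subr_eq0 -eqr_opp.
  by have := h1 _ tp; have := h2 _ tp; rewrite !lb2E => -> /eqP; rewrite eq_sym.
by apply: all_aeS => x h Dx; apply/eqP; rewrite -subr_eq0 h.
Qed.

(** The infimum is over a set with one element: two distributional divergences
    of a field agree almost everywhere. *)
Lemma residual_norm2E (a2 b2 L : R) mu f K v w d :
  measurable_fun (eset K : set (mplane R)) (fun x => f x (v x) + L ^+ 2 * opF a2 b2 w x) ->
  is_div (eset K) (flux mu v) d ->
  residual_norm2 a2 b2 L mu f K v w =
  (\int[@lb2 R]_(x in eset K) ((f x (v x) - d x + L ^+ 2 * opF a2 b2 w x) ^+ 2)%:E)%E.
Proof.
move=> mf hd; rewrite /residual_norm2 -[RHS]ereal_inf1; congr ereal_inf; apply/seteqP; split =>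
    [_ [d' hd' <-]|_ ->] /=; last first.
  by exists d => //; rewrite integral_leb2.
have mr d0 : is_div (eset K) (flux mu v) d0 -> measurable_fun (eset K : set (mplane R)) (fun x => ((f x
    (v x) - d0 x + L ^+ 2 * opF a2 b2 w x) ^+ 2)%:E).
  move=> [m0 _ _]; apply/measurable_EFinP; apply: measurable_funX.
  have -> : (fun x => f x (v x) - d0 x + L ^+ 2 * opF a2 b2 w x) = (fun x => (f x (v x)
      + L ^+ 2 * opF a2 b2 w x) - d0 x).
    by apply/funext => x; rewrite addrAC.
  by apply: measurable_funB => //.
rewrite integral_leb2; apply: ae_eq_integral => //; [exact: eset_mble|exact: mr|exact: mr|].
by apply: all_aeS (is_div_uniq (@eset_open R K) hd' hd) => x h Kx; rewrite h.
Qed.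

Lemma residual_ge0 (a2 b2 L : R) mu f K v w : (0 <= residual_norm2 a2 b2 L mu f K v w)%E.
Proof.
apply: le_ereal_inf_tmp => _ [d _ <-]; rewrite integral_leb2.
by apply: integral_ge0 => x _; rewrite lee_fin sqr_ge0.
Qed.

Lemma jump_norm2_ge0 Om (T : mesh R) K sigma : (0 <= jump_norm2 Om T K sigma)%E.
Proof.
apply: sume_ge0 => e _; apply: mule_ge0; first by rewrite lee_fin; exact: enorm_ge0.
by apply: integral_ge0 => s _; rewrite lee_fin; exact: sqr_ge0.
Qed.

Definition inner_params (Om : set (plane R)) e : set R := [set s | 0 <= s <= 1 /\ ~ bdry Om (param e s)].

Lemma inner_params_meas Om e : open Om -> @measurable _ (measurableTypeR R) (inner_params Om e).
Proof.
move=> oO; have -> : inner_params Om e = `[0, 1]%classic `&` (param e @^-1` (~` bdry Om)).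
  by apply/seteqP; split => s; rewrite /inner_params /= in_itv.
apply: measurableI; first exact: measurable_itv.
apply: open_measurable; apply: open_comp.
  by move=> s _; apply: cvgD; [exact: cvg_cst|apply: cvgZr_tmp; exact: cvg_id].
rewrite /bdry setDE setCI setCK; apply: openU; last exact: open_interior.
by apply: closed_openC; exact: closed_closure.
Qed.

Lemma inner_params_sub Om e : inner_params Om e `<=` `[0, 1]%classic.
Proof. by move=> s [h _]; rewrite /= in_itv. Qed.

Lemma jump_norm2E Om (T : mesh R) k sigma (S : 'I_(ncells T) -> plane R -> plane R) : open Om ->
  (forall k, vcont (cell T k) (S k)) -> (forall k x, eset (cell T k) x -> sigma x = S k x) ->
  jump_norm2 Om T (cell T k) sigma =
  (\sum_(e <- edges (cell T k)) enorm (e.2 - e.1) * nrm (@lb1 R) (inner_params Om e) (fun s => jump_ext S e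
      (param e s)) ^+ 2)%:E.
Proof.
move=> oO hS hsig; rewrite /jump_norm2 -sumEFin big_seq [RHS]big_seq; apply: eq_bigr => e he.
rewrite EFinM; congr (_ * _)%E; rewrite nrm_sqr.
have m0 := inner_params_meas e oO; have m01 : @measurable _ (measurableTypeR R) `[0, 1]%classic
    by exact: measurable_itv.
have [_ i0] : sqint (@lb1 R) (inner_params Om e) (fun s => jump_ext S e (param e s)).
  by apply: (sqint_sub m0 m01 (@inner_params_sub Om e)); exact: jump_ext_sq.
rewrite (Rint_fin m0 i0); apply: eq_integral => s; rewrite inE => -[s01 _].
congr (_ ^+ 2)%:E; rewrite /jump /jump_ext; apply: eq_bigr => m _.
rewrite big_seq_cond [RHS]big_seq_cond; apply: eq_bigr => e' /andP[he' se].
rewrite /normal_comp (vtraceE (hS m) (hsig m))//.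
have [->|->] : e = e' \/ e = (e'.2, e'.1).
  by move: se; rewrite same_edgeC => /orP[/eqP|/eqP]; [left|right].
  exact: closure_param.
rewrite param_rev; apply: (closure_param he').
by move: s01 => /andP[? ?]; apply/andP; split; lra.
Qed.

(** The trace vanishes where the edge lies in the boundary of the domain, so only
    the remaining part of the edge contributes. *)
Lemma edge_integral_bound Om (T : mesh R) k (S : 'I_(ncells T) -> plane R -> plane R) tau e : open Om ->
  (forall k, vcont (cell T k) (S k)) -> e \in edges (cell T k) ->
  (forall x, bdry Om x -> tau x = 0) -> sqint (@lb1 R) `[0, 1] (fun s => tau (param e s)) ->
  `|edge_integral e (fun x => jump_ext S e x * tau x)| <=
  (Num.sqrt (enorm (e.2 - e.1)) * nrm (@lb1 R) (inner_params Om e) (fun s => jump_ext S e (param e s))) *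
  (Num.sqrt (enorm (e.2 - e.1)) * nrm (@lb1 R) `[0, 1] (fun s => tau (param e s))).
Proof.
move=> oO hS he t0 st.
have m0 := inner_params_meas e oO; have m01 : @measurable _ (measurableTypeR R) `[0, 1]%classic
    by exact: measurable_itv.
rewrite mulrACA -expr2 sqr_sqrtr ?enorm_ge0// /edge_integral normrM (ger0_norm (enorm_ge0 _)).
apply: ler_wpM2l; first exact: enorm_ge0.
rewrite (Rint_supp (@lb1 R) (@inner_params_sub Om e)); last first.
  move=> s; rewrite /= in_itv /= => s01 ns; rewrite (t0 (param e s)) ?mulr0//.
  by apply: contrapT => nb; apply: ns.
have s1 := sqint_sub m0 m01 (@inner_params_sub Om e) (jump_ext_sq hS e).
have s2 := sqint_sub m0 m01 (@inner_params_sub Om e) st.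
apply: (le_trans (cauchy_schwarz m0 s1 s2)).
by apply: ler_wpM2l; [exact: nrm_ge0|exact: (nrm_sub m0 m01 (@inner_params_sub Om e) st)].
Qed.

(** The weights [g] and [g^-1] of the volume terms have the product [1]; those of
    the edge terms have the product [1/4], whose root is the factor [1/2]. *)
Lemma cauchy_schwarz_cell (a2 g rho w J t gw : R) : 0 < a2 -> 0 < g -> 0 <= rho -> 0 <= w -> 0 <= J -> 0 <= t ->
    0 <= gw ->
  rho * w + 2^-1 * (Num.sqrt J * t) <=
  Num.sqrt (g * rho ^+ 2 + 2^-1 * (Num.sqrt a2)^-1 * Num.sqrt g * J) *
  Num.sqrt (g^-1 * w ^+ 2 + a2 * gw ^+ 2 + 2^-1 * Num.sqrt a2 * (Num.sqrt g)^-1 * t ^+ 2).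
Proof.
move=> a20 g0 r0 w0 J0 t0 gw0.
have sa : 0 < Num.sqrt a2 by rewrite sqrtr_gt0.
have sg : 0 < Num.sqrt g by rewrite sqrtr_gt0.
pose c1 := 2^-1 * (Num.sqrt a2)^-1 * Num.sqrt g; pose c2 := 2^-1 * Num.sqrt a2 * (Num.sqrt g)^-1.
have c10 : 0 < c1 by rewrite !mulr_gt0 ?invr_gt0.
have c20 : 0 < c2 by rewrite !mulr_gt0 ?invr_gt0.
have c12 : Num.sqrt c1 * Num.sqrt c2 = 2^-1.
  rewrite -sqrtrM ?(ltW c10)// (_ : c1 * c2 = 2^-1 ^+ 2); first by rewrite sqrtr_sqr ger0_norm.
  by rewrite /c1 /c2; field; rewrite !gt_eqF.
have := @cauchy_schwarz2 R 1 1 (Num.sqrt g * rho) (Num.sqrt c1 * Num.sqrt J) ((Num.sqrt g)^-1 * w)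
    (Num.sqrt c2 * t) ler01 ler01.
rewrite !mul1r !exprMn exprVn !sqr_sqrtr ?(ltW g0) ?(ltW c10) ?(ltW c20)//.
have -> : Num.sqrt g * rho * ((Num.sqrt g)^-1 * w) = rho * w by field; rewrite gt_eqF.
have -> : Num.sqrt c1 * Num.sqrt J * (Num.sqrt c2 * t) = 2^-1 * (Num.sqrt J * t) by rewrite mulrACA c12.
move=> /le_trans; apply; apply: ler_wpM2l; first exact: sqrtr_ge0.
apply: ler_wsqrtr; rewrite -/c2 lerD2r lerDl; apply: mulr_ge0; [exact: ltW|exact: sqr_ge0].
Qed.

End Estim.

(** * The residual on a cell *)

Section CellIdentity.
Variable R : realType.
Implicit Types (K : element R) (x y z : plane R) (e : edge R).
Local Notation sq := (sqint (@lb2 R)).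
Local Notation nrm2 := (nrm (@lb2 R)).
Local Notation aeD D P := (all_ae (@lb2 R) (fun x => D x -> P x)).

(** The flux in terms of polynomials [q] and [qd] that represent the iterate and
    the increment on the cell; it is continuous up to the boundary of the cell. *)
Definition flux_ext (mu : plane R -> R -> R) (q qd : plane R -> R) (c : R) x : plane R :=
  mu x (enorm (cgrad q x)) *: cgrad q x + c *: cgrad qd x.

Lemma flux_ext_vcont Om mu K q qd c :
  {within closure Om `*` [set t : R | 0 <= t], continuous (fun z : plane R * R => mu z.1 z.2)} ->
  eset K `<=` Om -> smooth q -> smooth qd -> vcont K (flux_ext mu q qd c).
Proof.
move=> cmu KO sq' sqd; have cm := flux_cont cmu KO sq'.
have cs h : smooth h -> {within closure (eset K), continuous h}.
  by move=> sh; apply: continuous_subspaceT; exact: smooth_cont.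
split => x; apply: cvgD; apply: cvgM.
- exact: cm.
- exact: (cs _ (smooth_cgrad1 sq')).
- exact: cvg_cst.
- exact: (cs _ (smooth_cgrad1 sqd)).
- exact: cm.
- exact: (cs _ (smooth_cgrad2 sq')).
- exact: cvg_cst.
- exact: (cs _ (smooth_cgrad2 sqd)).
Qed.

Lemma claplace_div K qd psi : smooth qd -> test_fun (eset K) psi ->
  \int[@lb2 R]_(x in eset K) dot (cgrad qd x) (cgrad psi x) =
  - \int[@lb2 R]_(x in eset K) (claplace qd x * psi x).
Proof.
move=> sqd tp; have mK := @eset_mble R K; have [spsi _] := tp.
have ia g h : smooth g -> smooth h -> intg (@lb2 R) (eset K) (fun x => g x * h x).
  move=> sg sh; apply: sqint_mul => //; apply/L2E/L2_smooth => //; exact: eset_bounded.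
have s1 := smooth_cgrad1 sqd; have s2 := smooth_cgrad2 sqd.
have i1 := ia _ _ s1 (smooth_cgrad1 spsi); have i2 := ia _ _ s2 (smooth_cgrad2 spsi).
have j1 := ia _ _ (smoothD_v (1, 0) s1) spsi; have j2 := ia _ _ (smoothD_v (0, 1) s2) spsi.
have e1 := ibp_test mK s1 tp (@Rint_D1 R _); have e2 := ibp_test mK s2 tp (@Rint_D2 R _).
have -> : \int[@lb2 R]_(x in eset K) dot (cgrad qd x) (cgrad psi x) =
  \int[@lb2 R]_(x in eset K) ((cgrad qd x).1 * (cgrad psi x).1) + \int[@lb2 R]_(x in eset K) ((cgrad qd x).2 *
      (cgrad psi x).2).
  by rewrite -(RintegralD mK i1 i2).
have -> : \int[@lb2 R]_(x in eset K) (claplace qd x * psi x) =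
  \int[@lb2 R]_(x in eset K) ('D_(1, 0) (fun x => (cgrad qd x).1) x * psi x) + \int[@lb2 R]_(x in eset K) ('D_(0,
      1) (fun x => (cgrad qd x).2) x * psi x).
  by rewrite -(RintegralD mK j1 j2); apply: Rint_ext => x _; rewrite mulrDl.
by rewrite e1 e2 opprD.
Qed.

Lemma flux_ext_div Om mu K v q qd c d :
  {within closure Om `*` [set t : R | 0 <= t], continuous (fun z : plane R * R => mu z.1 z.2)} ->
  eset K `<=` Om -> smooth q -> smooth qd -> (forall x, eset K x -> v x = q x) ->
  is_div (eset K) (flux mu v) d ->
  forall psi, test_fun (eset K) psi ->
  \int[@lb2 R]_(x in eset K) dot (flux_ext mu q qd c x) (cgrad psi x) =
  - \int[@lb2 R]_(x in eset K) ((d x + c * claplace qd x) * psi x).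
Proof.
move=> cmu KO sq' sqd hv [md ld hd] psi tp; have mK := @eset_mble R K; have [spsi _] := tp.
have vc0 := flux_ext_vcont 0 cmu KO sq' sqd.
have i1 : intg (@lb2 R) (eset K) (fun x => dot (flux_ext mu q qd 0 x) (cgrad psi x)).
  have [c1 c2] := vc0; apply: (intD mK).
    exact: int_cont_smooth c1 (smooth_cgrad1 spsi).
  exact: int_cont_smooth c2 (smooth_cgrad2 spsi).
have ia g h : smooth g -> smooth h -> intg (@lb2 R) (eset K) (fun x => g x * h x).
  move=> sg sh; apply: sqint_mul => //; apply/L2E/L2_smooth => //; exact: eset_bounded.
have i2 : intg (@lb2 R) (eset K) (fun x => dot (cgrad qd x) (cgrad psi x)).
  by apply: (intD mK); [exact: ia (smooth_cgrad1 sqd) (smooth_cgrad1 spsi)|exact: ia (smooth_cgrad2 sqd)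
      (smooth_cgrad2 spsi)].
have -> : \int[@lb2 R]_(x in eset K) dot (flux_ext mu q qd c x) (cgrad psi x) =
   \int[@lb2 R]_(x in eset K) dot (flux_ext mu q qd 0 x) (cgrad psi x) + c * \int[@lb2 R]_(x in eset K) dot
       (cgrad qd x) (cgrad psi x).
  rewrite -(RintegralZl _ _ i2)// -(RintegralD mK i1); last exact: intZ.
  by apply: Rint_ext => x _; rewrite /flux_ext !dotDZl mul0r addr0.
have id : intg (@lb2 R) (eset K) (fun x => d x * psi x).
  by apply: loc_test_int => // C cC CK; apply/integrable_leb2; exact: ld.
have sl : smooth (claplace qd).
  exact: smoothD (smoothD_v (1, 0) (smooth_cgrad1 sqd)) (smoothD_v (0, 1) (smooth_cgrad2 sqd)).
have il := ia _ _ sl spsi.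
have -> : \int[@lb2 R]_(x in eset K) ((d x + c * claplace qd x) * psi x) =
  \int[@lb2 R]_(x in eset K) (d x * psi x) + c * \int[@lb2 R]_(x in eset K) (claplace qd x * psi x).
  rewrite -(RintegralZl _ _ il)// -(RintegralD mK id); last exact: intZ.
  by apply: Rint_ext => x _; rewrite mulrDl mulrA.
rewrite claplace_div// mulrN opprD; congr (_ + _).
have := hd _ tp; rewrite !lb2E => <-; apply: Rint_ext => x Kx.
by rewrite /flux (near_cgrad (near_eset hv Kx)) /flux_ext scale0r addr0.
Qed.

Variables (Om : set (plane R)) (mu f : plane R -> R -> R) (a1 a2 b1 b2 CP : R).
Hypotheses (oO : open Om) (bO : bounded_set Om).
Hypothesis cmu : {within closure Om `*` [set t : R | 0 <= t],
     continuous (fun z : plane R * R => mu z.1 z.2)}.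
Hypothesis cf : {within closure Om `*` [set: R],
     continuous (fun z : plane R * R => f z.1 z.2)}.
Hypotheses (a21 : a2 <= a1) (a20 : 0 < a2) (b21 : b2 <= b1) (b20 : 0 <= b2).
Hypothesis hmu : forall (x : plane R) (t s : R), closure Om x -> 0 <= s -> s <= t ->
     a2 * (t - s) <= mu x t * t - mu x s * s /\
     mu x t * t - mu x s * s <= a1 * (t - s).
Hypothesis hf : forall (x : plane R) (t s : R), closure Om x -> s <= t ->
     b2 * (t - s) <= f x t - f x s /\ f x t - f x s <= b1 * (t - s).
Let mO : mble Om := open_mble oO.

Definition weak_residual (L : R) v del w x : R :=
  (mu x (enorm (wgrad Om v x)) * dot (wgrad Om v x) (wgrad Om w x) + f x (v x) * w x)
  + L ^+ 2 * (a2 * dot (wgrad Om del x) (wgrad Om w x) + b2 * (del x * w x)).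

Definition strong_residual (L : R) v del d x : R := f x (v x) - d x + L ^+ 2 * opF a2 b2 del x.

Lemma fO_int v w : H1 Om v -> H1 Om w -> intg (@lb2 R) Om (fun x =>
  mu x (enorm (wgrad Om v x)) * dot (wgrad Om v x) (wgrad Om w x) + f x (v x) * w x).
Proof. exact: (formA_int oO bO cmu cf a21 a20 b21 b20 hmu hf). Qed.

Lemma weak_residual_int L v del w : H1 Om v -> H1 Om del -> H1 Om w -> intg (@lb2 R) Om (weak_residual L v del w).
Proof.
move=> hv hd hw; apply: (intD mO); first exact: fO_int.
by apply: (intZ mO); exact: ip_int.
Qed.

Lemma opF_ext K del qd x : (forall x, eset K x -> del x = qd x) -> eset K x ->
  opF a2 b2 del x = - a2 * claplace qd x + b2 * qd x.
Proof. by move=> h Kx; rewrite /opF (h _ Kx) (near_claplace (near_eset h Kx)). Qed.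

Lemma opF_sq K del qd : smooth qd -> (forall x, eset K x -> del x = qd x) -> sq (eset K) (opF a2 b2 del).
Proof.
move=> sqd h; have mK := @eset_mble R K.
have sl : smooth (claplace qd).
  exact: smoothD (smoothD_v (1, 0) (smooth_cgrad1 sqd)) (smoothD_v (0, 1) (smooth_cgrad2 sqd)).
have s := smoothD (smoothZ (- a2) sl) (smoothZ b2 sqd).
have : sq (eset K) (fun x => - a2 * claplace qd x + b2 * qd x).
  by apply/L2E/(L2_smooth mK _ s); exact: eset_bounded.
by apply: (sqint_ext mK) => x Kx; rewrite (opF_ext h Kx).
Qed.

Lemma f_cell_sq K v : eset K `<=` Om -> sq (eset K) v -> sq (eset K) (fun x => f x (v x)).
Proof. by move=> KO; exact: (@f_sq R Om f b1 b2 bO cf b21 b20 hf _ v (@eset_mble R K) KO). Qed.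

(** Green's formula for the field [flux_ext], whose divergence
    [d + L^2 a2 laplace qd] is square integrable because the strong residual is. *)
Lemma cell_identity L K v del q qd d w tau (phi : nat -> plane R -> R) :
  eset K `<=` Om -> smooth q -> smooth qd ->
  (forall x, eset K x -> v x = q x) -> (forall x, eset K x -> del x = qd x) ->
  is_div (eset K) (flux mu v) d -> sq (eset K) (strong_residual L v del d) ->
  H1 Om v -> H1 Om del -> H1 Om w ->
  (forall n, smooth (phi n)) -> H1cvg Om phi w (wgrad Om w) ->
  (forall e, e \in edges K -> sqint (@lb1 R) `[0, 1] (fun s => tau (param e s)) /\
           nrm (@lb1 R) `[0, 1] (fun s => phi n (param e s) - tau (param e s)) @[n --> \oo] --> (0 : R)) ->
  \int[@lb2 R]_(x in eset K) weak_residual L v del w x =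
  \sum_(e <- edges K) edge_integral e (fun x => dot (flux_ext mu q qd (L ^+ 2 * a2) x) (onormal K e) * tau x) +
  \int[@lb2 R]_(x in eset K) (strong_residual L v del d x * w x).
Proof.
move=> KO sq' sqd hv hdel hd sr Hv Hdel Hw sp cv htau; have mK := @eset_mble R K.
have [gw sw0] := H1_sq Hw; have [gv sv0] := H1_sq Hv; have [gd sd0] := H1_sq Hdel.
have sub h : sq Om h -> sq (eset K) h by move=> sh; exact: (sqint_sub mK mO KO).
have swK := sub _ sw0; have gwK : vsq (eset K) (wgrad Om w) by split; apply: sub; [case: gw|case: gw].
pose D x := d x + (L ^+ 2 * a2) * claplace qd x.
have vc := flux_ext_vcont (L ^+ 2 * a2) cmu KO sq' sqd.
have sD : sq (eset K) D.
  have h1 := sqintB mK (sqintD mK (f_cell_sq KO (sub _ sv0)) (sqintZ mK (L ^+ 2 * b2) (sub _ sd0))) sr.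
  apply: (sqint_ext mK) h1 => x Kx.
  by rewrite /D /strong_residual (opF_ext hdel Kx) (hdel _ Kx); ring.
have cvK : H1cvg (eset K) phi w (wgrad Om w).
  have sO psi : smooth psi -> sq Om psi by move=> spsi; apply/L2E/L2_smooth.
  have S g F : (forall n, sq Om (g n)) -> sq Om F -> nrm2 Om (fun x => g n x - F x) @[n --> \oo] --> (0 : R) ->
    nrm2 (eset K) (fun x => g n x - F x) @[n --> \oo] --> (0 : R).
    move=> sg sF; apply: cvg0_le => n; rewrite nrm_ge0/=.
    exact: (nrm_sub mK mO KO (sqintB mO (sg n) sF)).
  have [d0 d1 d2] := cv; have [gw1 gw2] := gw; split.
  - exact: (S phi w (fun n => sO _ (sp n)) sw0 d0).
  - exact: (S (fun n x => (cgrad (phi n) x).1) (fun x => (wgrad Om w x).1) (fun n => sO _ (smooth_cgrad1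
      (sp n))) gw1 d1).
  - exact: (S (fun n x => (cgrad (phi n) x).2) (fun x => (wgrad Om w x).2) (fun n => sO _ (smooth_cgrad2
      (sp n))) gw2 d2).
have G := green_cell vc sD (flux_ext_div (L ^+ 2 * a2) cmu KO sq' sqd hv hd) sp swK gwK cvK htau.
rewrite /edge_integral -G.
have i1 : intg (@lb2 R) (eset K) (fun x => dot (flux_ext mu q qd (L ^+ 2 * a2) x) (wgrad Om w x) + D x * w x).
  apply: (intD mK); last exact: (sqint_mul mK sD swK).
  by apply: (vsq_dot mK) gwK; have [c1 c2] := vc; split; exact: cont_sq.
have i2 := sqint_mul mK sr swK.
rewrite -(RintegralD mK i1 i2).
have ev := wgrad_cell mO KO Hv sq' hv; have ed := wgrad_cell mO KO Hdel sqd hdel.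
apply: Rint_ae => //; last first.
- exact: int_meas (intD mK i1 i2).
- exact: int_meas (integrableS mO mK KO (weak_residual_int L Hv Hdel Hw)).
apply: all_aeS2 ev ed => x hx1 hx2 Kx; rewrite /weak_residual (hx1 Kx) (hx2 Kx) /D /flux_ext /strong_residual
    (opF_ext hdel Kx) (hdel _ Kx).
move: (cgrad q x) (cgrad qd x) (wgrad Om w x) (claplace qd x) => g1 g2 g3 l.
by rewrite /dot /= /GRing.scale /=; ring.
Qed.

End CellIdentity.

(** * The a posteriori estimate *)

Section Final.
Variable R : realType.
Implicit Types (K : element R) (x y z : plane R) (e : edge R).
Local Notation sq := (sqint (@lb2 R)).
Local Notation nrm2 := (nrm (@lb2 R)).
Local Notation aeD D P := (all_ae (@lb2 R) (fun x => D x -> P x)).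

Variables (Om : set (plane R)) (mu f : plane R -> R -> R) (a1 a2 b1 b2 CP : R).
Hypotheses (oO : open Om) (bO : bounded_set Om).
Hypothesis cmu : {within closure Om `*` [set t : R | 0 <= t],
     continuous (fun z : plane R * R => mu z.1 z.2)}.
Hypothesis cf : {within closure Om `*` [set: R],
     continuous (fun z : plane R * R => f z.1 z.2)}.
Hypotheses (a21 : a2 <= a1) (a20 : 0 < a2) (b21 : b2 <= b1) (b20 : 0 <= b2).
Hypothesis hmu : forall (x : plane R) (t s : R), closure Om x -> 0 <= s -> s <= t ->
     a2 * (t - s) <= mu x t * t - mu x s * s /\
     mu x t * t - mu x s * s <= a1 * (t - s).
Hypothesis hf : forall (x : plane R) (t s : R), closure Om x -> s <= t ->
     b2 * (t - s) <= f x t - f x s /\ f x t - f x s <= b1 * (t - s).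
Let mO : mble Om := open_mble oO.
Local Notation A := (formA Om mu f).
Local Notation E := (energy Om a2 b2).
Local Notation IP := (ip Om a2 b2).

Lemma H1B v w : H1 Om v -> H1 Om w -> H1 Om (v - w).
Proof.
move=> hv hw; have [lv _] := hv; have [lw _] := hw; split; first exact: L2B.
by eexists; apply: wgradB => //; exact: wgradP.
Qed.

Lemma formA_subr v w1 w2 : H1 Om v -> H1 Om w1 -> H1 Om w2 -> A v (w1 - w2) = A v w1 - A v w2.
Proof.
move=> hv h1 h2; have h12 := H1B h1 h2.
have i (w : plane R -> R) : H1 Om w -> _ := fun hw => formA_int oO bO cmu cf a21 a20 b21 b20 hmu hf hv hw.
rewrite /formA !lb2E -(RintegralB mO (i _ h1) (i _ h2)).
have ew := wgradB_ae oO h1 h2.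
apply: Rint_ae => //; [|exact: int_meas (i _ h12)|exact: int_meas (intB mO (i _ h1) (i _ h2))].
by apply: all_aeS ew => x hx Ox; rewrite (hx Ox) -[(w1 - w2) x]/(w1 x - w2 x) dotBr !mulrBr opprD addrACA.
Qed.

Lemma ip_subr v w1 w2 : H1 Om v -> H1 Om w1 -> H1 Om w2 -> IP v (w1 - w2) = IP v w1 - IP v w2.
Proof.
move=> hv h1 h2; have h12 := H1B h1 h2.
have i (w : plane R -> R) : H1 Om w -> _ := fun hw => ip_int oO a2 b2 hv hw.
rewrite /ip !lb2E -(RintegralB mO (i _ h1) (i _ h2)).
have ew := wgradB_ae oO h1 h2.
apply: Rint_ae => //; [|exact: int_meas (i _ h12)|exact: int_meas (intB mO (i _ h1) (i _ h2))].
by apply: all_aeS ew => x hx Ox; rewrite (hx Ox) -[(w1 - w2) x]/(w1 x - w2 x) dotBr !mulrBr opprD addrACA.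
Qed.

Lemma ipC v w : IP v w = IP w v.
Proof.
by rewrite /ip; congr Rintegral; apply/funext => x; rewrite dotC [v x * _]mulrC.
Qed.

Lemma cauchy_schwarz_ip v w : H1 Om v -> H1 Om w -> `|IP v w| <= E v * E w.
Proof.
move=> hv hw; have [gv sv] := H1_sq hv; have [gw sw] := H1_sq hw.
have s1 := vsq_enorm mO gv; have s2 := vsq_enorm mO gw.
have i1 := vsq_dot mO gv gw; have i2 := sqint_mul mO sv sw.
have -> : IP v w = a2 * \int[@lb2 R]_(x in Om) dot (wgrad Om v x) (wgrad Om w x) + b2 * \int[@lb2 R]_(x in Om)
    (v x * w x).
  rewrite -(RintegralZl _ _ i1)// -(RintegralZl _ _ i2)// -(RintegralD mO)//; exact: intZ.
have e0 q : 0 <= E q by exact: sqrtr_ge0.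
have nE q : H1 Om q -> E q = Num.sqrt (a2 * L2vnorm Om (wgrad Om q) ^+ 2 + b2 * L2norm Om q ^+ 2).
  by move=> hq; rewrite -(energy_sqr oO a20 b20 hq) sqrtr_sqr ger0_norm.
rewrite (nE _ hv) (nE _ hw).
apply: le_trans (cauchy_schwarz2 _ _ _ _ (ltW a20) b20).
apply: (le_trans (ler_normD _ _)); rewrite !normrM (gtr0_norm a20) (ger0_norm b20).
apply: lerD; apply: ler_wpM2l => //; first exact: ltW.
  rewrite !vsq_norm//; apply: le_trans (cauchy_schwarz mO s1 s2).
  apply: le_trans (ler_norm _); apply: (le_trans (le_normr_Rintegral mO i1)).
  by apply: (le_Rintegral mO (int_abs i1) (sqint_mul mO s1 s2)) => x _; exact: dot_le.
exact: cauchy_schwarz.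
Qed.

Lemma weak_residual_form L v del w : H1 Om v -> H1 Om del -> H1 Om w ->
  \int[@lb2 R]_(x in Om) weak_residual Om mu f a2 b2 L v del w x = A v w + L ^+ 2 * IP del w.
Proof.
move=> hv hd hw; have i1 := formA_int oO bO cmu cf a21 a20 b21 b20 hmu hf hv hw.
have i2 := ip_int oO a2 b2 hd hw.
by rewrite /formA /ip !lb2E -(RintegralZl _ _ i2)// -(RintegralD mO i1)//; exact: intZ.
Qed.

Definition eta_real (g : R) (rho J : R) : R := g * rho ^+ 2 + 2^-1 * (Num.sqrt a2)^-1 * Num.sqrt g * J.

Lemma eta_real_ge0 g rho J : 0 < g -> 0 <= J -> 0 <= eta_real g rho J.
Proof.
move=> g0 J0; have c0 : 0 <= 2^-1 * (Num.sqrt a2)^-1 * Num.sqrt g by rewrite !mulr_ge0 ?invr_ge0 ?sqrtr_ge0.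
exact: addr_ge0 (mulr_ge0 (ltW g0) (sqr_ge0 _)) (mulr_ge0 c0 J0).
Qed.

Definition jump_sq (T : mesh R) (S : 'I_(ncells T) -> plane R -> plane R) k : R :=
  \sum_(e <- edges (cell T k)) enorm (e.2 - e.1) * nrm (@lb1 R) (inner_params Om e) (fun s => jump_ext S e
      (param e s)) ^+ 2.

Lemma jump_sq_ge0 T S k : 0 <= @jump_sq T S k.
Proof. by apply: sumr_ge0 => e _; rewrite mulr_ge0 ?enorm_ge0 ?sqr_ge0. Qed.

(** Add [cell_identity] over the cells, gather the edge terms with [jump_sum], and
    apply the Cauchy-Schwarz inequality on each cell and to the sum over cells. *)
Lemma residual_bound L (T : mesh R) v del w tau (q qd d : 'I_(ncells T) -> plane R -> R) (phi : nat -> plane R -> R)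
   (S := fun k => flux_ext mu (q k) (qd k) (L ^+ 2 * a2)) :
  partition_of Om T -> no_hanging_nodes T ->
  (forall k, smooth (q k)) -> (forall k, smooth (qd k)) ->
  (forall k x, eset (cell T k) x -> v x = q k x) -> (forall k x, eset (cell T k) x -> del x = qd k x) ->
  (forall k, is_div (eset (cell T k)) (flux mu v) (d k)) ->
  (forall k, sq (eset (cell T k)) (strong_residual f a2 b2 L v del (d k))) ->
  H1 Om v -> H1 Om del -> H1 Om w ->
  (forall n, smooth (phi n)) -> H1cvg Om phi w (wgrad Om w) ->
  (forall x, bdry Om x -> tau x = 0) ->
  (forall k e, e \in edges (cell T k) -> sqint (@lb1 R) `[0, 1] (fun s => tau (param e s)) /\
           nrm (@lb1 R) `[0, 1] (fun s => phi n (param e s) - tau (param e s)) @[n --> \oo] --> (0 : R)) ->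
  `|\int[@lb2 R]_(x in Om) weak_residual Om mu f a2 b2 L v del w x| <=
  Num.sqrt (\sum_(k < ncells T) eta_real (gammaK a2 b2 (cell T k)) (nrm2 (eset (cell T k))
      (strong_residual f a2 b2 L v del (d k))) (jump_sq S k)) *
  Num.sqrt (\sum_(k < ncells T)
      ((gammaK a2 b2 (cell T k))^-1 * L2norm (eset (cell T k)) w ^+ 2
       + a2 * L2vnorm (eset (cell T k)) (wgrad Om w) ^+ 2
       + 2^-1 * Num.sqrt a2 * (Num.sqrt (gammaK a2 b2 (cell T k)))^-1
         * L2bdnorm (cell T k) tau ^+ 2)).
Proof.
move=> hp nh sq' sqd hv hdel hd sr Hv Hdel Hw sp cv tau0 htau.
have [h1 _ _] := hp.
have vc k : vcont (cell T k) (S k) by exact: flux_ext_vcont cmu (h1 k) (sq' k) (sqd k).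
have st k e : e \in edges (cell T k) -> sqint (@lb1 R) `[0, 1] (fun s => tau (param e s)).
  by move=> he; have [] := htau k e he.
have iF := weak_residual_int oO bO cmu cf a21 a20 b21 b20 hmu hf L Hv Hdel Hw.
rewrite (Rint_cells mO hp iF).
have cid k := cell_identity oO bO cmu cf a21 a20 b21 b20 hmu hf (h1 k) (sq' k) (sqd k) (hv k) (hdel k) (hd k)
    (sr k) Hv Hdel Hw sp cv (htau k).
rewrite (eq_bigr _ (fun k _ => cid k)) big_split /=.
rewrite (jump_sum oO hp nh vc tau0 st) mulr_sumr -big_split /=.
have [_ sw0] := H1_sq Hw.
have cellb k : `|2^-1 * (\sum_(e <- edges (cell T k)) edge_integral e (fun x => jump_ext S e x * tau x)) +
    \int[@lb2 R]_(x in eset (cell T k)) (strong_residual f a2 b2 L v del (d k) x * w x)| <=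
   nrm2 (eset (cell T k)) (strong_residual f a2 b2 L v del (d k)) * L2norm (eset (cell T k)) w
    + 2^-1 * (Num.sqrt (jump_sq S k) * L2bdnorm (cell T k) tau).
  have mK := @eset_mble R (cell T k).
  have swK : sq (eset (cell T k)) w := sqint_sub mK mO (h1 k) sw0.
  apply: (le_trans (ler_normD _ _)); rewrite addrC; apply: lerD; first exact: cauchy_schwarz.
  rewrite normrM ger0_norm//; apply: ler_wpM2l => //.
  apply: (le_trans (ler_norm_sum _ _ _)).
  pose al e := Num.sqrt (enorm (e.2 - e.1)) * nrm (@lb1 R) (inner_params Om e) (fun s => jump_ext S e (param e s)).
  pose be e := Num.sqrt (enorm (e.2 - e.1)) * nrm (@lb1 R) `[0, 1] (fun s => tau (param e s)).
  apply: (@le_trans _ _ (\sum_(e <- edges (cell T k)) al e * be e)).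
    rewrite big_seq [leRHS]big_seq; apply: ler_sum => e he.
    exact: (edge_integral_bound oO vc he tau0 (st k e he)).
  have al0 e : 0 <= al e by rewrite mulr_ge0 ?sqrtr_ge0.
  have be0 e : 0 <= be e by rewrite mulr_ge0 ?sqrtr_ge0.
  apply: (le_trans (cauchy_schwarz_sum _ al0 be0)); rewrite le_eqVlt; apply/orP; left; apply/eqP.
  congr (Num.sqrt _ * Num.sqrt _); apply: eq_bigr => e _; rewrite exprMn sqr_sqrtr ?enorm_ge0//.
  by rewrite nrm_sqr.
apply: (le_trans (ler_norm_sum _ _ _)).
apply: (@le_trans _ _ (\sum_(k < ncells T)
   Num.sqrt (eta_real (gammaK a2 b2 (cell T k)) (nrm2 (eset (cell T k)) (strong_residual f a2 b2 L v del (d k)))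
       (jump_sq S k)) *
   Num.sqrt ((gammaK a2 b2 (cell T k))^-1 * L2norm (eset (cell T k)) w ^+ 2
       + a2 * L2vnorm (eset (cell T k)) (wgrad Om w) ^+ 2
       + 2^-1 * Num.sqrt a2 * (Num.sqrt (gammaK a2 b2 (cell T k)))^-1
         * L2bdnorm (cell T k) tau ^+ 2))).
  apply: ler_sum => k _; apply: (le_trans (cellb k)).
  apply: cauchy_schwarz_cell => //; try exact: sqrtr_ge0; first exact: gammaK_gt0.
  exact: jump_sq_ge0.
apply: (le_trans (cauchy_schwarz_sum _ (fun _ => sqrtr_ge0 _) (fun _ => sqrtr_ge0 _))).
have g0 k := gammaK_gt0 (cell T k) a20 b20.
rewrite le_eqVlt; apply/orP; left; apply/eqP; congr (Num.sqrt _ * Num.sqrt _); apply: eq_bigr => k _;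
    rewrite sqr_sqrtr//.
  by apply: eta_real_ge0 => //; exact: jump_sq_ge0.
by rewrite !addr_ge0// !mulr_ge0 ?invr_ge0 ?sqrtr_ge0 ?sqr_ge0 ?(ltW (g0 k)) ?(ltW a20).
Qed.

End Final.

Lemma le_of_sqr_le_mul (R : realType) (x c : R) : 0 <= x -> 0 <= c -> x ^+ 2 <= c * x -> x <= c.
Proof.
rewrite le_eqVlt => /orP[/eqP <-//|x0] c0; by rewrite expr2 ler_pM2r.
Qed.

Lemma eta2_ge0 (R : realType) Om (a2 b2 L : R) mu f T K vnew vold : 0 < a2 -> 0 <= b2 ->
  (0 <= eta2 Om a2 b2 L mu f T K vnew vold)%E.
Proof.
move=> a20 b20; apply: adde_ge0; apply: mule_ge0.
- by rewrite lee_fin ltW// gammaK_gt0.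
- exact: residual_ge0.
- by rewrite lee_fin !mulr_ge0 ?invr_ge0 ?sqrtr_ge0.
- exact: jump_norm2_ge0.
Qed.

Lemma sum_pinfty (R : realType) n (F : 'I_n -> \bar R) k : (forall i, 0 <= F i)%E -> F k = +oo%E ->
  (\sum_(i < n) F i = +oo)%E.
Proof.
move=> F0 Fk; rewrite (bigD1 k)//= Fk addye// gt_eqF// (lt_le_trans (ltNyr 0))//.
exact: sume_ge0.
Qed.

(** The upper bound [- An] is the sum of [- (An - Ao)], [- (Ao + L^2 I)] and
    [L^2 I]. *)
Lemma energy_arith (R : realType) (L CI Eta An Ao I Ee Ed : R) : 0 <= L ->
  Ee ^+ 2 <= - An -> `|An - Ao| <= L * (Ed * Ee) -> `|I| <= Ed * Ee ->
  `|Ao + L ^+ 2 * I| <= Eta * (CI * Ee) ->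
  Ee ^+ 2 <= (CI * Eta + L * (1 + L) * Ed) * Ee.
Proof.
move=> L0 m1 m2 m3 m4; apply: (le_trans m1).
have -> : - An = - (An - Ao) + (- (Ao + L ^+ 2 * I) + L ^+ 2 * I) by ring.
have -> : (CI * Eta + L * (1 + L) * Ed) * Ee = L * (Ed * Ee) + (Eta * (CI * Ee) + L ^+ 2 * (Ed * Ee)) by ring.
apply: lerD; first by apply: le_trans m2; rewrite -normrN ler_norm.
apply: lerD; first by apply: le_trans m4; rewrite -normrN ler_norm.
by apply: ler_wpM2l; [exact: sqr_ge0|exact: le_trans (ler_norm _) m3].
Qed.

Theorem theorem3p26 (R : realType) (Om : set (plane R))
    (mu f : plane R -> R -> R) (a1 a2 b1 b2 CP CI : R)
    (p : nat) (T : nat -> mesh R)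
    (u : plane R -> R) (uh : nat -> nat -> plane R -> R) (nstar : nat -> nat)
    (L := Lconst a1 a2 b1 b2 CP) :
  polygonal_lipschitz_domain Om ->
  {within closure Om `*` [set t : R | 0 <= t],
     continuous (fun z : plane R * R => mu z.1 z.2)} ->
  {within closure Om `*` [set: R],
     continuous (fun z : plane R * R => f z.1 z.2)} ->
  a2 <= a1 -> 0 < a2 -> b2 <= b1 -> 0 <= b2 ->
  (forall (x : plane R) (t s : R), closure Om x -> 0 <= s -> s <= t ->
     a2 * (t - s) <= mu x t * t - mu x s * s /\
     mu x t * t - mu x s * s <= a1 * (t - s)) ->
  (forall (x : plane R) (t s : R), closure Om x -> s <= t ->
     b2 * (t - s) <= f x t - f x s /\
     f x t - f x s <= b1 * (t - s)) ->
  0 < CP ->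
  (forall v, H10 Om v -> L2norm Om v <= CP * L2vnorm Om (wgrad Om v)) ->
  (forall i, partition_of Om (T i) /\ no_hanging_nodes (T i)) ->
  shape_regular T ->
  (1 <= p)%N ->
  0 < CI ->
  (forall i, interpolation_bound Om a2 b2 CI p (T i)) ->
  H10 Om u ->
  (forall v, H10 Om v -> formA Om mu f u v = 0) ->
  (forall i n, VFEM Om p (T i) (uh i n)) ->
  (forall i n, (1 <= n)%N -> forall v, VFEM Om p (T i) v ->
     ip Om a2 b2 (uh i n) v =
       ip Om a2 b2 (uh i n.-1) v - L ^- 2 * formA Om mu f (uh i n.-1) v) ->
  (forall i, (0 < i)%N ->
     exists2 P, is_projection Om (VFEM Om p (T i.-1)) (VFEM Om p (T i)) P &
       eq_ae Om (uh i 0%N) (P (uh i.-1 (nstar i.-1)))) ->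
  forall i n, (1 <= n)%N ->
    ((energy Om a2 b2 (u - uh i n))%:E
     <= CI%:E * sqrte (\sum_(k < ncells (T i))
          eta2 Om a2 b2 L mu f (T i) (cell (T i) k) (uh i n) (uh i n.-1))
        + (L * (1 + L) * energy Om a2 b2 (uh i n - uh i n.-1))%:E)%E.
Proof.
move=> [[_ _ oO] [bO _ _]] cmu cf a21 a20 b21 b20 hmu hf CP0 poinc hT _ _ CI0 hint hu Au hV hit _ i n n1.
have [hp nh] := hT i; have hint' := hint i; have Vn := hV i n; have Vo := hV i n.-1.
have hit' := hit i n n1.
move: (T i) (uh i n) (uh i n.-1) hp nh hint' Vn Vo hit' => Ti vn vo {uh T hT hV hit hint} hp nh hint Vn Vo hit.
have [hvn Svn] := Vn; have [hvo Svo] := Vo.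
have [h1 _ _] := hp.
have mO := open_mble oO.
pose del := vn - vo; pose e := u - vn; pose ce := clement Om p Ti e; pose w := e - ce.
have he : H10 Om e by exact: H10B.
have Vce : VFEM Om p Ti ce by exact: clement_VFEM.
have [hce _] := Vce.
have hw : H10 Om w by exact: H10B.
have hdel : H10 Om del by exact: H10B.
have L1 := L_ge1 a20 a21 b20 b21 CP0; rewrite -/L in L1.
have L0 : 0 < L by exact: lt_le_trans L1.
pose res k := residual_norm2 a2 b2 L mu f (cell Ti k) vo del.
(* one infinite residual makes the right-hand side infinite *)
have [fin|/existsNP[k /negP]] := pselect (forall k, (res k < +oo)%E); last first.
  rewrite -leNgt leye_eq => /eqP rk.
  have Ek : eta2 Om a2 b2 L mu f Ti (cell Ti k) vn vo = +oo%E.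
    rewrite /eta2 -/del -/(res k) rk gt0_muley ?lte_fin ?gammaK_gt0// addye// gt_eqF// (lt_le_trans (ltNyr 0))//.
    by apply: mule_ge0; [rewrite lee_fin !mulr_ge0 ?invr_ge0 ?sqrtr_ge0|exact: jump_norm2_ge0].
  have Es := sum_pinfty (fun j => eta2_ge0 Om L mu f Ti (cell Ti j) vn vo a20 b20) Ek.
  rewrite Es (_ : sqrte +oo = +oo)%E// gt0_muley ?lte_fin// addye//.
  exact: leey.
have exq k : exists q, smooth q /\ forall x, eset (cell Ti k) x -> vo x = q x.
  by have [q0 sq0 hq0] := Sp_smooth (Svo k); exists q0.
have exqd k : exists q, smooth q /\ forall x, eset (cell Ti k) x -> del x = q x.
  have [q0 sq0 hq0] := Sp_smooth (Sp_lin 1 (-1) (Svn k) (Svo k)); exists q0; split => // x Kx.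
  by rewrite -hq0// mul1r mulN1r.
have exd k : exists d, is_div (eset (cell Ti k)) (flux mu vo) d.
  by have := fin k; rewrite /res /residual_norm2 => /ereal_inf_lt[_ [d hd _] _]; exists d.
have [q hq] := choice exq; have [qd hqd] := choice exqd; have [d hd] := choice exd.
have Hvo := proj1 hvo; have Hdel := proj1 hdel; have Hw := proj1 hw; have He := proj1 he.
have [_ svo] := H1_sq Hvo.
pose r k := strong_residual f a2 b2 L vo del (d k).
have sfK k : sqint (@lb2 R) (eset (cell Ti k)) (fun x => f x (vo x)).
  apply: (f_cell_sq bO cf b21 b20 hf (h1 k)); exact: (sqint_sub (@eset_mble R _) mO (h1 k) svo).
have soK k : sqint (@lb2 R) (eset (cell Ti k)) (opF a2 b2 del) by exact: opF_sq (proj1 (hqd k)) (proj2 (hqd k)).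
have resE k : res k = (\int[@lb2 R]_(x in eset (cell Ti k)) (r k x ^+ 2)%:E)%E.
  apply: residual_norm2E => //; have [m1 _] := sfK k; have [m2 _] := soK k.
  by apply: measurable_funD => //; exact: measurable_funM.
have sr k : sqint (@lb2 R) (eset (cell Ti k)) (r k).
  have mr : measurable_fun (eset (cell Ti k) : set (mplane R)) (r k).
    have [m1 _] := sfK k; have [m2 _] := soK k; have [md _ _] := hd k.
    by apply: measurable_funD; [exact: measurable_funB|exact: measurable_funM].
  split => //; apply/integrableP; split; first by apply/measurable_EFinP; exact: measurable_funX.
  apply: le_lt_trans (fin k); rewrite resE le_eqVlt; apply/orP; left; apply/eqP; apply: eq_integral => x _ /=.
  by rewrite ger0_norm// sqr_ge0.
have [tau [phi [tau0 tphi cphi htr]]] := trace_exists oO bO hw.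
pose S k := flux_ext mu (q k) (qd k) (L ^+ 2 * a2).
have vc k : vcont (cell Ti k) (S k) by exact: flux_ext_vcont cmu (h1 k) (proj1 (hq k)) (proj1 (hqd k)).
have etaE k : eta2 Om a2 b2 L mu f Ti (cell Ti k) vn vo =
  (eta_real a2 (gammaK a2 b2 (cell Ti k)) (nrm (@lb2 R) (eset (cell Ti k)) (r k)) (jump_sq Om S k))%:E.
  have mK := @eset_mble R (cell Ti k).
  rewrite /eta2 -/del -/(res k) resE -(Rint_fin mK); last by case: (sr k).
  rewrite (jump_norm2E k oO vc); first by rewrite -!EFinM -EFinD /eta_real nrm_sqr.
  move=> m x Kx; rewrite /S /flux_ext /flux (near_cgrad (near_eset (proj2 (hq m)) Kx)) (near_cgrad (near_eset
      (proj2 (hqd m)) Kx)) //.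
rewrite (eq_bigr _ (fun k _ => etaE k)) sumEFin /= -EFinM -EFinD lee_fin.
have e0 v : 0 <= energy Om a2 b2 v by exact: sqrtr_ge0.
have Bnd := residual_bound oO bO cmu cf a21 a20 b21 b20 hmu hf (L := L) hp nh (fun k => proj1 (hq k)) (fun k =>
    proj1 (hqd k))
  (fun k => proj2 (hq k)) (fun k => proj2 (hqd k)) hd sr Hvo Hdel Hw (fun m => proj1 (tphi m)) cphi tau0
  (fun k e1 he1 => proj2 (htr _ (h1 k)) e1 he1).
set Eta := Num.sqrt _ in Bnd *.
have Th := hint e he (fun=> tau) (fun k => proj1 (htr _ (h1 k))).
have {}Bnd : `|formA Om mu f vo w + L ^+ 2 * ip Om a2 b2 del w| <= Eta * (CI * energy Om a2 b2 e).
  rewrite -(weak_residual_form oO bO cmu cf a21 a20 b21 b20 hmu hf L Hvo Hdel Hw); apply: (le_trans Bnd).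
  apply: ler_wpM2l; first exact: sqrtr_ge0.
  have ce0 : 0 <= CI * energy Om a2 b2 e by rewrite mulr_ge0// ltW.
  rewrite -(ger0_norm ce0) -sqrtr_sqr; apply: ler_wsqrtr; rewrite exprMn; exact: Th.
have Hce := proj1 hce; have Hvn := proj1 hvn; have Hu := proj1 hu.
(* the fixed point equation: the residual functional vanishes on the finite
   element space *)
have Gal : formA Om mu f vo ce + L ^+ 2 * ip Om a2 b2 del ce = 0.
  have -> : ip Om a2 b2 del ce = ip Om a2 b2 vn ce - ip Om a2 b2 vo ce.
    by rewrite ipC (ip_subr a2 b2 oO Hce Hvn Hvo) !(ipC Om a2 b2 ce).
  rewrite (hit _ Vce) addrAC subrr add0r mulrN mulrA mulfV ?mul1r ?subrr//.
  by rewrite expf_neq0// gt_eqF.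
have Rw : formA Om mu f vo w + L ^+ 2 * ip Om a2 b2 del w = formA Om mu f vo e + L ^+ 2 * ip Om a2 b2 del e.
  rewrite /w (formA_subr oO bO cmu cf a21 a20 b21 b20 hmu hf Hvo He Hce) (ip_subr a2 b2 oO Hdel He Hce).
  by rewrite mulrBr addrACA -opprD Gal subr0.
rewrite Rw in Bnd.
have mono := formA_mono oO bO cmu cf a21 a20 b21 b20 hmu hf Hu Hvn.
have lip := formA_lip oO bO cmu cf a21 a20 b21 b20 hmu hf CP0 poinc Hvn Hvo hdel he.
have ics := cauchy_schwarz_ip oO a20 b20 Hdel He.
rewrite -/e (Au e he) sub0r in mono; rewrite -/L -/del in lip *.
apply: le_of_sqr_le_mul => //.
  have Eta0 : 0 <= Eta by exact: sqrtr_ge0.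
  exact: addr_ge0 (mulr_ge0 (ltW CI0) Eta0) (mulr_ge0 (mulr_ge0 (ltW L0) (addr_ge0 ler01 (ltW L0))) (e0 _)).
exact: energy_arith (ltW L0) mono lip ics Bnd.
Qed.
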